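(* Let $M^n\times\mathbb{R}$ be a Riemannian cylinder with a product weight $e^{\psi(p,t)}:=e^{h(p)}\,e^{v(t)}$, where $h\in C^\infty(M)$ and $v\in C^\infty(\mathbb{R})$. Suppose that there are $\lambda\geq 0$ and $a\in\mathbb{R}$ such that $v'(t)\geq\lambda$ for any $t\leq a$. Let $\Sigma$ be a two-sided, connected and $\psi$-parabolic hypersurface contained in $M\times(-\infty,a]$. Suppose that either $|H_\psi|\leq\lambda$ on $\Sigma$, or $\Sigma$ is a horizontal multigraph with $H_\psi\leq\lambda$ on $\Sigma$. Then: (i) if $\partial\Sigma\neq\emptyset$ and $\Sigma$ is tangent to $M_a$ along $\partial\Sigma$, then $\Sigma\subseteq M_a$ and the $\psi$-mean curvature of $M_a$ with respect to $-\xi$ equals $\lambda$; (ii) if $\Sigma$ is complete and has free boundary in $\partial M\times\mathbb{R}$, then $\Sigma=M_s$ for some $s\in\mathbb{R}$ such that the horizontal slice $M_s$ has $\psi$-mean curvature $\lambda$ with respect to $-\xi$.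
   Context: A Riemannian cylinder $M^n\times\mathbb{R}$ is the Riemannian product of a complete, connected, oriented $n$-dimensional Riemannian manifold $M$ (possibly with smooth boundary $\partial M$) with the standard line $\mathbb{R}$. The unit parallel vertical vector field is $\xi(p,t):=(0,1)$, and $M_s:=M\times\{s\}$ is the horizontal slice at height $s$. A weight $e^\psi$ is a positive $C^1$ function. For a two-sided smooth hypersurface $\Sigma$ (possibly with smooth boundary $\partial\Sigma$) with unit normal (Gauss map) $N$, its $\psi$-mean curvature with respect to $N$ is $H_\psi:=-\operatorname{div}_\Sigma N-\langle\nabla\psi,N\rangle$, where $\nabla\psi$ is the ambient gradient. On $\Sigma$ with the induced metric the $\psi$-Laplacian is $\Delta_{\Sigma,\psi}u:=\Delta_\Sigma u+\langle\nabla_\Sigma\psi,\nabla_\Sigma u\rangle$. The hypersurface $\Sigma$ is $\psi$-parabolic if every $u\in C^2(\Sigma)$ that is bounded from above, satisfies $\Delta_{\Sigma,\psi}u\geq 0$ on $\Sigma\setminus\partial\Sigma$ and $\partial u/\partial\nu\geq 0$ along $\partial\Sigma$ is constant, where $\nu$ is the inner unit conormal of $\Sigma$ along $\partial\Sigma$. A horizontal multigraph is a two-sided connected hypersurface with a Gauss map $N$ such that the angle function $\theta:=\langle\xi,N\rangle$ satisfies $\theta\leq 0$ on $\Sigma$; its $\psi$-mean curvature is computed with respect to this $N$. $\Sigma$ is tangent to $M_a$ along $\partial\Sigma$ if $\partial\Sigma\subset M_a$ and the tangent hyperplanes of $\Sigma$ and $M_a$ coincide at every point of $\partial\Sigma$.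 A hypersurface with $\partial\Sigma\neq\emptyset$ has free boundary in $\partial M\times\mathbb{R}$ if $\partial\Sigma=\Sigma\cap(\partial M\times\mathbb{R})$ and $\Sigma$ is orthogonal to $\partial M\times\mathbb{R}$ along $\partial\Sigma$. *)

(* Defs.v *)
From HB Require Import structures.
From mathcomp Require Import all_boot all_order all_algebra.
From mathcomp Require Import all_classical all_reals all_analysis.

Set Implicit Arguments.
Unset Strict Implicit.
Unset Printing Implicit Defensive.

Import Order.TTheory GRing.Theory Num.Theory.
Import numFieldNormedType.Exports.

Local Open Scope classical_set_scope.
Local Open Scope ring_scope.

(* Points and vectors are rows.  Row [a] of a Jacobian is the derivative in the
   direction [a], so matrices act on vectors from the right. *)

Section HalfSpace.
Variable R : realType.

(* [x_0 >= 0]; written with [val i = 0] in order to cover every dimension. *)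
Definition halfspace (m : nat) : set 'rV[R]_m :=
  [set x | forall i : 'I_m, val i = 0%N -> 0 <= x ord0 i].

Definition pquot m (i : 'I_m) (f : 'rV[R]_m -> R) (x : 'rV[R]_m) (s : R) : R :=
  s^-1 * (f (x + s *: delta_mx ord0 i) - f x).

(* Increments that stay in the half-space: the partial derivative is the usual
   one where [x_0 > 0], and one-sided in the direction 0 where [x_0 = 0]. *)
Definition pincr m (i : 'I_m) (x : 'rV[R]_m) : set R :=
  [set s | s != 0 /\ halfspace (x + s *: delta_mx ord0 i)].

Definition pderivable m (i : 'I_m) (f : 'rV[R]_m -> R) (x : 'rV[R]_m) : Prop :=
  cvg (pquot i f x @ within (pincr i x) (nbhs (0 : R))).

Definition pderiv m (i : 'I_m) (f : 'rV[R]_m -> R) (x : 'rV[R]_m) : R :=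
  lim (pquot i f x @ within (pincr i x) (nbhs (0 : R))).

(* [C^k] on a relatively open subset [U] of the half-space. *)
Fixpoint Ck m (k : nat) (U : set 'rV[R]_m) (f : 'rV[R]_m -> R) : Prop :=
  {within U, continuous f} /\
  if k is k'.+1 then
    forall i : 'I_m, (forall x, U x -> pderivable i f x) /\ Ck k' U (pderiv i f)
  else True.

Definition Cinf m (U : set 'rV[R]_m) (f : 'rV[R]_m -> R) : Prop :=
  forall k, Ck k U f.

Definition jac m k (f : 'rV[R]_m -> 'rV[R]_k) (x : 'rV[R]_m) : 'M[R]_(m, k) :=
  \matrix_(a, b) pderiv a (fun y => f y ord0 b) x.

Definition smooth_line (v : R -> R) : Prop :=
  forall (k : nat) (t : R), derivable (derive1n k v) t 1.

Definition inner m (G : 'M[R]_m) (v w : 'rV[R]_m) : R :=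
  (v *m G *m w^T) ord0 ord0.

(* [G] is the field of Gram matrices of the coordinate frame. *)
Section Coordinates.
Variables (m : nat) (G : 'rV[R]_m -> 'M[R]_m).

(* [christoffel k i j] is Gamma^k_ij. *)
Definition christoffel (k i j : 'I_m) (x : 'rV[R]_m) : R :=
  2^-1 * \sum_(l < m) invmx (G x) k l *
    (pderiv i (fun y => G y j l) x + pderiv j (fun y => G y i l) x
     - pderiv l (fun y => G y i j) x).

Definition grad (u : 'rV[R]_m -> R) (x : 'rV[R]_m) : 'rV[R]_m :=
  (\row_k pderiv k u x) *m invmx (G x).

Definition hess (u : 'rV[R]_m -> R) (x : 'rV[R]_m) : 'M[R]_m :=
  \matrix_(i, j) (pderiv i (pderiv j u) x
                  - \sum_(k < m) christoffel k i j x * pderiv k u x).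

Definition lap (u : 'rV[R]_m -> R) (x : 'rV[R]_m) : R :=
  \tr (invmx (G x) *m hess u x).

End Coordinates.
End HalfSpace.

Arguments halfspace {R} m.

(* Charts are modelled on the half-space.  [par i] is the inverse of the
   coordinate map [crd i], with irrelevant values outside [chart_cod i].
   The atlas need not be maximal; [chart_at p] is a chosen chart around [p], in
   which the tensorial expressions below are evaluated at [p]. *)
Record manifold (R : realType) (n : nat) := Manifold {
  points :> topologicalType;
  chart_index : Type;
  chart_dom : chart_index -> set points;
  crd : chart_index -> points -> 'rV[R]_n;
  par : chart_index -> 'rV[R]_n -> points;
  chart_at : points -> chart_index;
  chart_cod := fun i => crd i @` chart_dom i;
  man_hausdorff : hausdorff_space points;
  man_countable : @second_countable points;
  dom_open : forall i, open (chart_dom i);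
  crdK : forall i p, chart_dom i p -> par i (crd i p) = p;
  crd_continuous : forall i p, chart_dom i p -> {for p, continuous (crd i)};
  par_continuous : forall i, {within chart_cod i, continuous (par i)};
  cod_open : forall i, exists2 W, open W & chart_cod i = W `&` halfspace n;
  dom_chart_at : forall p, chart_dom (chart_at p) p;
  transition_smooth : forall i j b,
    Cinf [set x | chart_cod i x /\ chart_dom j (par i x)]
      (fun x => crd j (par i x) ord0 b)
}.

Section Manifolds.
Variables (R : realType) (n : nat).
Implicit Types M : manifold R n.

Definition boundary M : set M :=
  [set p | exists2 i : chart_index M, chart_dom i p &
    forall k : 'I_n, val k = 0%N -> crd i p ord0 k = 0].

Definition Ck_fun M (k : nat) (u : M -> R) : Prop :=
  forall i : chart_index M, Ck k (@chart_cod _ _ M i) (u \o par i).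

Definition Cinf_fun M (u : M -> R) : Prop := forall k, Ck_fun k u.

Definition transition_jac M (i j : chart_index M) (p : M) : 'M[R]_n :=
  jac (crd j \o par i) (crd i p).

(* [o i p] is the sign of the chart [i] at [p] with respect to the chosen
   orientation of the tangent space at [p]. *)
Definition orientation M (o : chart_index M -> M -> bool) : Prop :=
  (forall i p, chart_dom i p -> \forall q \near p, o i q = o i p) /\
  (forall i j p, chart_dom i p -> chart_dom j p ->
     o j p = o i p (+) (\det (transition_jac i j p) < 0)).

(* The matrix of [<.,.>_p] in the coordinate frame of the chart [i]. *)
Definition metric_on M := chart_index M -> M -> 'M[R]_n.

Definition riemannian M (g : metric_on M) : Prop :=
  [/\ (forall i p, chart_dom i p -> (g i p)^T = g i p),
      (forall i p (w : 'rV[R]_n), chart_dom i p -> w != 0 -> 0 < inner (g i p) w w),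
      (forall i a b, Cinf (@chart_cod _ _ M i) (fun x => g i (par i x) a b)) &
      (forall i j p, chart_dom i p -> chart_dom j p ->
         g i p = transition_jac i j p *m g j p *m (transition_jac i j p)^T)].

Section Distance.
Variables (M : manifold R n) (g : metric_on M).

Definition curve_crd (gam : R -> M) (i : chart_index M) (k : 'I_n) (t : R) : R :=
  crd i (gam t) ord0 k.

(* [C^1] on a neighbourhood of [[a, b]].  Velocities may vanish, so a
   piecewise [C^1] curve on [[a, b]] can be reparametrized to stop at its corners
   and ends; the infimum of the lengths is the same for both classes. *)
Definition C1_curve (gam : R -> M) (a b : R) : Prop :=
  a <= b /\
  forall t, a <= t <= b ->
    {for t, continuous gam} /\
    forall (i : chart_index M) (k : 'I_n), chart_dom i (gam t) ->
      (\forall s \near t, derivable (curve_crd gam i k) s 1) /\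
      {for t, continuous (derive1 (curve_crd gam i k))}.

Definition speed (gam : R -> M) (t : R) : R :=
  let i := chart_at (gam t) in
  let w := \row_k derive1 (curve_crd gam i k) t in
  Num.sqrt (inner (g i (gam t)) w w).

Definition curve_length (gam : R -> M) (a b : R) : \bar R :=
  (\int[lebesgue_measure]_(t in `[a, b]) (speed gam t)%:E)%E.

Definition dist (p q : M) : \bar R :=
  ereal_inf [set l | exists gam a b,
    [/\ C1_curve gam a b, gam a = p, gam b = q & l = curve_length gam a b]].

Definition riem_complete : Prop :=
  forall u : nat -> M,
    (forall e : R, 0 < e -> exists N : nat, forall k l : nat,
       (N <= k)%N -> (N <= l)%N -> (dist (u k) (u l) < e%:E)%E) ->
    exists p : M, forall e : R, 0 < e -> exists N : nat, forall k : nat,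
       (N <= k)%N -> (dist (u k) p < e%:E)%E.

Definition metric_crd (i : chart_index M) (x : 'rV[R]_n) : 'M[R]_n := g i (par i x).

(* The weight is [e^phi]. *)
Definition wlaplacian (phi u : M -> R) (p : M) : R :=
  let i := chart_at p in let x := crd i p in
  lap (metric_crd i) (u \o par i) x +
  inner (g i p) (grad (metric_crd i) (phi \o par i) x)
                (grad (metric_crd i) (u \o par i) x).

(* Inner unit conormal at a boundary point, [grad x_0 / |grad x_0|]; the sum
   has the single term [k = 0]. *)
Definition conormal (p : M) : 'rV[R]_n :=
  let G' := invmx (g (chart_at p) p) in
  \sum_(k < n | val k == 0%N) (Num.sqrt (G' k k))^-1 *: row k G'.

Definition conormal_deriv (u : M -> R) (p : M) : R :=
  let i := chart_at p in
  inner (g i p) (grad (metric_crd i) (u \o par i) (crd i p)) (conormal p).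

Definition parabolic (phi : M -> R) : Prop :=
  forall u : M -> R,
    Ck_fun 2 u ->
    (exists B : R, forall p, u p <= B) ->
    (forall p, ~ boundary p -> 0 <= wlaplacian phi u p) ->
    (forall p, boundary p -> 0 <= conormal_deriv u p) ->
    exists c : R, forall p, u p = c.

End Distance.
End Manifolds.

(* A chart [j] of [M] gives the coordinates [(x, t)] on [M x R].  They range over
   the half-space [x_0 >= 0] of dimension [n + 1] only when [n > 0]. *)

Section Cylinder.
Variables (R : realType) (n : nat) (M : manifold R n) (g : metric_on M).

Definition cyl_crd (j : chart_index M) (q : M * R) : 'rV[R]_(n + 1) :=
  row_mx (crd j q.1) q.2%:M.

Definition cyl_par (j : chart_index M) (y : 'rV[R]_(n + 1)) : M * R :=
  (par j (lsubmx y), rsubmx y ord0 ord0).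

Definition cyl_metric (j : chart_index M) (q : M * R) : 'M[R]_(n + 1) :=
  block_mx (g j q.1) 0 0 1%:M.

Definition cyl_metric_crd (j : chart_index M) (y : 'rV[R]_(n + 1)) : 'M[R]_(n + 1) :=
  cyl_metric j (cyl_par j y).

(* The vertical field has the same components in all charts. *)
Definition xi : 'rV[R]_(n + 1) := row_mx 0 1%:M.

Section Hypersurface.
Variables (S : manifold R n) (F : S -> M * R).

Definition map_crd (i : chart_index S) (j : chart_index M) (x : 'rV[R]_n) : 'rV[R]_(n + 1) :=
  cyl_crd j (F (par i x)).

Definition map_dom (i : chart_index S) (j : chart_index M) : set 'rV[R]_n :=
  [set x | @chart_cod _ _ S i x /\ chart_dom j (F (par i x)).1].

Definition differential (i : chart_index S) (j : chart_index M) (p : S) : 'M[R]_(n, n + 1) :=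
  jac (map_crd i j) (crd i p).

Definition immersion : Prop :=
  [/\ continuous F,
      (forall i j b, Cinf (map_dom i j) (fun x => map_crd i j x ord0 b)) &
      (forall i j p, chart_dom i p -> chart_dom j (F p).1 -> row_free (differential i j p))].

Definition induced_metric : metric_on S := fun i p =>
  let j := chart_at (F p).1 in
  differential i j p *m cyl_metric j (F p) *m (differential i j p)^T.

(* A vector field along [F], by its components in each chart of [M]. *)
Definition field_along := chart_index M -> S -> 'rV[R]_(n + 1).

Definition gauss_map (N : field_along) : Prop :=
  [/\ (forall j j' p, chart_dom j (F p).1 -> chart_dom j' (F p).1 ->
         N j' p = N j p *m block_mx (transition_jac j j' (F p).1) 0 0 1%:M),
      (forall i j b, Cinf (map_dom i j) (fun x => N j (par i x) ord0 b)),
      (forall j p, chart_dom j (F p).1 -> inner (cyl_metric j (F p)) (N j p) (N j p) = 1) &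
      (forall i j p, chart_dom i p -> chart_dom j (F p).1 ->
         differential i j p *m cyl_metric j (F p) *m (N j p)^T = 0)].

Section Curvature.
Variable N : field_along.

(* Row [a] is the Levi-Civita derivative of [N] along the [a]-th coordinate
   field of [S]. *)
Definition covariant_deriv (i : chart_index S) (j : chart_index M) (p : S) : 'M[R]_(n, n + 1) :=
  \matrix_(a, k) (pderiv a (fun x => N j (par i x) ord0 k) (crd i p) +
    \sum_(b < n + 1) \sum_(c < n + 1)
      christoffel (cyl_metric_crd j) k b c (cyl_crd j (F p)) *
      differential i j p a b * N j p ord0 c).

(* The trace of [(v, w) |-> <D_v N, w>] on the tangent space of [S]. *)
Definition div_along (p : S) : R :=
  let i := chart_at p in let j := chart_at (F p).1 in
  \tr (invmx (induced_metric i p) *m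
       (covariant_deriv i j p *m cyl_metric j (F p) *m (differential i j p)^T)).

Definition weighted_mean_curvature (psi : M * R -> R) (p : S) : R :=
  let j := chart_at (F p).1 in
  - div_along p
  - inner (cyl_metric j (F p))
      (grad (cyl_metric_crd j) (psi \o cyl_par j) (cyl_crd j (F p))) (N j p).

Definition angle (p : S) : R :=
  let j := chart_at (F p).1 in inner (cyl_metric j (F p)) xi (N j p).

(* Orthogonality to [dM x R] is expressed by the unit normals; that of
   [dM x R] is the conormal of [M], lifted horizontally. *)
Definition free_boundary : Prop :=
  (forall p, boundary p <-> boundary (F p).1) /\
  forall p, boundary p ->
    let j := chart_at (F p).1 in
    inner (cyl_metric j (F p)) (N j p) (row_mx (conormal g (F p).1) 0) = 0.

End Curvature.

(* The tangent spaces are the row spaces of [differential i j p] and of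
   [row_mx 1%:M 0]. *)
Definition tangent_to_slice (a : R) : Prop :=
  forall p, boundary p ->
    (F p).2 = a /\
    (differential (chart_at p) (chart_at (F p).1) p == row_mx 1%:M (0 : 'M[R]_(n, 1)))%MS.

End Hypersurface.

Definition slice_map (s : R) (p : M) : M * R := (p, s).

Definition slice_mean_curvature (psi : M * R -> R) (s : R) : M -> R :=
  weighted_mean_curvature (slice_map s) (fun _ _ => - xi) psi.

End Cylinder.

(* Main.v *)
Require Import Defs.
From HB Require Import structures.
From mathcomp Require Import all_boot all_order all_algebra.
From mathcomp Require Import all_classical all_reals all_analysis.
From mathcomp Require Import measurable_realfun.
From mathcomp Require Import ring lra.

Set Implicit Arguments.
Unset Strict Implicit.
Unset Printing Implicit Defensive.

Import Order.TTheory GRing.Theory Num.Theory.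
Import numFieldNormedType.Exports.

Local Open Scope classical_set_scope.
Local Open Scope ring_scope.

(* Let u be the height function of Sigma, theta its angle function and w the gradient of u, so
   that xi = w + theta N and |w|^2 + theta^2 = 1.  Since xi is parallel, the Hessian of u is
   - theta <D N, .>, whence Delta_psi u = theta H_psi + v'(u).  Both curvature hypotheses give
   theta H_psi >= - lambda, so Delta_psi u >= 0; tangency to the slice, or the free boundary
   condition, gives du/dnu = 0 on the boundary.  By parabolicity u is a constant c; then
   theta^2 = 1, and 0 = theta H_psi + v'(c) forces v'(c) = lambda, the curvature of M_c.

   In (ii) the projection of Sigma to M is now a local isometry that preserves boundaries.  It is
   locally open, also at boundary points, and if it reaches a point near y in a chart of M, it
   reaches y: otherwise the coordinate distance to y could be decreased for ever along paths of
   controlled length (Ekeland's principle), and completeness gives a limit at which one more step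
   is possible.  Hence its image is open and closed in M. *)

(** * One-sided differential calculus on the half-space *)

Section Cubes.
Variables (R : realType) (m : nat).
Implicit Types (x y z : 'rV[R]_m) (U : set 'rV[R]_m).

(** Charts take values in a half-space, so partial derivatives at a boundary point are one-sided and
    ordinary differentiability of maps is not at hand. Strict differentiability relative to the
    half-space takes its place: it follows from C^1, yields the chain rule, and gives the
    quantitative injectivity of the projection of Sigma in charts.

    In (ii) minimizing geodesics of M are no help for lifting, since they may touch the boundary,
    which need not be convex. The descent therefore uses only straight segments in coordinates.
    Lengths are those of C^1 curves, so each segment is run through with a step function that rests
    at both ends, and the pieces can be concatenated. Conversely, completeness only gives a limit
    for [dist]; a lower bound on the length of curves that leave a small coordinate cube turns it
    into a limit in the topology of Sigma, at boundary points too. *)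

Definition cube x (d : R) : set 'rV[R]_m :=
  [set y | forall k, `|y ord0 k - x ord0 k| < d].

Lemma cube_nbhs x d : 0 < d -> nbhs x (cube x d).
Proof.
move=> d0; exists (fun i j => ball (x i j) d).
  by move=> i j; exact: nbhsx_ballx.
move=> y /= xy k; have := xy ord0 k.
by rewrite -ball_normE /= distrC.
Qed.

Lemma nbhs_cubeP x (A : set 'rV[R]_m) :
  nbhs x A <-> exists2 d, 0 < d & cube x d `<=` A.
Proof.
split=> [|[d d0 dA]]; last by apply: filterS dA _; exact: cube_nbhs.
move/nbhs_ballP => [d d0 dA]; exists d => // y xy; apply: dA.
split=> [|i j]; first exact: d0.
rewrite (ord1 i) -ball_normE /= distrC; exact: xy.
Qed.

Lemma cube_center x d : 0 < d -> cube x d x.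
Proof. by move=> d0 k; rewrite subrr normr0. Qed.

Lemma cube_le x d d' : d <= d' -> cube x d `<=` cube x d'.
Proof. by move=> dd y xy k; apply: lt_le_trans dd; exact: xy. Qed.

Definition ropen U : Prop := U `<=` halfspace m /\
  forall x, U x -> exists2 d, 0 < d & cube x d `&` halfspace m `<=` U.

Lemma ropenI U V : ropen U -> ropen V -> ropen (U `&` V).
Proof.
move=> [UH Uo] [VH Vo]; split; first by move=> x [/UH].
move=> x [/Uo [d d0 dU] /Vo [d' d'0 dV]].
exists (Num.min d d'); first by rewrite lt_min d0.
move=> y [xy Hy]; split.
  by apply: dU; split=> //; apply: cube_le xy; rewrite ge_min lexx.
by apply: dV; split=> //; apply: cube_le xy; rewrite ge_min lexx orbT.
Qed.

Lemma ropen_openI (W : set 'rV[R]_m) : open W -> ropen (W `&` halfspace m).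
Proof.
move=> oW; split; first by move=> x [].
move=> x [Wx _]; have /nbhs_cubeP [d d0 dW] : nbhs x W by exact: open_nbhs_nbhs.
by exists d => // y [/dW].
Qed.

Lemma within_cubeP (T : topologicalType) U (f : 'rV[R]_m -> T) :
  {within U, continuous f} <-> forall x (B : set T), U x -> nbhs (f x) B ->
    exists2 d, 0 < d & forall y, U y -> cube x d y -> B (f y).
Proof.
rewrite subspace_continuousP; split=> H x.
  move=> B Ux /(H x Ux) /nbhs_cubeP [d d0 dB].
  by exists d => // y Uy xy; exact: dB.
move=> Ux B /(H x B Ux) [d d0 dB]; apply/nbhs_cubeP; exists d => // y xy Uy.
exact: dB.
Qed.

Lemma within_contP U (f : 'rV[R]_m -> R) :
  {within U, continuous f} <-> forall x e, U x -> 0 < e ->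
    exists2 d, 0 < d & forall y, U y -> cube x d y -> `|f y - f x| < e.
Proof.
rewrite within_cubeP; split=> H x.
  move=> e Ux e0; have [|d d0 dB] := H x (ball (f x) e) Ux.
    exact: nbhsx_ballx.
  by exists d => // y Uy /(dB y Uy); rewrite -ball_normE /= distrC.
move=> B Ux /nbhs_ballP [e e0 eB]; have [d d0 dB] := H x e Ux e0.
by exists d => // y Uy /(dB y Uy) xy; apply: eB; rewrite -ball_normE /= distrC.
Qed.

Lemma ropen_preimage (T : topologicalType) U (f : 'rV[R]_m -> T) (B : set T) :
  ropen U -> {within U, continuous f} -> open B ->
  ropen [set x | U x /\ B (f x)].
Proof.
move=> [UH Uo] /within_cubeP fc oB; split; first by move=> x [/UH].
move=> x [Ux Bx]; have [d d0 dU] := Uo x Ux.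
have [|d' d'0 dB] := fc x B Ux; first exact: open_nbhs_nbhs.
exists (Num.min d d'); first by rewrite lt_min d0.
move=> y [xy Hy].
have Uy : U y by apply: dU; split=> //; apply: cube_le xy; rewrite ge_min lexx.
by split=> //; apply: dB => //; apply: cube_le xy; rewrite ge_min lexx orbT.
Qed.

End Cubes.

(** * Difference quotients along a filter *)

Section DiffQuotients.
Variable R : realType.

(** Quotients are taken along any filter finer than the punctured neighbourhoods of 0, so that the
    same rules serve one-sided partial derivatives and ordinary derivatives of curves. *)
Definition dquot (phi : R -> R) (s : R) : R := s^-1 * (phi s - phi 0).

Section AlongFilter.
Variables (Fl : set_system R) (FF : Filter Fl) (Fl0 : Fl `=>` 0^').

Let Fl_neq0 : \forall s \near Fl, s != 0.
Proof. by apply: Fl0; exact: (@nbhs_dnbhs_neq R 0). Qed.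

Lemma Fl_cvg0 : Fl --> (0 : R).
Proof. by move=> A A0; apply: Fl0; apply: filterS A0 => x Ax _. Qed.

Lemma dquot_near phi chi (l : R) : phi 0 = chi 0 ->
  (\forall s \near Fl, phi s = chi s) ->
  dquot phi @ Fl --> l -> dquot chi @ Fl --> l.
Proof.
move=> e0 en; apply: cvg_trans; apply: near_eq_cvg.
by apply: filterS en => s es; rewrite /dquot es e0.
Qed.

Lemma dquot_continuous phi (l : R) : dquot phi @ Fl --> l -> phi @ Fl --> phi 0.
Proof.
move=> pl.
have H : (fun s => phi 0 + s * dquot phi s) @ Fl --> phi 0 + 0 * l.
  apply: cvgD; first exact: cvg_cst.
  by apply: cvgM => //; exact: Fl_cvg0.
rewrite mul0r addr0 in H; apply: cvg_trans H; apply: near_eq_cvg.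
apply: filterS Fl_neq0 => s s0.
by rewrite /dquot mulrA divff // mul1r addrC subrK.
Qed.

Lemma dquot_cst (c : R) : dquot (fun=> c) @ Fl --> (0 : R).
Proof.
have -> : dquot (fun=> c) = fun=> 0 by apply/funext => s; rewrite /dquot subrr mulr0.
exact: cvg_cst.
Qed.

Lemma dquotD phi chi (a b : R) : dquot phi @ Fl --> a -> dquot chi @ Fl --> b ->
  dquot (fun s => phi s + chi s) @ Fl --> a + b.
Proof.
move=> pa cb; have -> : dquot (fun s => phi s + chi s) = dquot phi \+ dquot chi.
  by apply/funext => s; rewrite /dquot /=; ring.
exact: cvgD.
Qed.

Lemma dquotM phi chi (a b : R) : dquot phi @ Fl --> a -> dquot chi @ Fl --> b ->
  dquot (fun s => phi s * chi s) @ Fl --> a * chi 0 + phi 0 * b.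
Proof.
move=> pa cb.
have -> : dquot (fun s => phi s * chi s) =
    fun s => dquot phi s * chi s + phi 0 * dquot chi s.
  by apply/funext => s; rewrite /dquot /=; ring.
apply: cvgD; apply: cvgM => //; first exact: dquot_continuous cb.
exact: cvg_cst.
Qed.

Lemma dquot_sum (I : finType) (phi : I -> R -> R) (l : I -> R) :
  (forall i, dquot (phi i) @ Fl --> l i) ->
  dquot (fun s => \sum_i phi i s) @ Fl --> \sum_i l i.
Proof.
move=> pl.
have -> : dquot (fun s => \sum_i phi i s) = fun s => \sum_i dquot (phi i) s.
  apply/funext => s; rewrite /dquot -sumrB mulr_sumr.
  by [].
by apply: cvg_big; [exact: add_continuous | move=> i _; exact: pl].
Qed.

End AlongFilter.
End DiffQuotients.

(** * Strict differentiability and the chain rule *)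

Section StrictDifferentiability.
Variables (R : realType) (m : nat).
Implicit Types (x y z : 'rV[R]_m) (U : set 'rV[R]_m) (f : 'rV[R]_m -> R).

(** Strict differentiability at [x] relative to the half-space, with differential [A]. Both [y] and
    [z] vary: this is what later gives a lower bound for the distance of two values near a point
    where the differential is invertible. *)
Definition sdiff f x (A : 'I_m -> R) : Prop := forall e, 0 < e ->
  exists2 d, 0 < d & forall y z, halfspace m y -> halfspace m z ->
    cube x d y -> cube x d z ->
    `|f z - f y - \sum_k A k * (z ord0 k - y ord0 k)|
      <= e * \sum_k `|z ord0 k - y ord0 k|.

Lemma sdiff_dquot (Fl : set_system R) (FF : Filter Fl) (Fl0 : Fl `=>` 0^')
    f (c : R -> 'rV[R]_m) (A l : 'I_m -> R) :
  sdiff f (c 0) A -> halfspace m (c 0) ->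
  (\forall s \near Fl, halfspace m (c s)) ->
  (forall k, dquot (fun s => c s ord0 k) @ Fl --> l k) ->
  dquot (f \o c) @ Fl --> \sum_k A k * l k.
Proof.
move=> fA H0 Hn cl.
have lim2 : (fun s => \sum_k A k * dquot (fun s => c s ord0 k) s) @ Fl -->
    \sum_k A k * l k.
  apply: cvg_big; first exact: add_continuous.
  by move=> k _; apply: cvgM; [exact: cvg_cst | exact: cl].
suff lim0 : (fun s => dquot (f \o c) s - \sum_k A k * dquot (fun s => c s ord0 k) s)
    @ Fl --> (0 : R).
  rewrite -[X in _ --> X]add0r; set g := (X in X @ _ --> _).
  have -> : g = (fun s => (dquot (f \o c) s
      - \sum_k A k * dquot (fun s => c s ord0 k) s)
      + \sum_k A k * dquot (fun s => c s ord0 k) s).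
    by apply/funext => s; rewrite subrK.
  exact: cvgD.
apply/(@cvgr0Pnorm_lt R R R Fl FF) => e e0.
(* Along the filter each coordinate quotient stays below [|l k| + 1], hence their sum below [B];
   accuracy [e / (2 * B)] then leaves an error of at most [e / 2]. *)
pose B := 1 + \sum_k (`|l k| + 1).
have B0 : 0 < B by rewrite ltr_pwDl // sumr_ge0 // => k _; rewrite addr_ge0.
have [|d d0 fd] := fA (e / (2 * B)); first by rewrite divr_gt0 // mulr_gt0.
have cn : \forall s \near Fl, forall k, `|c s ord0 k - c 0 ord0 k| < d.
  apply: filter_forall => k.
  have /cvgrPdist_lt/(_ d d0) := @dquot_continuous R Fl FF Fl0 _ _ (cl k).
  by apply: filterS => s; rewrite distrC.
have qn : \forall s \near Fl, forall k,
    `|dquot (fun s => c s ord0 k) s| < `|l k| + 1.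
  apply: filter_forall => k.
  have /cvgrPdist_lt/(_ 1 ltr01) := cl k.
  apply: filterS => s sl.
  have -> : dquot (fun s => c s ord0 k) s = l k - (l k - dquot (fun s => c s ord0 k) s) by ring.
  by apply: le_lt_trans (ler_normB _ _) _; rewrite ltrD2l.
have s0n : \forall s \near Fl, s != 0.
  by apply: Fl0; exact: (@nbhs_dnbhs_neq R 0).
near=> s.
have s0 : s != 0 by near: s.
have := fd (c 0) (c s) H0 _ (cube_center _ d0) _.
have Hs : halfspace m (c s) by near: s.
have cs : cube (c 0) d (c s) by near: s.
move=> /(_ Hs cs) /= bd.
have -> : dquot (f \o c) s - \sum_k A k * dquot (fun s => c s ord0 k) s =
    s^-1 * (f (c s) - f (c 0) - \sum_k A k * (c s ord0 k - c 0 ord0 k)).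
  rewrite /dquot /= [RHS]mulrBr mulr_sumr; congr (_ - _).
  by apply: eq_bigr => k _; ring.
rewrite normrM.
have : `|s^-1| * (e / (2 * B) * \sum_k `|c s ord0 k - c 0 ord0 k|) <= e / 2.
  have -> : `|s^-1| * (e / (2 * B) * \sum_k `|c s ord0 k - c 0 ord0 k|) =
      (e / (2 * B)) * \sum_k `|dquot (fun s => c s ord0 k) s|.
    rewrite mulrCA; congr (_ * _); rewrite mulr_sumr; apply: eq_bigr => k _.
    by rewrite /dquot normrM.
  have -> : e / 2 = (e / (2 * B)) * B by field; rewrite gt_eqF.
  apply: ler_wpM2l; first by rewrite ltW // divr_gt0 // mulr_gt0.
  apply: le_trans (_ : \sum_k (`|l k| + 1) <= _); last by rewrite lerDr.
  apply: ler_sum => k _; apply: ltW.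
  by move: k; near: s.
move=> H1; apply: le_lt_trans (_ : e / 2 < e); last by lra.
by apply: le_trans H1; apply: ler_wpM2l.
Unshelve. all: by end_near. Qed.

End StrictDifferentiability.

(** * One-sided partial derivatives *)

Section PartialDerivatives.
Variables (R : realType) (m : nat).
Implicit Types (x y z : 'rV[R]_m) (U V : set 'rV[R]_m) (f g : 'rV[R]_m -> R).
Implicit Types i j k : 'I_m.

Definition incr_filter i x : set_system R := within (pincr i x) (nbhs (0 : R)).

Definition pline i x (s : R) : 'rV[R]_m := x + s *: delta_mx ord0 i.

(** A relational form of [pderiv], whose [lim] is meaningful only once convergence is known. *)
Definition ispd i f x (l : R) : Prop := dquot (f \o pline i x) @ incr_filter i x --> l.

Lemma pline0 i x : pline i x 0 = x.
Proof. by rewrite /pline scale0r addr0. Qed.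

Lemma plineE i x s k : pline i x s ord0 k = x ord0 k + s * (k == i)%:R.
Proof. by rewrite /pline !mxE. Qed.

Lemma pline_add i x s t : pline i (pline i x s) t = pline i x (s + t).
Proof. by rewrite /pline -addrA -scalerDl. Qed.

Lemma pquotE i f x : pquot i f x = dquot (f \o pline i x).
Proof. by apply/funext => s; rewrite /pquot /dquot /= pline0. Qed.

Lemma incr_filter_filter i x : Filter (incr_filter i x).
Proof. exact: within_filter. Qed.

Lemma incr_filter0 i x : incr_filter i x `=>` 0^'.
Proof. by move=> P; rewrite /dnbhs /incr_filter /within /=; apply: filterS => s Ps [/Ps]. Qed.

Lemma incr_filter_halfspace i x : \forall s \near incr_filter i x, halfspace m (pline i x s).
Proof. by rewrite /incr_filter; near=> s; have [] : pincr i x s by near: s; exact: withinT.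
Unshelve. all: by end_near. Qed.

Lemma incr_filter_proper i x : halfspace m x -> ProperFilter (incr_filter i x).
Proof.
move=> Hx; split; last exact: incr_filter_filter.
rewrite /incr_filter /within => /nbhs_ballP [d /= d0 dH].
apply: (dH (d / 2)).
  by rewrite -ball_normE /= sub0r normrN gtr0_norm ?divr_gt0 //; lra.
split; first by rewrite gt_eqF // divr_gt0.
move=> k k0; rewrite !mxE; apply: addr_ge0; first exact: Hx.
by apply: mulr_ge0; [rewrite ltW // divr_gt0 | rewrite ler0n].
Qed.

Lemma incr_filter_cube i x d : 0 < d -> \forall s \near incr_filter i x, cube x d (pline i x s).
Proof.
move=> d0; apply: cvg_within; apply/nbhs_ballP; exists d => //= s.
rewrite -ball_normE /= sub0r normrN => sd k; rewrite plineE addrAC subrr add0r.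
by case: (k == i); rewrite ?mulr1 ?mulr0 ?normr0.
Qed.

Lemma ispd_pderiv i f x l : halfspace m x -> ispd i f x l -> pderiv i f x = l.
Proof.
move=> Hx fl; rewrite /pderiv pquotE.
by apply: (@cvg_lim _ (@norm_hausdorff R R) _ _ (incr_filter_proper i Hx)).
Qed.

Lemma pderivableP i f x : pderivable i f x -> ispd i f x (pderiv i f x).
Proof. by rewrite /pderivable /pderiv pquotE. Qed.

Lemma pderiv_near i f g x d : 0 < d -> halfspace m x ->
  (forall y, halfspace m y -> cube x d y -> f y = g y) ->
  pderiv i f x = pderiv i g x.
Proof.
move=> d0 Hx fg; rewrite /pderiv; congr (lim _).
have F1 := incr_filter_filter i x.
have fgn : \forall s \near incr_filter i x, pquot i f x s = pquot i g x s.
  near=> s; rewrite /pquot (fg x) //; last exact: cube_center.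
  rewrite fg //.
    by near: s; exact: incr_filter_halfspace.
  by near: s; exact: incr_filter_cube.
by rewrite eqEsubset; split; apply: near_eq_cvg => //;
  apply: filterS fgn => s.
Unshelve. all: by end_near. Qed.

Lemma ispd_cst i (c : R) x : ispd i (fun=> c) x 0.
Proof. exact: (@dquot_cst _ _ (incr_filter_filter i x)). Qed.

Lemma ispdD i f g x a b : ispd i f x a -> ispd i g x b ->
  ispd i (fun y => f y + g y) x (a + b).
Proof. exact: (@dquotD _ _ (incr_filter_filter i x)). Qed.

Lemma ispdM i f g x a b : ispd i f x a -> ispd i g x b ->
  ispd i (fun y => f y * g y) x (a * g x + f x * b).
Proof.
move=> fa gb; rewrite -[in g x](pline0 i x) -[in f x](pline0 i x).
exact: (@dquotM _ _ (incr_filter_filter i x) (@incr_filter0 i x)).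
Qed.

Lemma ispd_sum i (I : finType) (f : I -> 'rV[R]_m -> R) x (l : I -> R) :
  (forall r, ispd i (f r) x (l r)) -> ispd i (fun y => \sum_r f r y) x (\sum_r l r).
Proof. by move=> fl; apply: (@dquot_sum _ _ (incr_filter_filter i x)). Qed.

Lemma ispd_coord i k x : ispd i (fun y => y ord0 k) x (k == i)%:R.
Proof.
have F1 := incr_filter_filter i x.
apply: cvg_trans (_ : (fun=> (k == i)%:R) @ incr_filter i x --> _); last exact: cvg_cst.
apply: near_eq_cvg; near=> s.
have s0 : s != 0 by near: s; apply: incr_filter0; exact: (@nbhs_dnbhs_neq R 0).
by rewrite /dquot /= !plineE mul0r addr0 addrAC subrr add0r mulrA mulVf // mul1r.
Unshelve. all: by end_near. Qed.

(** Increments admissible at [x] remain so at [x + v], the half-space being closed under addition;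
    the filter at [x] is the finer of the two. *)
Lemma ispd_shift i f v x l : halfspace m v ->
  ispd i f (x + v) l -> ispd i (fun y => f (y + v)) x l.
Proof.
move=> Hv; rewrite /ispd.
have -> : (fun y => f (y + v)) \o pline i x = f \o pline i (x + v).
  by apply/funext => s /=; rewrite /pline addrAC.
apply: cvg_trans; apply: cvg_app => A; rewrite /incr_filter /within !nbhs_simpl /=.
apply: filterS => s As [s0 Hs]; apply: As; split=> // k k0.
by rewrite addrAC mxE; apply: addr_ge0; [exact: Hs | exact: Hv].
Qed.

End PartialDerivatives.

(** * Mean value estimates and symmetry of second derivatives *)

Section MeanValue.
Variable R : realType.

Lemma dquot_is_derive (phi : R -> R) (s l : R) :
  dquot (fun t => phi (s + t)) @ 0^' --> l <-> is_derive s 1 phi l.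
Proof.
have E : dquot (fun t => phi (s + t)) = fun t => t^-1 *: ((phi \o shift s) (t *: 1) - phi s).
  by apply/funext => t; rewrite /dquot /= addr0 /shift /= /GRing.scale /= mulr1 [t + s]addrC.
rewrite E; split=> [H|[H1 H2]].
  apply: DeriveDef; first by apply/cvg_ex; exists l.
  exact: (@cvg_lim _ (@norm_hausdorff R R)).
by rewrite -H2; exact: H1.
Qed.

Variable m : nat.
Implicit Types (x y z : 'rV[R]_m) (U V : set 'rV[R]_m) (f g q : 'rV[R]_m -> R).
Implicit Types i j k : 'I_m.

Lemma halfspace_pline_between i x h s : 0 <= s <= h ->
  halfspace m x -> halfspace m (pline i x h) -> halfspace m (pline i x s).
Proof.
move=> /andP[s0 sh] Hx Hh k k0; rewrite plineE; apply: addr_ge0; first exact: Hx.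
by rewrite mulr_ge0.
Qed.

Lemma partial_MVT i q x (l : R -> R) h : 0 < h -> halfspace m x ->
  (forall s, 0 <= s <= h -> ispd i q (pline i x s) (l s)) ->
  exists2 c, 0 < c < h & q (pline i x h) - q x = l c * h.
Proof.
move=> h0 Hx ql; pose phi s := q (pline i x s).
have Hs s : 0 <= s -> halfspace m (pline i x s).
  by move=> s0 k k0; rewrite plineE addr_ge0 ?Hx // mulr_ge0.
have phiE s : q \o pline i (pline i x s) = fun t => phi (s + t).
  by apply/funext => t /=; rewrite pline_add.
(* At [s > 0] every increment with [|t| < s] is admissible, as it leads to a point of the ray
   issuing from [x]; the one-sided derivative is an ordinary one there. *)
have dphi s : s \in `]0, h[%R -> is_derive s 1 phi (l s).
  rewrite in_itv /= => /andP[s0 sh]; apply/dquot_is_derive; rewrite -phiE.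
  have := ql s _; rewrite ltW // ltW // => /(_ isT).
  apply: cvg_trans; apply: cvg_app => A.
  rewrite !nbhs_simpl /incr_filter /dnbhs /within /= => An; near=> t => t0.
  have tA : pincr i (pline i x s) t -> A t by near: t.
  apply: tA; split=> //; rewrite -/(pline _ _ _) pline_add; apply: Hs.
  have : `|t| < s by near: t; apply/nbhs_ballP; exists s => //= u; rewrite -ball_normE /= sub0r normrN.
  by rewrite ltr_norml => /andP[]; lra.
have cphi : {within `[0, h], continuous phi}.
  apply/subspace_continuousP => s; rewrite /= in_itv /= => /andP[s0 sh].
  have := @dquot_continuous R _ (incr_filter_filter i _) (@incr_filter0 _ _ i _) _ _ (ql s _).
  rewrite s0 sh => /(_ isT); rewrite phiE addr0 => H.
  move=> B /[dup] /nbhs_singleton Bs /H; rewrite !nbhs_simpl /incr_filter /within /= => /nbhs_ballP [d d0 dB].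
  apply/nbhs_ballP; exists d => // u; rewrite -ball_normE /= => su.
  rewrite in_itv /= => /andP[u0 uh].
  have [->|us] := eqVneq u s; first exact: Bs.
  have := dB (u - s); rewrite -ball_normE /= sub0r opprB => /(_ su).
  have usE : s + (u - s) = u by ring.
  rewrite usE; apply; split; first by rewrite subr_eq0.
  by rewrite -/(pline i (pline i x s) (u - s)) pline_add usE; apply: Hs.
have [c] := MVT h0 dphi cphi.
by rewrite in_itv /= => c0h; rewrite /phi pline0 subr0 => e; exists c.
Unshelve. all: by end_near. Qed.

Lemma partial_MVT_bound i f x d (P : 'rV[R]_m -> R) (A e : R) :
  (forall u, halfspace m u -> cube x d u -> ispd i f u (P u) /\ `|P u - A| <= e) ->
  forall w h, halfspace m w -> halfspace m (pline i w h) ->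
  cube x d w -> cube x d (pline i w h) ->
  `|f (pline i w h) - f w - A * h| <= e * `|h|.
Proof.
move=> fP.
have pos w h : 0 < h -> halfspace m w -> halfspace m (pline i w h) ->
  cube x d w -> cube x d (pline i w h) ->
  `|f (pline i w h) - f w - A * h| <= e * `|h|.
  move=> h0 Hw Hh xw xh.
  have seg s : 0 <= s <= h -> halfspace m (pline i w s) /\ cube x d (pline i w s).
    move=> sh; split; first exact: halfspace_pline_between Hh.
    move=> k; have := xw k; have := xh k; rewrite !plineE.
    case: (k == i); rewrite ?mulr0 ?addr0 // !mulr1 !ltr_norml.
    by move=> /andP[a b] /andP[a' b']; move/andP: sh => [s0 sh]; apply/andP; split; lra.
  have [|c /andP[c0 ch] ->] := @partial_MVT i f w (fun s => P (pline i w s)) h h0 Hw.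
    by move=> s /seg [Hs xs]; have [] := fP _ Hs xs.
  have [|Hc xc] := seg c; first by rewrite !ltW.
  rewrite -mulrBl normrM; apply: ler_wpM2r => //.
  by have [] := fP _ Hc xc.
move=> w h Hw Hh xw xh; have [h0|h0|h0] := ltgtP h 0; last 2 first.
- exact: pos.
- by rewrite h0 pline0 subrr mulr0 subrr normr0 mulr0.
have := pos (pline i w h) (- h); rewrite oppr_gt0 pline_add subrr pline0.
move=> /(_ h0 Hh Hw xh xw); rewrite normrN mulrN opprK.
have -> : f w - f (pline i w h) + A * h = - (f (pline i w h) - f w - A * h) by ring.
by rewrite normrN.
Qed.

(** From [y] to [z] one coordinate is changed at a time. The vertices [mix k] of this broken line
    stay in the half-space and in the cube, and the mean value bound applies to each leg. *)
Lemma C1_sdiff U f x : ropen U -> Ck 1 U f -> U x -> sdiff f x (fun k => pderiv k f x).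
Proof.
move=> [UH Uo] [_ fC] Ux e e0.
have [d1 d10 dU] := Uo x Ux.
have /choice [dd ddP] : forall k, exists d, 0 < d /\
    forall y, U y -> cube x d y -> `|pderiv k f y - pderiv k f x| < e.
  move=> k; have [_ [/within_contP fc _]] := fC k.
  by have [d d0 dB] := fc x e Ux e0; exists d.
pose d := \big[Num.min/d1]_k dd k.
have d0 : 0 < d by apply: (big_ind (fun d : R => 0 < d)) => //= [a b a0 b0|k _]; [rewrite lt_min a0 | case: (ddP k)].
have dd1 : d <= d1 by exact: bigmin_le_id.
have ddk k : d <= dd k by exact: bigmin_le_cond.
exists d => // y z Hy Hz xy xz.
pose mix (k : nat) : 'rV[R]_m := \row_j (if (j < k)%N then z ord0 j else y ord0 j).
have mix0 : mix 0%N = y by apply/rowP => j; rewrite mxE ltn0.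
have mixm : mix m = z by apply/rowP => j; rewrite mxE ltn_ord.
have mixH (k : nat) : halfspace m (mix k).
  by move=> j j0; rewrite mxE; case: ifP => _; [exact: Hz | exact: Hy].
have mixC (k : nat) : cube x d (mix k) by move=> j; rewrite mxE; case: ifP.
have mixS (k : 'I_m) : mix k.+1 = pline k (mix k) (z ord0 k - y ord0 k).
  apply/rowP => j; rewrite plineE !mxE ltnS leq_eqVlt -val_eqE /=.
  case: eqVneq => [jk|jk] /=; last by rewrite mulr0 addr0.
  rewrite jk ltnn mulr1 addrC.
  by have -> : j = k by [apply: val_inj]; rewrite subrK.
have -> : f z - f y = \sum_(k < m) (f (mix k.+1) - f (mix k)).
  rewrite -(big_mkord xpredT (fun k : nat => f (mix k.+1) - f (mix k))).
  by rewrite telescope_sumr // mixm mix0.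
rewrite -sumrB; apply: le_trans (ler_norm_sum _ _ _) _.
rewrite mulr_sumr; apply: ler_sum => k _.
rewrite mixS; apply: (@partial_MVT_bound _ _ x d (pderiv k f)) => //; last 2 first.
- by have := mixH k.+1; rewrite mixS.
- by have := mixC k.+1; rewrite mixS.
move=> u Hu xu; have Uu : U u by apply: dU; split=> //; exact: cube_le xu.
split; first by apply: pderivableP; case: (fC k) => /(_ u Uu).
apply: ltW; apply: (ddP k).2 => //; apply: cube_le xu; exact: ddk.
Qed.

Lemma double_increment_inj (s a1 a2 a3 a4 D1 D2 : R) : s != 0 ->
  a1 - a2 - (a3 - a4) = D1 * s * s -> a1 - a3 - (a2 - a4) = D2 * s * s -> D1 = D2.
Proof.
move=> s0 E1 E2; apply: (mulIf s0); apply: (mulIf s0); rewrite -E1 -E2; ring.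
Qed.

Lemma two_distances (a b c e : R) : `|a - b| < e -> `|a - c| < e -> `|c - b| < 2 * e.
Proof.
by rewrite !ltr_norml => /andP[? ?] /andP[? ?]; apply/andP; split; lra.
Qed.

(** Only nonnegative increments from [x] occur, so the double difference is defined even at a
    boundary point; continuity of the mixed derivatives brings the intermediate points back to
    [x]. *)
Lemma pderivC U f x i j : ropen U -> Ck 2 U f -> U x ->
  pderiv i (pderiv j f) x = pderiv j (pderiv i f) x.
Proof.
move=> Uro [_ fC] Ux; have [UH Uo] := Uro.
have [d1 d10 dU] := Uo x Ux.
apply/eqP; rewrite -subr_eq0 -normr_eq0; apply/eqP.
suff H e : 0 < e -> `|pderiv i (pderiv j f) x - pderiv j (pderiv i f) x| < 2 * e.
  have [//|n0] := eqVneq `|pderiv i (pderiv j f) x - pderiv j (pderiv i f) x| 0.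
  have p0 : 0 < `|pderiv i (pderiv j f) x - pderiv j (pderiv i f) x|.
    by rewrite lt_def n0 normr_ge0.
  have := H (`|pderiv i (pderiv j f) x - pderiv j (pderiv i f) x| / 2).
  by rewrite divr_gt0 // => /(_ isT); rewrite mulrC divfK // ltxx.
move=> e0.
have [fi [fic fid]] := fC i; have [fj [fjc fjd]] := fC j.
have [fij [/within_contP fijc _]] := fid j; have [fji [/within_contP fjic _]] := fjd i.
have [d2 d20 d2P] := fijc x e Ux e0; have [d3 d30 d3P] := fjic x e Ux e0.
pose d := Num.min d1 (Num.min d2 d3).
have d0 : 0 < d by rewrite !lt_min d10 d20.
have [s s0 sd] : exists2 s : R, 0 < s & s < d.
  by exists (d / 2); [rewrite divr_gt0 | lra].
have Hx := UH x Ux.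
have in2 k k' a b : k != k' -> 0 <= a <= s -> 0 <= b <= s ->
    halfspace m (pline k' (pline k x a) b) /\ cube x d (pline k' (pline k x a) b).
  move=> kk /andP[a0 as_] /andP[b0 bs]; split.
    move=> r r0; rewrite !plineE; apply: addr_ge0; last by rewrite mulr_ge0.
    by apply: addr_ge0; [exact: Hx | rewrite mulr_ge0].
  move=> r; rewrite !plineE.
  have -> : x ord0 r + a * (r == k)%:R + b * (r == k')%:R - x ord0 r =
     a * (r == k)%:R + b * (r == k')%:R by ring.
  case: (eqVneq r k) => [->|_]; last first.
    case: (r == k'); rewrite ?mulr1 ?mulr0 ?addr0 ?add0r ?normr0 //.
    by rewrite ger0_norm //; apply: le_lt_trans sd.
  by rewrite (negbTE kk) mulr0 mulr1 addr0 ger0_norm //; apply: le_lt_trans sd.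
have inU k k' a b : k != k' -> 0 <= a <= s -> 0 <= b <= s ->
    U (pline k' (pline k x a) b).
  move=> kk as_ bs; have [H1 H2] := in2 k k' a b kk as_ bs.
  by apply: dU; split=> //; apply: cube_le H2; rewrite /d ge_min lexx.
have [->|ij] := eqVneq i j; first by rewrite subrr normr0 mulr_gt0.
have ji : j != i by rewrite eq_sym.
have ss : 0 <= s <= s by rewrite lexx ltW.
have s00 : (0 : R) <= 0 <= s by apply/andP; split=> //; exact: ltW.
(* Both mixed derivatives are values of the same double increment quotient. *)
have key k k' : k != k' -> (forall y, U y -> pderivable k f y) ->
    (forall y, U y -> pderivable k' (pderiv k f) y) ->
    exists a b, [/\ 0 <= a <= s, 0 <= b <= s &
    f (pline k' (pline k x s) s) - f (pline k x s) - (f (pline k' x s) - f x) =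
    pderiv k' (pderiv k f) (pline k' (pline k x a) b) * s * s].
  move=> kk pk pkk.
  have [|a /andP[a0 as_]] := @partial_MVT k (fun y => f (y + s *: delta_mx ord0 k') - f y) x
      (fun a => pderiv k f (pline k' (pline k x a) s) - pderiv k f (pline k x a)) s s0 Hx.
    move=> a a0s; apply: ispdD.
      apply: ispd_shift.
        by move=> r r0; rewrite !mxE; apply: mulr_ge0; [exact: ltW | exact: ler0n].
      by apply: pderivableP; apply: pk; exact: inU.
    have -> : (fun y => - f y) = (fun y => (fun=> -1) y * f y).
      by apply/funext => y; rewrite mulN1r.
    rewrite -[X in ispd _ _ _ X]mulN1r -[X in ispd _ _ _ X]add0r.
    rewrite -[X in ispd _ _ _ (X + _)](mul0r (f (pline k x a))).
    apply: ispdM; first exact: ispd_cst.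
    apply: pderivableP; apply: pk.
    by have := inU k k' a 0 kk a0s s00; rewrite pline0.
  move=> E1.
  have a0s : 0 <= a <= s by rewrite !ltW.
  have Ha : halfspace m (pline k x a).
    by have [] := in2 k k' a 0 kk a0s s00; rewrite pline0.
  have [|b /andP[b0 bs] E2] := @partial_MVT k' (pderiv k f) (pline k x a)
      (fun b => pderiv k' (pderiv k f) (pline k' (pline k x a) b)) s s0 Ha.
    by move=> b b0s; apply: pderivableP; apply: pkk; exact: inU.
  exists a, b; split=> //; first by rewrite !ltW.
  rewrite -E2 -E1 /pline; ring.
have [a [b [as_ bs E1]]] := key i j ij fi fij.
have [a' [b' [as' bs' E2]]] := key j i ji fj fji.
have swap : pline j (pline i x s) s = pline i (pline j x s) s.
  by rewrite /pline addrAC.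
have E : pderiv j (pderiv i f) (pline j (pline i x a) b) =
    pderiv i (pderiv j f) (pline i (pline j x a') b').
  have s_neq0 : s != 0 by rewrite gt_eqF.
  by rewrite swap in E1; exact: (double_increment_inj s_neq0 E1 E2).
have A1 : `|pderiv j (pderiv i f) (pline j (pline i x a) b) - pderiv j (pderiv i f) x| < e.
  apply: d2P; first exact: inU.
  by apply: cube_le (in2 _ _ _ _ ij as_ bs).2; rewrite /d !ge_min lexx orbT.
have A2 : `|pderiv i (pderiv j f) (pline i (pline j x a') b') - pderiv i (pderiv j f) x| < e.
  apply: d3P; first exact: inU.
  by apply: cube_le (in2 _ _ _ _ ji as' bs').2; rewrite /d !ge_min lexx !orbT.
rewrite E in A1; exact: (two_distances A1 A2).
Qed.

End MeanValue.

(** * Locality of smoothness and first-order conditions at a minimum *)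

Section SmoothFunctions.
Variables (R : realType) (m : nat).
Implicit Types (x y z : 'rV[R]_m) (U V : set 'rV[R]_m) (f g : 'rV[R]_m -> R).
Implicit Types i j : 'I_m.

Lemma Ck_sub k U V f : V `<=` U -> Ck k U f -> Ck k V f.
Proof.
elim: k f => [|k IH] f VU [fc fC]; split=> //; try exact: continuous_subspaceW fc.
by move=> i; have [fd fk] := fC i; split=> [x /VU /fd //|]; exact: IH.
Qed.

(** [pderiv] refers to the half-space and not to [U], so smoothness can be checked on relatively
    open pieces. This serves functions, such as the height, whose smoothness is known only chart by
    chart of M. *)
Lemma Ck_local k U f : U `<=` halfspace m ->
  (forall x, U x -> exists V, [/\ ropen V, V x & Ck k V f]) -> Ck k U f.
Proof.
move=> UH; elim: k f => [|k IH] f loc.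
  split=> //; apply/within_cubeP => x B Ux nB.
  have [V [[_ Vo] Vx [/within_cubeP fc _]]] := loc x Ux.
  have [d d0 dV] := Vo x Vx; have [d' d'0 dB] := fc x B Vx nB.
  exists (Num.min d d'); first by rewrite lt_min d0.
  move=> y Uy xy; apply: dB; last by apply: cube_le xy; rewrite ge_min lexx orbT.
  by apply: dV; split; [apply: cube_le xy; rewrite ge_min lexx | exact: UH].
split.
  apply/within_cubeP => x B Ux nB.
  have [V [[_ Vo] Vx [/within_cubeP fc _]]] := loc x Ux.
  have [d d0 dV] := Vo x Vx; have [d' d'0 dB] := fc x B Vx nB.
  exists (Num.min d d'); first by rewrite lt_min d0.
  move=> y Uy xy; apply: dB; last by apply: cube_le xy; rewrite ge_min lexx orbT.
  by apply: dV; split; [apply: cube_le xy; rewrite ge_min lexx | exact: UH].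
move=> i; split=> [x Ux|].
  by have [V [_ Vx [_ fC]]] := loc x Ux; have [fd _] := fC i; exact: fd.
apply: IH => x Ux; have [V [Vo Vx [_ fC]]] := loc x Ux.
by exists V; split=> //; have [] := fC i.
Qed.

Lemma Ck1_ispd U f x i : Ck 1 U f -> U x -> ispd i f x (pderiv i f x).
Proof. by move=> [_ fC] Ux; apply: pderivableP; have [] := fC i; auto. Qed.

Lemma ispd_comp n (U : set 'rV[R]_m) f (c : 'rV[R]_n -> 'rV[R]_m) (x : 'rV[R]_n)
    (i : 'I_n) (l : 'I_m -> R) (d : R) :
  ropen U -> Ck 1 U f -> U (c x) -> 0 < d ->
  (forall y : 'rV[R]_n, halfspace n y -> cube x d y -> halfspace m (c y)) ->
  (forall b, ispd i (fun y : 'rV[R]_n => c y ord0 b) x (l b)) ->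
  ispd i (f \o c) x (\sum_b pderiv b f (c x) * l b).
Proof.
move=> Uro fC Ucx d0 cH cl; rewrite /ispd -compA.
have F1 := incr_filter_filter i x.
apply: (@sdiff_dquot _ _ _ (incr_filter_filter i x) (@incr_filter0 _ _ i x)).
- by rewrite /= pline0; exact: C1_sdiff fC Ucx.
- by rewrite /= pline0; apply: Uro.1.
- near=> s; apply: cH; first by near: s; exact: incr_filter_halfspace.
  by near: s; exact: incr_filter_cube.
- exact: cl.
Unshelve. all: by end_near. Qed.

(** Positive increments are admissible everywhere, negative ones unless [i] is the index 0 and [x]
    lies on the face. Hence at a local minimum over the half-space a partial derivative is
    nonnegative, and zero off the face or in the directions along it. *)
Lemma pincr_right i x : halfspace m x -> incr_filter i x `<=` (0 : R)^'+ .
Proof.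
move=> Hx A; rewrite /incr_filter /at_right /within /=; apply: filterS => s As s0.
apply: As; split; first by rewrite gt_eqF.
move=> k k0; rewrite -/(pline i x s) plineE addr_ge0 ?Hx //.
by apply: mulr_ge0; [exact: ltW | exact: ler0n].
Qed.

Lemma pincr_left i x : halfspace m x -> (val i = 0%N -> 0 < x ord0 i) ->
  incr_filter i x `<=` (0 : R)^'- .
Proof.
move=> Hx x0 A; rewrite /incr_filter /at_left /within /=.
pose d := if val i == 0%N then x ord0 i else 1.
have d0 : 0 < d by rewrite /d; case: eqP => // /x0.
move=> An; near=> s => s0.
have sA : pincr i x s -> A s by near: s.
apply: sA; split; first by rewrite lt_eqF.
have sd : `|s| < d.
  by near: s; apply/nbhs_ballP; exists d => //= u; rewrite -ball_normE /= sub0r normrN.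
move=> k k0; rewrite -/(pline i x s) plineE.
case: eqVneq => [ki|_] /=; last by rewrite mulr0 addr0; exact: Hx.
move: sd; rewrite /d -ki k0 eqxx mulr1 ltr_norml => /andP[]; lra.
Unshelve. all: by end_near. Qed.

Lemma ispd_min_ge0 i f x l (d : R) : 0 < d -> halfspace m x ->
  (forall y, halfspace m y -> cube x d y -> f x <= f y) -> ispd i f x l -> 0 <= l.
Proof.
move=> d0 Hx xmin fl; have F1 := incr_filter_filter i x.
have fr : dquot (f \o pline i x) @ (0 : R)^'+ --> l.
  by apply: cvg_trans fl; apply: cvg_app; exact: pincr_right.
suff : 0 <= lim (dquot (f \o pline i x) @ (0 : R)^'+).
  by rewrite (cvg_lim (@norm_hausdorff R R) fr).
apply: limr_ge; first by apply/cvg_ex; exists l.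
have min_n : \forall s \near (0 : R)^'+, f x <= f (pline i x s).
  have : \forall s \near incr_filter i x, f x <= f (pline i x s).
    near=> s; apply: xmin; first by near: s; exact: incr_filter_halfspace.
    by near: s; exact: incr_filter_cube.
  by move=> H; exact: (pincr_right Hx H).
near=> s; rewrite /dquot /= pline0 mulr_ge0 ?subr_ge0 //; last by near: s.
by rewrite invr_ge0; near: s; exact: nbhs_right_ge.
Unshelve. all: by end_near. Qed.

Lemma ispd_min_eq0 i f x l (d : R) : 0 < d -> halfspace m x ->
  (val i = 0%N -> 0 < x ord0 i) ->
  (forall y, halfspace m y -> cube x d y -> f x <= f y) -> ispd i f x l -> l = 0.
Proof.
move=> d0 Hx x0 xmin fl; have F1 := incr_filter_filter i x.
apply/eqP; rewrite eq_le (ispd_min_ge0 d0 Hx xmin fl) andbT.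
have fr : dquot (f \o pline i x) @ (0 : R)^'- --> l.
  by apply: cvg_trans fl; apply: cvg_app; exact: pincr_left.
suff : lim (dquot (f \o pline i x) @ (0 : R)^'-) <= 0.
  by rewrite (cvg_lim (@norm_hausdorff R R) fr).
apply: limr_le; first by apply/cvg_ex; exists l.
have min_n : \forall s \near (0 : R)^'-, f x <= f (pline i x s).
  have : \forall s \near incr_filter i x, f x <= f (pline i x s).
    near=> s; apply: xmin; first by near: s; exact: incr_filter_halfspace.
    by near: s; exact: incr_filter_cube.
  by move=> H; exact: (pincr_left Hx x0 H).
near=> s; rewrite /dquot /= pline0 mulr_le0_ge0 ?subr_ge0 //; last by near: s.
by rewrite invr_le0; near: s; exact: nbhs_left_le.
Unshelve. all: by end_near. Qed.

End SmoothFunctions.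

(** * Jacobians and C^1 curves *)

Section Jacobians.
Variable R : realType.

Lemma jac_comp m n r (U : set 'rV[R]_m) (V : set 'rV[R]_n)
    (f : 'rV[R]_m -> 'rV[R]_n) (h : 'rV[R]_n -> 'rV[R]_r) (x : 'rV[R]_m) :
  ropen U -> ropen V -> U x -> (forall y, U y -> V (f y)) ->
  (forall b, Ck 1 U (fun y => f y ord0 b)) -> (forall b, Ck 1 V (fun y => h y ord0 b)) ->
  jac (h \o f) x = jac f x *m jac h (f x).
Proof.
move=> Uro Vro Ux UV fC hC; apply/matrixP => a b; rewrite !mxE.
have [d d0 dU] := Uro.2 x Ux.
have H := @ispd_comp R n m V (fun y => h y ord0 b) f x a
  (fun k => pderiv a (fun y => f y ord0 k) x) d Vro (hC b) (UV x Ux) d0.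
rewrite -[LHS]/(pderiv a ((fun y => h y ord0 b) \o f) x).
rewrite (ispd_pderiv (Uro.1 _ Ux) (H _ _)).
- by apply: eq_bigr => k _; rewrite !mxE mulrC.
- by move=> y Hy xy; apply: Vro.1; apply: UV; exact: dU.
- by move=> k; apply: Ck1_ispd (fC k) Ux.
Qed.

Lemma jac_near m n (f g : 'rV[R]_m -> 'rV[R]_n) (x : 'rV[R]_m) (d : R) :
  0 < d -> halfspace m x -> (forall y, halfspace m y -> cube x d y -> f y = g y) ->
  jac f x = jac g x.
Proof.
move=> d0 Hx fg; apply/matrixP => a b; rewrite !mxE.
by apply: pderiv_near d0 Hx _ => y Hy xy; rewrite fg.
Qed.

Lemma jac_id m (x : 'rV[R]_m) : halfspace m x -> jac (fun y : 'rV[R]_m => y) x = 1%:M.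
Proof.
move=> Hx; apply/matrixP => a b; rewrite !mxE.
by rewrite (ispd_pderiv Hx (@ispd_coord _ _ a b x)) eq_sym.
Qed.

End Jacobians.

Section Curves.
Variable R : realType.

Definition C1_at (phi : R -> R) (t : R) : Prop :=
  (\forall s \near t, derivable phi s 1) /\ {for t, continuous (derive1 phi)}.

Lemma C1_at_near (phi chi : R -> R) (t : R) : (\forall s \near t, phi s = chi s) -> C1_at phi t ->
  C1_at chi t /\ derive1 chi t = derive1 phi t.
Proof.
move=> E [pd pc].
have E' : \forall s \near t, derive1 chi s = derive1 phi s.
  near=> s; rewrite !derive1E; apply: near_eq_derive.
  have : \forall u \near s, phi u = chi u by near: s; exact: near_join E.
  by apply: filterS => u ->.
split; last exact: (nbhs_singleton E').
split.
  near=> s; apply: (@near_eq_derivable _ _ _ phi); last by near: s.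
  by near: s; exact: near_join E.
suff : derive1 chi @ t --> derive1 phi t by rewrite -(nbhs_singleton E').
apply: cvg_trans pc.
by apply: near_eq_cvg; apply: filterS E' => s ->.
Unshelve. all: by end_near. Qed.

Lemma derivable_continuous1 (phi : R -> R) (t : R) : derivable phi t 1 -> {for t, continuous phi}.
Proof. by move=> /derivable1_diffP /differentiable_continuous. Qed.

Variable m : nat.
Implicit Types (U : set 'rV[R]_m) (c : R -> 'rV[R]_m).

Lemma curve_cube c (t d : R) : (forall k, {for t, continuous (fun s => c s ord0 k)}) -> 0 < d ->
  \forall s \near t, cube (c t) d (c s).
Proof.
move=> cc d0; apply: (@filter_forall R _ _ (nbhs t) _) => k.
have /cvgrPdist_lt /(_ d d0) := cc k.
by apply: filterS => s; rewrite distrC.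
Qed.

Lemma is_derive_comp_curve U (f : 'rV[R]_m -> R) c (t : R) : ropen U -> Ck 1 U f -> U (c t) ->
  (\forall s \near t, halfspace m (c s)) ->
  (forall k, derivable (fun s => c s ord0 k) t 1) ->
  is_derive t 1 (f \o c) (\sum_k pderiv k f (c t) * derive1 (fun s => c s ord0 k) t).
Proof.
move=> Uro fC Ut Hn cd; apply/dquot_is_derive.
have -> : (fun s => (f \o c) (t + s)) = f \o (fun s => c (t + s)) by [].
apply: (@sdiff_dquot _ _ (0 : R)^' _ _ f (fun s => c (t + s))).
- by move=> A.
- by rewrite addr0; exact: C1_sdiff Ut.
- by rewrite addr0; exact: Uro.1 Ut.
- apply: nbhs_dnbhs => /=.
  have : (fun s : R => t + s) @ (0 : R) --> t.
    rewrite -[X in _ --> X](addr0 t); apply: cvgD; first exact: cvg_cst.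
    exact: cvg_id.
  by move=> H; exact: (H _ Hn).
- move=> k; apply/(dquot_is_derive (fun s => c s ord0 k) t).
  by rewrite derive1E; apply: DeriveDef => //; exact: cd.
Qed.

Lemma C1_at_comp U (f : 'rV[R]_m -> R) c (t : R) : ropen U -> Ck 1 U f -> (\forall s \near t, U (c s)) ->
  (forall k, C1_at (fun s => c s ord0 k) t) ->
  C1_at (f \o c) t /\
  derive1 (f \o c) t = \sum_k pderiv k f (c t) * derive1 (fun s => c s ord0 k) t.
Proof.
move=> Uro fC Un cC.
have Un2 := near_join Un.
have dn : \forall s \near t, forall k, derivable (fun s => c s ord0 k) s 1.
  by apply: (@filter_forall R _ _ (nbhs t) _) => k; have [] := cC k.
have D : \forall s \near t, is_derive (s : R) 1 (f \o c : R -> R)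
    (\sum_k pderiv k f (c s) * derive1 (fun s => c s ord0 k) s).
  near=> s; apply: (is_derive_comp_curve Uro fC).
  - by near: s.
  - have : \forall u \near s, U (c u) by near: s.
    by apply: filterS => u; apply: Uro.1.
  - by near: s.
have D1 : \forall s \near t, derive1 (f \o c) s =
    \sum_k pderiv k f (c s) * derive1 (fun s => c s ord0 k) s.
  by apply: filterS D => s [_ <-]; rewrite derive1E.
have Ut := nbhs_singleton Un.
split; last exact: nbhs_singleton D1.
split; first by apply: filterS D => s [].
suff : derive1 (f \o c) @ t --> \sum_k pderiv k f (c t) * derive1 (fun s => c s ord0 k) t.
  by rewrite -(nbhs_singleton D1).
apply: cvg_trans (_ : (fun s => \sum_k pderiv k f (c s) *
  derive1 (fun s => c s ord0 k) s) @ t --> _).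
  by apply: near_eq_cvg; apply: filterS D1 => s ->.
apply: cvg_big; first exact: add_continuous.
move=> k _; apply: cvgM; last by have [] := cC k.
have [_ fk] := fC; have [_ [/within_contP fkc _]] := fk k.
apply/cvgrPdist_lt => e e0; have [d d0 de] := fkc _ e Ut e0.
near=> s; rewrite distrC; apply: de; first by near: s.
near: s; apply: curve_cube => // r; apply: derivable_continuous1.
have [cd _] := cC r; exact: (nbhs_singleton cd).
Unshelve. all: by end_near. Qed.

End Curves.

(** * Positive definite Gram matrices *)

Section PositiveDefinite.
Variable R : realType.

Definition posdef m (G : 'M[R]_m) : Prop :=
  G^T = G /\ forall w : 'rV[R]_m, w != 0 -> 0 < inner G w w.

Lemma inner_add_scalel m (G : 'M[R]_m) a u v w :
  inner G (a *: u + v) w = a * inner G u w + inner G v w.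
Proof. by rewrite /inner !mulmxDl -!scalemxAl !mxE. Qed.

Lemma inner_add_scaler m (G : 'M[R]_m) a u v w :
  inner G w (a *: u + v) = a * inner G w u + inner G w v.
Proof. by rewrite /inner linearD linearZ /= mulmxDr -!scalemxAr !mxE. Qed.

Lemma innerC m (G : 'M[R]_m) u v : G^T = G -> inner G u v = inner G v u.
Proof.
move=> Gs; rewrite /inner; have -> : v *m G *m u^T = (u *m G *m v^T)^T.
  by rewrite !trmx_mul trmxK Gs mulmxA.
by rewrite [RHS]mxE.
Qed.

Lemma inner_mulmx m n (G : 'M[R]_m) (J : 'M[R]_(n, m)) u v :
  inner (J *m G *m J^T) u v = inner G (u *m J) (v *m J).
Proof. by rewrite /inner trmx_mul !mulmxA. Qed.

Lemma inner0l m (G : 'M[R]_m) v : inner G 0 v = 0.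
Proof. by rewrite /inner !mul0mx mxE. Qed.

Lemma posdef_ge0 m (G : 'M[R]_m) v : posdef G -> 0 <= inner G v v.
Proof.
move=> [_ Gp]; have [->|/Gp /ltW //] := eqVneq v 0; by rewrite inner0l.
Qed.

Lemma posdef_unit m (G : 'M[R]_m) : posdef G -> G \in unitmx.
Proof.
move=> [_ Gp]; rewrite -row_free_unit -kermx_eq0; apply/eqP/row_matrixP => i.
rewrite row0; apply/eqP; apply: contraT => /Gp.
have : row i (kermx G) *m G = 0 by rewrite -row_mul mulmx_ker row0.
by rewrite /inner => ->; rewrite mul0mx mxE ltxx.
Qed.

Lemma posdef_congr m n (G : 'M[R]_m) (J : 'M[R]_(n, m)) :
  row_free J -> posdef G -> posdef (J *m G *m J^T).
Proof.
move=> Jf [Gs Gp]; split; first by rewrite !trmx_mul trmxK Gs mulmxA.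
move=> w w0; rewrite inner_mulmx; apply: Gp.
by apply: contraNneq w0 => /eqP; rewrite mulmx_free_eq0.
Qed.

Lemma posdef_inv m (G : 'M[R]_m) : posdef G -> posdef (invmx G).
Proof.
move=> Gp; have Gu := posdef_unit Gp.
have -> : invmx G = invmx G *m G *m (invmx G)^T.
  by rewrite mulVmx // mul1mx trmx_inv Gp.1.
by apply: posdef_congr => //; rewrite row_free_unit unitmx_inv.
Qed.

Lemma innerE m (G : 'M[R]_m) u v :
  inner G u v = \sum_i \sum_j u ord0 i * G i j * v ord0 j.
Proof.
rewrite /inner mxE exchange_big /=; apply: eq_bigr => j _.
by rewrite !mxE mulr_suml.
Qed.

Lemma posdef_diag m (G : 'M[R]_m) k : posdef G -> 0 < G k k.
Proof.
move=> [_ Gp]; have -> : G k k = inner G (delta_mx ord0 k) (delta_mx ord0 k).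
  by rewrite /inner -rowE trmx_delta -colE !mxE.
by apply: Gp; apply/eqP => /matrixP/(_ ord0 k)/eqP; rewrite !mxE !eqxx oner_eq0.
Qed.

Lemma posdef_block m (G : 'M[R]_m) :
  posdef G -> posdef (block_mx G 0 0 (1%:M : 'M[R]_1)).
Proof.
move=> [Gs Gp]; split; first by rewrite tr_block_mx Gs !trmx0 trmx1.
move=> w; rewrite -[w]hsubmxK; set u := lsubmx w; set t := rsubmx w => w0.
have -> : inner (block_mx G 0 0 1%:M) (row_mx u t) (row_mx u t) = inner G u u + t ord0 ord0 ^+ 2.
  rewrite /inner tr_row_mx mul_row_block !mulmx0 addr0 add0r mulmx1 mul_row_col !mxE.
  by rewrite big_ord1 !mxE expr2.
have [u0|u0] := eqVneq u 0; last by apply: ltr_wpDr; [exact: sqr_ge0 | exact: Gp].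
rewrite u0 inner0l add0r exprn_even_gt0 //=.
apply: contraNneq w0 => t0; rewrite u0; apply/eqP/rowP => j.
rewrite mxE; case: splitP => k _; first by rewrite !mxE.
by rewrite (ord1 k) t0 mxE.
Qed.

(** [E] stacks the tangent frame on the normal. Its Gram matrix is block diagonal with blocks [H]
    and 1, hence invertible, and so is [G *m E^T]. The difference of the two sides is orthogonal to
    every row of [E], so it vanishes. *)
Lemma normal_decomposition m (J : 'M[R]_(m, m + 1)) (G : 'M[R]_(m + 1))
    (N w : 'rV[R]_(m + 1)) :
  posdef G -> row_free J -> J *m G *m N^T = 0 -> inner G N N = 1 ->
  w = w *m G *m J^T *m invmx (J *m G *m J^T) *m J + inner G w N *: N.
Proof.
move=> Gp Jf JN NN; set H := J *m G *m J^T.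
have Hu : H \in unitmx by apply: posdef_unit; exact: posdef_congr.
have Gu := posdef_unit Gp.
have NJ : N *m G *m J^T = 0.
  by have := congr1 trmx JN; rewrite !trmx_mul trmxK Gp.1 trmx0 mulmxA.
have scal1 (A : 'M[R]_1) : A = (A ord0 ord0)%:M.
  by apply/matrixP => i j; rewrite (ord1 i) (ord1 j) mxE eqxx mulr1n.
pose E := col_mx J N.
have EG : E *m G *m E^T = block_mx H 0 0 1%:M.
  rewrite /E tr_col_mx mul_col_mx mul_col_row JN NJ.
  by rewrite [N *m G *m N^T]scal1 -/(inner G N N) NN.
have GEu : G *m E^T \in unitmx.
  have : E *m G *m E^T \in unitmx.
    by rewrite EG; apply: posdef_unit; apply: posdef_block; exact: posdef_congr.
  rewrite !unitmxE !det_mulmx !unitrM det_tr => /andP[/andP[-> ->] _] //.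
set z := w *m G *m J^T *m invmx H.
apply/eqP; rewrite -subr_eq0; apply/eqP.
rewrite -[LHS](mulmxK GEu) (_ : _ *m (G *m E^T) = 0) ?mul0mx //.
rewrite mulmxA /E tr_col_mx mul_mx_row.
suff [-> ->] : (w - (z *m J + inner G w N *: N)) *m G *m J^T = 0 /\
    (w - (z *m J + inner G w N *: N)) *m G *m N^T = 0 by rewrite row_mx0.
have expand (B : 'M[R]_(m + 1, m)) : (w - (z *m J + inner G w N *: N)) *m B =
    w *m B - (z *m (J *m B) + inner G w N *: (N *m B)).
  by rewrite mulmxBl mulmxDl scalemxAl mulmxA.
have expand1 (B : 'M[R]_(m + 1, 1)) : (w - (z *m J + inner G w N *: N)) *m B =
    w *m B - (z *m (J *m B) + inner G w N *: (N *m B)).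
  by rewrite mulmxBl mulmxDl scalemxAl mulmxA.
have zJ (k : nat) (B : 'M[R]_(m + 1, k)) : z *m J *m G *m B = z *m (J *m G *m B).
  by rewrite !mulmxA.
split; rewrite -mulmxA ?expand ?expand1 !mulmxA zJ.
  by rewrite NJ scaler0 addr0 -/H /z mulmxKV // subrr.
rewrite JN mulmx0 add0r.
rewrite [N *m G *m N^T]scal1 -/(inner G N N) NN [w *m G *m N^T]scal1 -/(inner G w N).
by rewrite scalemx1 subrr.
Qed.

End PositiveDefinite.

(** * Changes of charts and invariance of the boundary *)

Section ChartsAndBoundary.
Variables (R : realType) (n : nat) (M : manifold R n).
Implicit Types (p q : M) (i j : chart_index M).

Definition overlap i j : set 'rV[R]_n :=
  [set x | @chart_cod _ _ M i x /\ chart_dom j (par i x)].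

Lemma cod_ropen i : ropen (@chart_cod _ _ M i).
Proof. by have [W oW ->] := cod_open i; exact: ropen_openI. Qed.

Lemma crd_cod i p : chart_dom i p -> @chart_cod _ _ M i (crd i p).
Proof. by move=> ip; exists p. Qed.

Lemma par_dom i (x : 'rV[R]_n) : @chart_cod _ _ M i x -> chart_dom i (par i x : M).
Proof. by move=> [p ip <-]; rewrite crdK. Qed.

Lemma parK i (x : 'rV[R]_n) : @chart_cod _ _ M i x -> crd i (par i x : M) = x.
Proof. by move=> [p ip <-]; rewrite crdK. Qed.

Lemma crd_halfspace i p : chart_dom i p -> halfspace n (crd i p).
Proof. by move=> /crd_cod; apply: (cod_ropen i).1. Qed.

Lemma overlap_ropen i j : ropen (overlap i j).
Proof.
apply: ropen_preimage; [exact: cod_ropen | exact: par_continuous | exact: dom_open].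
Qed.

Lemma overlap_crd i j p : chart_dom i p -> chart_dom j p -> overlap i j (crd i p).
Proof. by move=> ip jp; split; [exact: crd_cod | rewrite crdK]. Qed.

Lemma transition_jacV i j p : chart_dom i p -> chart_dom j p ->
  transition_jac i j p *m transition_jac j i p = 1%:M.
Proof.
move=> ip jp.
have [d d0 dU] := (overlap_ropen i j).2 _ (overlap_crd ip jp).
rewrite /transition_jac.
have -> : crd j p = (crd j \o par i) (crd i p) by rewrite /= crdK.
rewrite -(@jac_comp _ _ _ _ (overlap i j) (overlap j i)).
- rewrite -(jac_id (crd_halfspace ip)); apply: jac_near d0 (crd_halfspace ip) _.
  move=> y Hy xy; have [iy jy] : overlap i j y by exact: dU.
  by rewrite /= crdK // parK.
- exact: overlap_ropen.
- exact: overlap_ropen.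
- exact: overlap_crd.
- move=> y [iy jy] /=; split; first exact: crd_cod.
  by rewrite crdK //; exact: par_dom.
- by move=> b; apply: (transition_smooth i j b 1).
- by move=> b; apply: (transition_smooth j i b 1).
Qed.

(* If [p] were interior in the chart [j], the first coordinate of the transition from [j]
   to [i] would have an interior minimum there, and its Jacobian would be singular. *)
Lemma boundary_crd0 i p (k : 'I_n) : chart_dom i p -> boundary p -> val k = 0%N ->
  crd i p ord0 k = 0.
Proof.
move=> ip [j jp j0] k0; apply/eqP; apply: contraT => ne.
have xk : 0 < crd i p ord0 k.
  by rewrite lt_def ne; exact: crd_halfspace ip k k0.
have [d d0 dU] := (overlap_ropen i j).2 _ (overlap_crd ip jp).
have Hi := crd_halfspace ip.
have z a : transition_jac i j p a k = 0.
  rewrite mxE; apply: (ispd_min_eq0 d0 Hi (i := a)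
    (f := fun y => (crd j \o par i) y ord0 k)).
  - by move=> a0; have -> : a = k by apply: val_inj; rewrite a0 k0.
  - move=> y Hy xy; rewrite /= crdK // j0 //.
    have [_ jy] : overlap i j y by exact: dU.
    exact: (crd_halfspace jy).
  - by apply: Ck1_ispd (transition_smooth i j k 1) _; exact: overlap_crd.
have := transition_jacV jp ip => /matrixP/(_ k k).
rewrite !mxE eqxx big1 => [/eqP|a _]; first by rewrite eq_sym oner_eq0.
by rewrite z mulr0.
Qed.

End ChartsAndBoundary.

Section InnerRows.
Variables (R : realType) (m : nat) (G : 'M[R]_m).

Lemma innerZr c u v : inner G u (c *: v) = c * inner G u v.
Proof. by rewrite /inner linearZ /= -scalemxAr mxE. Qed.

Lemma inner_sumr (I : finType) (P : pred I) (f : I -> 'rV[R]_m) u :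
  inner G u (\sum_(i | P i) f i) = \sum_(i | P i) inner G u (f i).
Proof. by rewrite /inner linear_sum /= mulmx_sumr summxE. Qed.

Lemma inner_row_inv u k : posdef G -> inner G u (row k (invmx G)) = u ord0 k.
Proof.
move=> Gp; rewrite /inner tr_row trmx_inv Gp.1 colE mulmxA mulmxK ?posdef_unit //.
by rewrite -colE mxE.
Qed.

End InnerRows.

(** * Algebra of the Levi-Civita connection *)

Section ChristoffelAlgebra.
Variables (R : realType) (m : nat) (G : 'M[R]_m) (dG : 'I_m -> 'I_m -> 'I_m -> R).
Hypotheses (G_unit : G \in unitmx) (G_sym : G^T = G).
Hypothesis dG_sym : forall b c l, dG b c l = dG b l c.

(** Christoffel symbols of the first kind; [dG b c l] stands for the derivative in direction [b] of
    the entry [(c, l)] of the metric. *)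
Definition lowered (b c l : 'I_m) : R := 2^-1 * (dG b c l + dG c b l - dG l b c).

(** The zeroth-order part of the covariant derivative of [w] in direction [v]. [GammaC] expresses
    that the connection is torsion free, [Gamma_compat] that it is metric. *)
Definition Gamma (v w : 'rV[R]_m) : 'rV[R]_m :=
  \row_k \sum_b \sum_c
    (2^-1 * \sum_l invmx G k l * (dG b c l + dG c b l - dG l b c))
      * v ord0 b * w ord0 c.

Lemma inner_Gamma v w z : inner G (Gamma v w) z =
  \sum_b \sum_c \sum_l lowered b c l * v ord0 b * w ord0 c * z ord0 l.
Proof.
have -> : Gamma v w = (\row_l \sum_b \sum_c lowered b c l * v ord0 b * w ord0 c) *m invmx G.
  apply/rowP => k; rewrite !mxE.
  under [RHS]eq_bigr => l _ do rewrite !mxE mulr_suml.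
  rewrite [RHS]exchange_big /=; apply: eq_bigr => b _.
  under [RHS]eq_bigr => l _ do rewrite mulr_suml.
  rewrite [RHS]exchange_big /=; apply: eq_bigr => c _.
  rewrite mulr_sumr !mulr_suml; apply: eq_bigr => l _.
  have -> : invmx G k l = invmx G l k by rewrite -{1}G_sym -trmx_inv mxE.
  by rewrite /lowered; ring.
rewrite /inner mulmxKV // mxE.
under eq_bigr => l _ do rewrite !mxE mulr_suml.
rewrite exchange_big /=; apply: eq_bigr => b _.
under eq_bigr => l _ do rewrite mulr_suml.
by rewrite exchange_big.
Qed.

Lemma GammaC v w : Gamma v w = Gamma w v.
Proof.
apply/rowP => k; rewrite !mxE exchange_big /=; apply: eq_bigr => c _.
apply: eq_bigr => b _; rewrite mulrAC; congr (_ * _ * _); congr (_ * _).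
by apply: eq_bigr => l _; rewrite (dG_sym l b c); ring.
Qed.

Lemma Gamma_compat v w z :
  inner G (Gamma v w) z + inner G w (Gamma v z) =
  \sum_c \sum_l w ord0 c * (\sum_b v ord0 b * dG b c l) * z ord0 l.
Proof.
rewrite (innerC w) // !inner_Gamma.
have -> : \sum_b \sum_c \sum_l lowered b c l * v ord0 b * z ord0 c * w ord0 l =
    \sum_b \sum_c \sum_l lowered b l c * v ord0 b * w ord0 c * z ord0 l.
  apply: eq_bigr => b _; rewrite exchange_big /=; apply: eq_bigr => c _.
  by apply: eq_bigr => l _; rewrite mulrAC.
rewrite -big_split /=.
have -> : \sum_c \sum_l w ord0 c * (\sum_b v ord0 b * dG b c l) * z ord0 l =
    \sum_b \sum_c \sum_l w ord0 c * (v ord0 b * dG b c l) * z ord0 l.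
  rewrite [RHS]exchange_big /=; apply: eq_bigr => c _.
  rewrite [RHS]exchange_big /=; apply: eq_bigr => l _.
  by rewrite mulr_sumr mulr_suml.
apply: eq_bigr => b _; rewrite -big_split /=; apply: eq_bigr => c _.
rewrite -big_split /=; apply: eq_bigr => l _.
rewrite /lowered (dG_sym b l c) (dG_sym l b c) (dG_sym c b l).
by field.
Qed.

(* The Koszul formula: [P a b d] plays <D_a X_b, X_d>. *)
Lemma koszul n (P dH : 'I_n -> 'I_n -> 'I_n -> R) :
  (forall a b d, P a b d = P b a d) ->
  (forall a b d, dH a b d = P a b d + P a d b) ->
  forall a b d, dH a b d + dH b a d - dH d a b = 2 * P a b d.
Proof.
move=> Ps dHP a b d; rewrite !dHP (Ps b a d) (Ps d a b) (Ps d b a); ring.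
Qed.

End ChristoffelAlgebra.

(** * Partial derivatives in product coordinates *)

Section ProductCoordinates.
Variables (R : realType) (n : nat) (n_gt0 : (0 < n)%N).
Implicit Types (y : 'rV[R]_(n + 1)) (f : 'rV[R]_n -> R).

Lemma ordD1_ind (P : 'I_(n + 1) -> Prop) :
  (forall a, P (lshift 1 a)) -> P (rshift n ord0) -> forall k, P k.
Proof.
by move=> Pl Pr k; rewrite -[k]splitK; case: (fintype.split k) => k' //=; rewrite (ord1 k').
Qed.

Lemma ispd_comp1 m (v : R -> R) (c : 'rV[R]_m -> R) (x : 'rV[R]_m) i l :
  derivable v (c x) 1 -> ispd i c x l -> ispd i (v \o c) x (derive1 v (c x) * l).
Proof.
move=> vd cl; have F1 := incr_filter_filter i x.
(* The increment of [c] may vanish for [s != 0], so the quotient of [v] is extended by the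
   derivative at 0; the extension is continuous there. *)
pose q h := if h == 0 then derive1 v (c x) else h^-1 * (v (c x + h) - v (c x)).
have qc : q @ (0 : R) --> derive1 v (c x).
  have /dquot_is_derive H : is_derive (c x) 1 v (derive1 v (c x)).
    by rewrite derive1E; apply: DeriveDef.
  have q0 : q 0 = derive1 v (c x) by rewrite /q eqxx.
  rewrite -q0; apply/continuous_withinNx; rewrite q0.
  apply: cvg_trans H; apply: near_eq_cvg; near=> h.
  have h0 : h != 0 by near: h; exact: (@nbhs_dnbhs_neq R 0).
  by rewrite /q (negbTE h0) /dquot addr0.
have cc : (fun s => c (pline i x s) - c x) @ incr_filter i x --> (0 : R).
  have := @dquot_continuous R _ (incr_filter_filter i x) (@incr_filter0 _ _ i x) _ _ cl.
  rewrite /= pline0 => H; rewrite -[X in _ --> X](subrr (c x)).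
  by apply: cvgB => //; exact: cvg_cst.
rewrite /ispd; have -> : dquot ((v \o c) \o pline i x) = fun s =>
    q (c (pline i x s) - c x) * dquot (c \o pline i x) s.
  apply/funext => s; rewrite /dquot /q /= pline0.
  case: eqVneq => [e|ne].
    have -> : c (pline i x s) = c x by apply/eqP; rewrite -subr_eq0 e.
    by rewrite !subrr !mulr0.
  have -> : c x + (c (pline i x s) - c x) = c (pline i x s) by ring.
  move: ne; move: (c (pline i x s) - c x) => z z0.
  by rewrite [RHS]mulrCA; congr (_ * _); rewrite mulrAC mulVf // mul1r.
apply: cvgM; last exact: cl.
exact: (@cvg_comp _ _ _ (fun s => c (pline i x s) - c x) q _ _ _ cc qc).
Unshelve. all: by end_near. Qed.

(** As [n > 0], the coordinate of index 0 belongs to the left block, that of M. *)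
Lemma halfspace_lsub y : halfspace (n + 1) y <-> halfspace n (lsubmx y).
Proof.
split=> H k k0; first by rewrite mxE; exact: H.
have kn : (k < n)%N by rewrite k0.
by have := H (Ordinal kn) k0; rewrite mxE; congr (0 <= y _ _); apply: val_inj.
Qed.

Lemma lsubmx_pline_l a y s : lsubmx (pline (lshift 1 a) y s) = pline a (lsubmx y) s.
Proof. by apply/rowP => k; rewrite mxE !plineE mxE (inj_eq (@lshift_inj _ _)). Qed.

Lemma lsubmx_pline_r b y s : lsubmx (pline (rshift n b) y s) = lsubmx y.
Proof. by apply/rowP => k; rewrite mxE plineE mxE eq_lrshift mulr0 addr0. Qed.

Lemma ispd_lsub_l a f y l : ispd a f (lsubmx y) l -> ispd (lshift 1 a) (f \o lsubmx) y l.
Proof.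
rewrite /ispd.
have -> : (f \o lsubmx) \o pline (lshift 1 a) y = f \o pline a (lsubmx y).
  by apply/funext => s /=; rewrite lsubmx_pline_l.
apply: cvg_trans; apply: cvg_app => A; rewrite /incr_filter /within !nbhs_simpl /=.
apply: filterS => s As [s0 Hs]; apply: As; split=> //.
by rewrite -/(pline _ _ _) -lsubmx_pline_l; apply/halfspace_lsub.
Qed.

Lemma ispd_lsub_r b f y : ispd (rshift n b) (f \o lsubmx) y 0.
Proof.
rewrite /ispd; have -> : (f \o lsubmx) \o pline (rshift n b) y = fun=> f (lsubmx y).
  by apply/funext => s /=; rewrite lsubmx_pline_r.
exact: (@dquot_cst _ _ (incr_filter_filter _ _)).
Qed.

Lemma ispd_rsub (v : R -> R) k y : derivable v (rsubmx y ord0 ord0) 1 ->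
  ispd k (fun z : 'rV[R]_(n + 1) => v (rsubmx z ord0 ord0)) y
    (derive1 v (rsubmx y ord0 ord0) * (rshift n ord0 == k)%:R).
Proof.
have E : (fun z : 'rV[R]_(n + 1) => rsubmx z ord0 ord0) =
    (fun z : 'rV[R]_(n + 1) => z ord0 (rshift n ord0)).
  by apply/funext => z; rewrite mxE.
move=> vd; apply: (@ispd_comp1 _ v (fun z : 'rV[R]_(n + 1) => rsubmx z ord0 ord0)) => //.
by rewrite E; exact: ispd_coord.
Qed.

End ProductCoordinates.

(** * The height function of a hypersurface *)

Section MapsToCylinder.
Variables (R : realType) (n : nat) (n_gt0 : (0 < n)%N).
Variables (M : manifold R n) (g : metric_on M) (g_riem : riemannian g).
Variables (S : manifold R n) (F : S -> M * R) (F_imm : immersion F).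
Implicit Types (i : chart_index S) (j : chart_index M) (p : S).

Definition base i j (x : 'rV[R]_n) : 'rV[R]_n := crd j (F (par i x)).1.

Definition height i (x : 'rV[R]_n) : R := (F (par i x)).2.

Definition base_jac i j p : 'M[R]_n := lsubmx (differential F i j p).

Lemma riemannian_posdef j q : chart_dom j q -> posdef (g j q).
Proof. by move=> jq; case: g_riem => gs gp _ _; split=> [|w]; [exact: gs | exact: gp]. Qed.

Lemma cyl_posdef j (q : M * R) : chart_dom j q.1 -> posdef (cyl_metric g j q).
Proof. by move=> jq; apply: posdef_block; exact: riemannian_posdef. Qed.

Lemma F_continuous1 : continuous (fun p => (F p).1).
Proof.
case: F_imm => Fc _ _ p; apply: (@cvg_comp _ _ _ F fst _ (nbhs (F p))); first exact: Fc.
exact: cvg_fst.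
Qed.

Lemma map_dom_ropen i j : ropen (map_dom F i j).
Proof.
apply: (@ropen_preimage _ _ _ _ (fun x => (F (par i x)).1)) => //; last exact: dom_open.
  exact: cod_ropen.
apply/within_cubeP => x B Ux nB.
have [d d0 dB] := (within_cubeP _ _).1 (@par_continuous _ _ S i) x _ Ux (F_continuous1 nB).
by exists d.
Qed.

Lemma map_dom_crd i j p : chart_dom i p -> chart_dom j (F p).1 -> map_dom F i j (crd i p).
Proof. by move=> ip jp; split; [exact: crd_cod | rewrite crdK]. Qed.

Lemma base_smooth i j k b : Ck k (map_dom F i j) (fun x => base i j x ord0 b).
Proof.
case: F_imm => _ Fs _; have := Fs i j (lshift 1 b) k.
by congr (Ck _ _ _); apply/funext => x; rewrite /map_crd /cyl_crd row_mxEl.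
Qed.

Lemma height_smooth_dom i j k : Ck k (map_dom F i j) (height i).
Proof.
case: F_imm => _ Fs _; have := Fs i j (rshift n ord0) k.
by congr (Ck _ _ _); apply/funext => x; rewrite /map_crd /cyl_crd row_mxEr mxE eqxx mulr1n.
Qed.

Lemma height_Ck i k : Ck k (@chart_cod _ _ S i) (height i).
Proof.
apply: Ck_local; first exact: (cod_ropen i).1.
move=> x ix; exists (map_dom F i (chart_at (F (par i x)).1)); split.
- exact: map_dom_ropen.
- by split=> //; exact: dom_chart_at.
- exact: height_smooth_dom.
Qed.

Lemma differentialE i j p a :
  (forall b, differential F i j p a (lshift 1 b) = pderiv a (fun x => base i j x ord0 b) (crd i p)) /\
  differential F i j p a (rshift n ord0) = pderiv a (height i) (crd i p).
Proof.
split=> [b|]; rewrite mxE; congr (pderiv _ _ _); apply/funext => x.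
  by rewrite /map_crd /cyl_crd row_mxEl.
by rewrite /map_crd /cyl_crd row_mxEr mxE eqxx mulr1n.
Qed.

Lemma base_jacE i j p : base_jac i j p = jac (base i j) (crd i p).
Proof.
by apply/matrixP => a b; rewrite !mxE; have [/(_ b) + _] := differentialE i j p a; rewrite mxE.
Qed.

Lemma base_jac_transition i j j' p : chart_dom i p -> chart_dom j (F p).1 ->
  chart_dom j' (F p).1 ->
  base_jac i j' p = base_jac i j p *m transition_jac j j' (F p).1.
Proof.
move=> ip jp j'p; rewrite !base_jacE /transition_jac.
have Eb : base i j (crd i p) = crd j (F p).1 by rewrite /base crdK.
rewrite -Eb; pose U := map_dom F i j `&` map_dom F i j'.
have Uo : ropen U by apply: ropenI; exact: map_dom_ropen.
have Ux : U (crd i p) by split; exact: map_dom_crd.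
rewrite -(@jac_comp _ _ _ _ U (overlap j j')) //.
- have [d d0 dU] := Uo.2 _ Ux; apply: jac_near d0 (Uo.1 _ Ux) _ => y Hy xy.
  by have [[_ jy] _] : U y by [apply: dU]; rewrite /= /base crdK.
- exact: overlap_ropen.
- by move=> y [[iy jy] [_ j'y]]; exact: overlap_crd.
- by move=> b; apply: Ck_sub (base_smooth i j 1 b) => y [].
- by move=> b; exact: (transition_smooth j j' b 1).
Qed.

Lemma differential_transition i j j' p : chart_dom i p -> chart_dom j (F p).1 ->
  chart_dom j' (F p).1 ->
  differential F i j' p =
  differential F i j p *m block_mx (transition_jac j j' (F p).1) 0 0 1%:M.
Proof.
move=> ip jp j'p; rewrite -[LHS]hsubmxK -[X in X *m _]hsubmxK mul_row_block.
rewrite !mulmx0 addr0 add0r mulmx1 -(base_jac_transition ip jp j'p).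
congr (row_mx _ _); apply/matrixP => a b; rewrite mxE [RHS]mxE (ord1 b).
by rewrite (differentialE i j p a).2 (differentialE i j' p a).2.
Qed.

Lemma cyl_metric_transition j j' (q : M * R) : chart_dom j q.1 -> chart_dom j' q.1 ->
  cyl_metric g j q = block_mx (transition_jac j j' q.1) 0 0 1%:M *m cyl_metric g j' q
    *m (block_mx (transition_jac j j' q.1) 0 0 1%:M)^T.
Proof.
move=> jq j'q; rewrite /cyl_metric tr_block_mx !trmx0 trmx1.
rewrite !mulmx_block !mulmx0 !mul0mx !addr0 ?mulmx1 !add0r ?mulmx1; congr block_mx; rewrite ?mul0mx //.
by case: g_riem => _ _ _; apply.
Qed.

(** [induced_metric] is evaluated in the chart chosen at the image of [p], which changes with [p];
    to differentiate it, one fixed chart [j] is needed. *)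
Lemma induced_metricE i j p : chart_dom i p -> chart_dom j (F p).1 ->
  induced_metric g F i p =
  differential F i j p *m cyl_metric g j (F p) *m (differential F i j p)^T.
Proof.
move=> ip jp; have j0p := dom_chart_at (F p).1.
rewrite (differential_transition ip j0p jp) /induced_metric.
by rewrite (cyl_metric_transition j0p jp) trmx_mul !mulmxA.
Qed.

Lemma cyl_parK j (q : M * R) : chart_dom j q.1 -> cyl_par j (cyl_crd j q) = q.
Proof.
by case: q => q t /= jq; rewrite /cyl_par /cyl_crd row_mxKl row_mxKr crdK // mxE eqxx mulr1n.
Qed.

Lemma induced_metric_crdE i j (x : 'rV[R]_n) : map_dom F i j x ->
  metric_crd (induced_metric g F) i x =
  jac (map_crd F i j) x *m cyl_metric_crd g j (map_crd F i j x) *m (jac (map_crd F i j) x)^T.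
Proof.
move=> [ix jx]; rewrite /metric_crd (induced_metricE (par_dom ix) jx).
by rewrite /differential parK // /cyl_metric_crd /map_crd cyl_parK.
Qed.

Lemma differential_free i j p : chart_dom i p -> chart_dom j (F p).1 ->
  row_free (differential F i j p).
Proof. by case: F_imm => _ _; apply. Qed.

Lemma induced_posdef i p : chart_dom i p -> posdef (induced_metric g F i p).
Proof.
move=> ip; have jp := dom_chart_at (F p).1.
by apply: posdef_congr; [exact: differential_free | exact: cyl_posdef].
Qed.

Lemma cyl_metric_crd_entry j (c l : 'I_(n + 1)) :
  (exists c' l', (fun y => cyl_metric_crd g j y c l) = (fun z => g j (par j z) c' l') \o lsubmx)
  \/ exists r, (fun y => cyl_metric_crd g j y c l) = fun=> r.
Proof.
rewrite -[c]splitK -[l]splitK; case: (fintype.split c) (fintype.split l) => c' [l'|l'] /=.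
- by left; exists c', l'; apply/funext => z; rewrite /cyl_metric_crd /cyl_metric block_mxEul.
- by right; exists 0; apply/funext => z; rewrite /cyl_metric_crd /cyl_metric block_mxEur mxE.
- by right; exists 0; apply/funext => z; rewrite /cyl_metric_crd /cyl_metric block_mxEdl mxE.
- right; exists (c' == l')%:R; apply/funext => z.
  by rewrite /cyl_metric_crd /cyl_metric block_mxEdr mxE.
Qed.

Lemma cyl_crd_halfspace j (q : M * R) : chart_dom j q.1 -> halfspace (n + 1) (cyl_crd j q).
Proof. by move=> jq; apply/(halfspace_lsub n_gt0); rewrite row_mxKl; exact: crd_halfspace. Qed.

(** With the next two lemmas: the vertical row and column of the product metric are constant, and no
    entry depends on the height. All Christoffel symbols with a vertical index then vanish, that is,
    [xi] is parallel. *)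
Lemma pderiv_cyl_metric_lastl j b l y : halfspace (n + 1) y ->
  pderiv b (fun z => cyl_metric_crd g j z (rshift n ord0) l) y = 0.
Proof.
move=> Hy; move: l; apply: ordD1_ind => [l|].
  rewrite (_ : (fun z => _) = fun=> 0); last first.
    by apply/funext => z; rewrite /cyl_metric_crd /cyl_metric block_mxEdl mxE.
  exact: ispd_pderiv Hy (@ispd_cst _ _ b _ _).
rewrite (_ : (fun z => _) = fun=> 1); last first.
  by apply/funext => z; rewrite /cyl_metric_crd /cyl_metric block_mxEdr mxE.
exact: ispd_pderiv Hy (@ispd_cst _ _ b _ _).
Qed.

Lemma pderiv_cyl_metric_lastr j b c y : halfspace (n + 1) y ->
  pderiv b (fun z => cyl_metric_crd g j z c (rshift n ord0)) y = 0.
Proof.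
move=> Hy; move: c; apply: ordD1_ind => [c|]; last exact: pderiv_cyl_metric_lastl.
rewrite (_ : (fun z => _) = fun=> 0); last first.
  by apply/funext => z; rewrite /cyl_metric_crd /cyl_metric block_mxEur mxE.
exact: ispd_pderiv Hy (@ispd_cst _ _ b _ _).
Qed.

Lemma pderiv_cyl_metric_vertical j c l y : halfspace (n + 1) y ->
  pderiv (rshift n ord0) (fun z => cyl_metric_crd g j z c l) y = 0.
Proof.
move=> Hy; have [[c' [l' E]]|[r E]] := cyl_metric_crd_entry j c l; rewrite E.
  exact: ispd_pderiv Hy (@ispd_lsub_r _ _ _ _ _).
exact: ispd_pderiv Hy (@ispd_cst _ _ _ _ _).
Qed.

Section ProductWeight.
Variables (h : M -> R) (v : R -> R).
Hypotheses (h_smooth : Ck_fun 1 h) (v_derivable : forall t, derivable v t 1).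
Let psi (q : M * R) := h q.1 + v q.2.

Lemma weight_pderiv j (q : M * R) : chart_dom j q.1 ->
  (forall b, pderiv (lshift 1 b) (psi \o cyl_par j) (cyl_crd j q) =
     pderiv b (h \o par j) (crd j q.1)) /\
  pderiv (rshift n ord0) (psi \o cyl_par j) (cyl_crd j q) = derive1 v q.2.
Proof.
move=> jq.
have y0 : @chart_cod _ _ M j (lsubmx (cyl_crd j q)) by rewrite row_mxKl; exact: crd_cod.
have t0 : rsubmx (cyl_crd j q) ord0 ord0 = q.2 by rewrite row_mxKr mxE eqxx mulr1n.
have E : psi \o cyl_par j =
  fun y => ((h \o par j) \o lsubmx) y + v (rsubmx y ord0 ord0) by [].
have Hy := cyl_crd_halfspace jq.
split=> [b|].
  apply: ispd_pderiv Hy _; rewrite E -[X in ispd _ _ _ X]addr0; apply: ispdD.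
    apply: ispd_lsub_l => //; rewrite -[X in pderiv _ _ X](row_mxKl (crd j q.1) q.2%:M).
    exact: Ck1_ispd (h_smooth j) y0.
  have := @ispd_rsub _ n v (lshift 1 b) (cyl_crd j q) (@v_derivable _).
  by rewrite eq_sym eq_lrshift mulr0.
apply: ispd_pderiv Hy _; rewrite E -[X in ispd _ _ _ X]add0r; apply: ispdD.
  exact: ispd_lsub_r.
have := @ispd_rsub _ n v (rshift n ord0) (cyl_crd j q) (@v_derivable _).
by rewrite eqxx mulr1 t0.
Qed.

End ProductWeight.

Lemma xiT_l b : (xi R n)^T (lshift 1 b) ord0 = 0.
Proof. by rewrite mxE /xi row_mxEl mxE. Qed.

Lemma xiT_r : (xi R n)^T (rshift n ord0) ord0 = 1.
Proof. by rewrite mxE /xi row_mxEr mxE. Qed.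

Lemma mulmx_xiT m (A : 'M[R]_(m, n + 1)) k : (A *m (xi R n)^T) k ord0 = A k (rshift n ord0).
Proof.
rewrite mxE big_split_ord /= big_ord1 big1 ?add0r => [|b _]; last by rewrite xiT_l mulr0.
by rewrite xiT_r mulr1.
Qed.

Lemma cyl_metric_xi j (q : M * R) : cyl_metric g j q *m (xi R n)^T = (xi R n)^T.
Proof.
by rewrite /cyl_metric /xi tr_row_mx mul_block_col !trmx0 trmx1 !mulmx0 !mul0mx !addr0 add0r mulmx1.
Qed.

(** * Hessian and weighted Laplacian of the height *)

Section HeightLaplacian.
Variables (N : field_along M S) (N_gauss : gauss_map g F N).
Variables (i : chart_index S) (j : chart_index M) (p : S).
Hypotheses (ip : chart_dom i p) (jp : chart_dom j (F p).1).

Let x := crd i p.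
Let U := map_dom F i j.
Let J y := jac (map_crd F i j) y.
Let Gc y := cyl_metric_crd g j (map_crd F i j y).
Let G0 := cyl_metric g j (F p).
Let dG (b c l : 'I_(n + 1)) : R :=
  pderiv b (fun y => cyl_metric_crd g j y c l) (cyl_crd j (F p)).
Let Nc y := N j (par i y).
Let GI := induced_metric g F i p.

Let Ux : U x. Proof. exact: map_dom_crd. Qed.
Let Uo : ropen U. Proof. exact: map_dom_ropen. Qed.
Let Hx : halfspace n x. Proof. exact: crd_halfspace. Qed.

Let near_x : exists2 d, 0 < d & forall y, halfspace n y -> cube x d y -> U y.
Proof. by have [d d0 dU] := Uo.2 _ Ux; exists d => // y Hy xy; exact: dU. Qed.

Let Xx : map_crd F i j x = cyl_crd j (F p).
Proof. by rewrite /map_crd crdK. Qed.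

Let Gcx : Gc x = G0.
Proof. by rewrite /Gc /cyl_metric_crd Xx cyl_parK. Qed.

Let G0_posdef : posdef G0. Proof. exact: cyl_posdef. Qed.
Let G0_unit : G0 \in unitmx. Proof. exact: posdef_unit. Qed.
Let GI_posdef : posdef GI. Proof. exact: induced_posdef. Qed.
Let GI_unit : GI \in unitmx. Proof. exact: posdef_unit. Qed.

Let J0 := differential F i j p.
Let JxE : J x = J0. Proof. by []. Qed.

Let GIE : GI = J0 *m G0 *m J0^T.
Proof. exact: induced_metricE. Qed.

Let G0xi : G0 *m (xi R n)^T = (xi R n)^T. Proof. exact: cyl_metric_xi. Qed.

Let Hy0 : halfspace (n + 1) (cyl_crd j (F p)). Proof. exact: cyl_crd_halfspace. Qed.

Let basex : base i j x = crd j (F p).1.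
Proof. by rewrite /base crdK. Qed.

Let g_smooth c l : Ck 1 (@chart_cod _ _ M j) (fun z => g j (par j z) c l).
Proof. by case: g_riem => _ _ gs _; apply: gs. Qed.

(** The chain rule for the ambient metric along [F]. A non-constant entry is a function of the base
    point, so it is differentiated through [base] in a chart of M and the vertical term of the sum
    is zero. *)
Let ispd_Gc a c l : ispd a (fun y => Gc y c l) x (\sum_b J0 a b * dG b c l).
Proof.
have [[c' [l' E]]|[r E]] := cyl_metric_crd_entry j c l; last first.
  rewrite (_ : (fun y => _) = fun=> r).
    rewrite big1 => [|b _]; first exact: ispd_cst.
    by rewrite /dG E (ispd_pderiv Hy0 (@ispd_cst _ _ b r _)) mulr0.
  by apply/funext => y; rewrite /Gc -[LHS]/((fun y => cyl_metric_crd g j y c l) _) E.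
set f := fun z => g j (par j z) c' l' in E.
have fC : Ck 1 (@chart_cod _ _ M j) f by exact: g_smooth.
have y0 : @chart_cod _ _ M j (lsubmx (cyl_crd j (F p))) by rewrite row_mxKl; exact: crd_cod.
have -> : (fun y => Gc y c l) = f \o base i j.
  apply/funext => y; rewrite /Gc -[LHS]/((fun y => cyl_metric_crd g j y c l) _) E /=.
  by rewrite /map_crd /cyl_crd row_mxKl.
rewrite big_split_ord /= big_ord1.
have -> : dG (rshift n ord0) c l = 0.
  by rewrite /dG E (ispd_pderiv Hy0 (@ispd_lsub_r _ _ _ f _)).
rewrite mulr0 addr0.
have -> : \sum_b J0 a (lshift 1 b) * dG (lshift 1 b) c l =
    \sum_b pderiv b f (base i j x) * J0 a (lshift 1 b).
  apply: eq_bigr => b _; rewrite mulrC; congr (_ * _); rewrite /dG E basex.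
  have := @ispd_lsub_l _ _ n_gt0 b f (cyl_crd j (F p)) (pderiv b f (lsubmx (cyl_crd j (F p)))).
  by move=> /(_ (Ck1_ispd fC y0)) H; rewrite (ispd_pderiv Hy0 H) row_mxKl.
have [d d0 dU] := near_x.
apply: (ispd_comp (cod_ropen j) fC _ d0).
- by rewrite basex; exact: crd_cod.
- by move=> y Hy xy; have [_ jy] := dU y Hy xy; exact: crd_halfspace.
- move=> b; rewrite (differentialE i j p a).1.
  by apply: Ck1_ispd (base_smooth i j 1 b) Ux.
Qed.

Let dG_sym b c l : dG b c l = dG b l c.
Proof.
have [d d0 dU] := (cod_ropen j).2 _ (crd_cod jp).
apply: (pderiv_near b d0 Hy0) => y Hy xy.
have jy : @chart_cod _ _ M j (lsubmx y).
  apply: dU; split; last exact/(halfspace_lsub n_gt0).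
  by move=> k; have := xy (lshift 1 k); rewrite /cyl_crd row_mxEl [lsubmx y _ _]mxE.
have /riemannian_posdef [] := par_dom jy.
rewrite /cyl_metric_crd => gs _.
have : (cyl_metric g j (cyl_par j y))^T = cyl_metric g j (cyl_par j y).
  by rewrite /cyl_metric tr_block_mx gs !trmx0 trmx1.
by move=> E; rewrite -{1}E mxE.
Qed.

Let christoffelE k b c :
  christoffel (cyl_metric_crd g j) k b c (cyl_crd j (F p)) =
  2^-1 * \sum_l invmx G0 k l * (dG b c l + dG c b l - dG l b c).
Proof. by rewrite /christoffel -Xx -/(Gc x) Gcx Xx. Qed.

Let Gam := Gamma G0 dG.

(** This is parallelism of [xi]: the symbols of the first kind with vertical last index are zero. *)
Let Gam_xi v w : inner G0 (Gam v w) (xi R n) = 0.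
Proof.
rewrite /Gam (inner_Gamma dG G0_unit G0_posdef.1) big1 // => b _; rewrite big1 // => c _.
rewrite big_split_ord /= big_ord1 big1 ?add0r => [|l _]; last first.
  by rewrite /xi row_mxEl mxE mulr0.
by rewrite /lowered /dG !pderiv_cyl_metric_lastr // pderiv_cyl_metric_vertical // addr0 subr0 mulr0 !mul0r.
Qed.

(* Metric compatibility of the covariant derivative along [F]. *)
Let ispd_inner a (V W : 'rV[R]_n -> 'rV[R]_(n + 1)) (V' W' : 'rV[R]_(n + 1)) :
  (forall k, ispd a (fun y => V y ord0 k) x (V' ord0 k)) ->
  (forall k, ispd a (fun y => W y ord0 k) x (W' ord0 k)) ->
  ispd a (fun y => inner (Gc y) (V y) (W y)) x
    (inner G0 (V' + Gam (row a J0) (V x)) (W x) + inner G0 (V x) (W' + Gam (row a J0) (W x))).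
Proof.
move=> dV dW.
rewrite (_ : (fun y => inner _ _ _) =
    fun y => \sum_c \sum_l V y ord0 c * Gc y c l * W y ord0 l); last first.
  by apply/funext => y; rewrite innerE.
have D c l : ispd a (fun y => V y ord0 c * Gc y c l * W y ord0 l) x
    ((V' ord0 c * Gc x c l + V x ord0 c * (\sum_b J0 a b * dG b c l)) * W x ord0 l
     + V x ord0 c * Gc x c l * W' ord0 l).
  by apply: ispdM (dW l); apply: ispdM (dV c) (@ispd_Gc a c l).
have := ispd_sum (fun c => ispd_sum (D c)); congr (ispd _ _ _ _).
(* The factors 1 bring the sums into the shape expected by [inner_add_scalel] and
   [inner_add_scaler]. *)
rewrite -[V' + _]scale1r -[V']scale1r -[W' + _]scale1r -[W']scale1r.
set A := 1 *: V'; set B := 1 *: W'.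
have -> : inner G0 (1 *: (A + Gam (row a J0) (V x))) (W x) =
    inner G0 V' (W x) + inner G0 (Gam (row a J0) (V x)) (W x).
  by rewrite scale1r /A inner_add_scalel mul1r.
have -> : inner G0 (V x) (1 *: (B + Gam (row a J0) (W x))) =
    inner G0 (V x) W' + inner G0 (V x) (Gam (row a J0) (W x)).
  by rewrite scale1r /B inner_add_scaler mul1r.
rewrite addrACA (Gamma_compat G0_unit G0_posdef.1 dG_sym) !innerE -!big_split /=.
apply: eq_bigr => c _; rewrite -!big_split /=; apply: eq_bigr => l _.
rewrite Gcx; have -> : \sum_b row a J0 ord0 b * dG b c l = \sum_b J0 a b * dG b c l.
  by apply: eq_bigr => b _; rewrite mxE.
by rewrite /A /B !scale1r; ring.
Qed.

Let K a b : 'rV[R]_(n + 1) := \row_k pderiv a (fun y => J y b k) x.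

Let X_smooth k : Cinf U (fun y => map_crd F i j y ord0 k).
Proof. by case: F_imm => _ Fs _; exact: Fs. Qed.

Let ispd_J a b k : ispd a (fun y => (row b (J y)) ord0 k) x (K a b ord0 k).
Proof.
have -> : (fun y => (row b (J y)) ord0 k) = pderiv b (fun y => map_crd F i j y ord0 k).
  by apply/funext => y; rewrite !mxE.
have [_ /(_ b) [_ [_ /(_ a) [H _]]]] := X_smooth k 2.
rewrite mxE; have -> : (fun y => J y b k) = pderiv b (fun y => map_crd F i j y ord0 k).
  by apply/funext => y; rewrite !mxE.
by apply: pderivableP; exact: H.
Qed.

Let KC a b : K a b = K b a.
Proof.
apply/rowP => k; rewrite !mxE.
have E c : (fun y => J y c k) = pderiv c (fun y => map_crd F i j y ord0 k).
  by apply/funext => y; rewrite !mxE.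
by rewrite !E; exact: (pderivC a b Uo (X_smooth k 2) Ux).
Qed.

(** [DJ a b] and [DN a] are the ambient covariant derivatives, along the [a]-th coordinate field of
    Sigma, of the [b]-th coordinate field and of [N]. *)
Let DJ a b := K a b + Gam (row a J0) (row b J0).
Let DN a := \row_k pderiv a (fun y => Nc y ord0 k) x + Gam (row a J0) (N j p).

Let DJC a b : DJ a b = DJ b a.
Proof. by rewrite /DJ KC /Gam (GammaC G0 dG_sym). Qed.

Let P a b d := inner G0 (DJ a b) (row d J0).

Let induced_entry y a b : (J y *m Gc y *m (J y)^T) a b = inner (Gc y) (row a (J y)) (row b (J y)).
Proof.
rewrite /inner -row_mul [LHS]mxE [RHS]mxE; apply: eq_bigr => k _.
by congr (_ * _); [rewrite [RHS]mxE | rewrite !mxE].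
Qed.

Let dGI a b d : pderiv a (fun y => metric_crd (induced_metric g F) i y b d) x =
  P a b d + P a d b.
Proof.
have [e e0 eU] := near_x.
have E : forall y, halfspace n y -> cube x e y ->
    metric_crd (induced_metric g F) i y b d = inner (Gc y) (row b (J y)) (row d (J y)).
  by move=> y Hy xy; rewrite (induced_metric_crdE (eU y Hy xy)) -induced_entry.
rewrite (pderiv_near a e0 Hx E).
have H := ispd_inner (@ispd_J a b) (@ispd_J a d).
by rewrite (ispd_pderiv Hx H) /P JxE (innerC (row b J0)) // G0_posdef.1.
Qed.

(** By the Koszul formula the connection of the induced metric is the tangential part of the ambient
    one. *)
Let christoffelIE k a b :
  christoffel (metric_crd (induced_metric g F) i) k a b x =
  \sum_d invmx GI k d * P a b d.
Proof.
rewrite /christoffel /metric_crd crdK // -/GI mulr_sumr; apply: eq_bigr => d _.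
rewrite (koszul (P := P) (dH := fun a b d =>
  pderiv a (fun y => metric_crd (induced_metric g F) i y b d) x)).
- by rewrite mulrCA mulKf.
- by move=> a' b' d'; rewrite /P DJC.
- by move=> a' b' d'; exact: dGI.
Qed.

Let N_normal : J0 *m G0 *m (N j p)^T = 0.
Proof. by case: N_gauss => _ _ _; apply. Qed.

Let N_unit : inner G0 (N j p) (N j p) = 1.
Proof. by case: N_gauss => _ _ + _; apply. Qed.

Let NxE : Nc x = N j p. Proof. by rewrite /Nc crdK. Qed.

(** The Weingarten relation, obtained by differentiating the orthogonality of [N] to the coordinate
    fields. *)
Let inner_DJN a b : inner G0 (DJ a b) (N j p) = - inner G0 (row b J0) (DN a).
Proof.
have [e e0 eU] := near_x.
have dN k : ispd a (fun y => Nc y ord0 k) x ((\row_k pderiv a (fun y => Nc y ord0 k) x) ord0 k).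
  rewrite mxE; case: N_gauss => _ Ns _ _.
  by apply: Ck1_ispd (Ns i j k 1) Ux.
have H := ispd_inner (@ispd_J a b) dN.
have Z : forall y, halfspace n y -> cube x e y ->
    inner (Gc y) (row b (J y)) (Nc y) = (fun=> 0 : R) y.
  move=> y Hy xy; have [iy jy] := eU y Hy xy.
  case: N_gauss => _ _ _ /(_ i j (par i y) (par_dom iy) jy).
  rewrite /differential parK // => /matrixP/(_ b ord0).
  rewrite [RHS]mxE /inner -row_mul -row_mul [row _ _ _ _]mxE => <-.
  by rewrite /Gc /cyl_metric_crd /map_crd cyl_parK.
have := ispd_pderiv Hx H; rewrite (pderiv_near a e0 Hx Z).
rewrite (ispd_pderiv Hx (@ispd_cst _ _ a 0 x)) NxE JxE => /eqP.
by rewrite eq_sym addr_eq0 => /eqP.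
Qed.

Let theta := inner G0 (xi R n) (N j p).
Let w := xi R n *m G0 *m J0^T *m invmx GI.

Let xi_split : xi R n = w *m J0 + theta *: N j p.
Proof.
rewrite /w GIE; apply: normal_decomposition => //.
exact: differential_free.
Qed.

Let height_pd a : pderiv a (height i) x = (xi R n *m G0 *m J0^T) ord0 a.
Proof.
rewrite -[xi R n *m G0]trmxK trmx_mul G0_posdef.1 G0xi trmxK.
rewrite -(differentialE i j p a).2 [RHS]mxE big_split_ord /= big_ord1 big1 ?add0r => [|k _].
  have -> : xi R n ord0 (rshift n ord0) = 1 by rewrite /xi row_mxEr mxE.
  by rewrite mul1r [RHS]mxE.
have -> : xi R n ord0 (lshift 1 k) = 0 by rewrite /xi row_mxEl mxE.
by rewrite mul0r.
Qed.

Lemma height_gradE : grad (metric_crd (induced_metric g F) i) (height i) x = w.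
Proof.
rewrite /grad /metric_crd crdK // -/GI /w; congr (_ *m _).
by apply/rowP => k; rewrite mxE height_pd.
Qed.

(** The differential of the height pairs [xi] with the coordinate fields. As [xi] is parallel, the
    second derivative is the pairing of [DJ a b] with [xi]. In the splitting of [xi], the tangential
    part cancels the Christoffel term of the Hessian and the normal part is given by the Weingarten
    relation. *)
Let height_hess a b : hess (metric_crd (induced_metric g F) i) (height i) x a b =
  - theta * inner G0 (row b J0) (DN a).
Proof.
have H2 : pderiv a (pderiv b (height i)) x = inner G0 (DJ a b) (xi R n).
  rewrite /DJ -[K a b]scale1r inner_add_scalel mul1r Gam_xi addr0.
  rewrite /inner -mulmxA G0xi mulmx_xiT mxE; congr (pderiv _ _ _).
  apply/funext => y; rewrite mxE; congr (pderiv _ _ _); apply/funext => z.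
  by rewrite /map_crd /cyl_crd row_mxEr mxE eqxx mulr1n.
rewrite mxE H2 [in inner G0 (DJ a b) _]xi_split addrC.
rewrite [w *m J0 + _]addrC inner_add_scaler inner_DJN.
have -> : inner G0 (DJ a b) (w *m J0) = \sum_d w ord0 d * P a b d.
  rewrite /inner trmx_mul mulmxA mxE; apply: eq_bigr => d _.
  rewrite mulrC [w^T _ _]mxE; congr (_ * _); rewrite /P /inner tr_row.
  by rewrite -[col _ _]/(col _ _) colE mulmxA -colE [RHS]mxE.
have -> : \sum_k christoffel (metric_crd (induced_metric g F) i) k a b x * pderiv k (height i) x
    = \sum_d w ord0 d * P a b d.
  under eq_bigr => k _ do rewrite christoffelIE mulr_suml.
  rewrite exchange_big /=; apply: eq_bigr => d _.
  rewrite /w mxE mulr_suml; apply: eq_bigr => k _; rewrite height_pd; ring.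
by ring.
Qed.

Lemma height_lap : lap (metric_crd (induced_metric g F) i) (height i) x =
  - theta * \tr (invmx GI *m (covariant_deriv g F N i j p *m G0 *m J0^T)).
Proof.
rewrite /lap /metric_crd crdK // -/GI -mxtraceZ scalemxAr; congr (\tr (_ *m _)).
apply/matrixP => a b; rewrite height_hess mxE; congr (_ * _).
have -> : DN a = row a (covariant_deriv g F N i j p).
  apply/rowP => k; rewrite !mxE; congr (_ + _).
  apply: eq_bigr => b' _; apply: eq_bigr => c' _; rewrite christoffelE.
  by rewrite mxE.
rewrite innerC ?G0_posdef.1 // /inner tr_row -!row_mul mxE colE mulmxA -colE.
by rewrite [LHS]mxE.
Qed.

Lemma angle_decomposition :
  1 = inner GI w w + theta ^+ 2 /\ xi R n = w *m J0 + theta *: N j p.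
Proof.
split; last exact: xi_split.
have xx : inner G0 (xi R n) (xi R n) = 1.
  by rewrite /inner -mulmxA G0xi mulmx_xiT /xi row_mxEr mxE.
have uJN u : inner G0 (u *m J0) (N j p) = 0.
  by rewrite /inner -(mulmxA u) -(mulmxA u) N_normal mulmx0 mxE.
have wJN := uJN w.
rewrite -[LHS]xx xi_split addrC inner_add_scalel addrC [w *m J0 + _]addrC !inner_add_scaler.
rewrite wJN N_unit [inner G0 (N j p) _]innerC ?G0_posdef.1 // wJN GIE inner_mulmx.
by ring.
Qed.

Section Weight.
Variables (h : M -> R) (v : R -> R).
Hypotheses (h_smooth : Ck_fun 1 h) (v_derivable : forall t, derivable v t 1).
Let psi (q : M * R) := h q.1 + v q.2.

Let dpsi : 'rV[R]_(n + 1) := \row_k pderiv k (psi \o cyl_par j) (cyl_crd j (F p)).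

Let pderiv_psiF a : pderiv a ((psi \o F) \o par i) x = (dpsi *m J0^T) ord0 a.
Proof.
have [e e0 eU] := near_x.
have E : forall y, halfspace n y -> cube x e y ->
    ((psi \o F) \o par i) y = ((h \o par j) \o base i j) y + (v \o height i) y.
  by move=> y Hy xy; have [iy jy] := eU y Hy xy; rewrite /= /psi /base crdK.
rewrite (pderiv_near a e0 Hx E).
have [el er] := weight_pderiv h_smooth v_derivable jp.
have D1 : ispd a ((h \o par j) \o base i j) x
    (\sum_b pderiv b (h \o par j) (base i j x) * J0 a (lshift 1 b)).
  apply: (ispd_comp (cod_ropen j) (h_smooth j) _ e0).
  - by rewrite basex; exact: crd_cod.
  - by move=> y Hy xy; have [_ jy] := eU y Hy xy; exact: crd_halfspace.
  - move=> b; rewrite (differentialE i j p a).1.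
    by apply: Ck1_ispd (base_smooth i j 1 b) Ux.
have D2 : ispd a (v \o height i) x (derive1 v (height i x) * J0 a (rshift n ord0)).
  apply: ispd_comp1 => //; rewrite (differentialE i j p a).2.
  exact: Ck1_ispd (height_Ck i 1) (crd_cod ip).
rewrite (ispd_pderiv Hx (ispdD D1 D2)) [RHS]mxE big_split_ord /= big_ord1; congr (_ + _).
  by apply: eq_bigr => b _; rewrite [dpsi _ _]mxE el basex [J0^T _ _]mxE.
by rewrite [dpsi _ _]mxE er [J0^T _ _]mxE /height crdK.
Qed.

(** The drift is the differential of [psi] on [w = xi - theta N]. On [xi] it gives the derivative of
    [v], as the weight is a product; the term [- theta dpsi(N)] completes the divergence to the
    weighted mean curvature. *)
Lemma height_drift :
  lap (metric_crd (induced_metric g F) i) (height i) x +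
  inner GI (grad (metric_crd (induced_metric g F) i) ((psi \o F) \o par i) x)
    (grad (metric_crd (induced_metric g F) i) (height i) x) =
  theta * (- \tr (invmx GI *m (covariant_deriv g F N i j p *m G0 *m J0^T))
    - inner G0 (grad (cyl_metric_crd g j) (psi \o cyl_par j) (cyl_crd j (F p))) (N j p))
  + derive1 v (F p).2.
Proof.
have E1 : grad (metric_crd (induced_metric g F) i) ((psi \o F) \o par i) x =
    dpsi *m J0^T *m invmx GI.
  rewrite /grad /metric_crd crdK // -/GI; congr (_ *m _).
  by apply/rowP => k; rewrite mxE pderiv_psiF.
have E2 : grad (cyl_metric_crd g j) (psi \o cyl_par j) (cyl_crd j (F p)) =
    dpsi *m invmx G0 by rewrite /grad -Xx -/(Gc x) Gcx Xx.
rewrite height_lap height_gradE E1 E2 /inner !mulmxKV //.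
have -> : dpsi *m J0^T *m w^T = dpsi *m (xi R n)^T - theta *: (dpsi *m (N j p)^T).
  rewrite [in RHS]xi_split linearD linearZ /= mulmxDr -scalemxAr addrK.
  rewrite [(w *m J0)^T]trmx_mul.
  by rewrite mulmxA.
have -> : dpsi *m (xi R n)^T = (derive1 v (F p).2)%:M.
  apply/matrixP => r s; rewrite (ord1 r) (ord1 s) mulmx_xiT [RHS]mxE eqxx mulr1n mxE.
  exact: (weight_pderiv h_smooth v_derivable jp).2.
have entry (r c : R) (A : 'M[R]_1) : (r%:M - c *: A) ord0 ord0 = r - c * A ord0 ord0.
  by rewrite !mxE eqxx mulr1n.
by rewrite entry; ring.
Qed.

End Weight.

End HeightLaplacian.

Lemma pderiv_cst m (a : 'I_m) (c : R) (x : 'rV[R]_m) :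
  halfspace m x -> pderiv a (fun=> c) x = 0.
Proof. by move=> Hx; exact: ispd_pderiv Hx (@ispd_cst _ _ a c x). Qed.

(** * The height as test function: sign of its Laplacian and boundary derivative *)

Section TestFunction.
Variables (N : field_along M S) (N_gauss : gauss_map g F N).
Variables (h : M -> R) (v : R -> R).
Hypotheses (h_smooth : Ck_fun 1 h) (v_derivable : forall t, derivable v t 1).
Let psi (q : M * R) := h q.1 + v q.2.
Let GI := induced_metric g F.
Let u p := (F p).2.

Lemma wlaplacian_height p : wlaplacian GI (psi \o F) u p =
  angle g F N p * weighted_mean_curvature g F N psi p + derive1 v (F p).2.
Proof.
exact: (height_drift N_gauss (dom_chart_at p) (dom_chart_at (F p).1) h_smooth v_derivable).
Qed.

Lemma angle_sqr p :
  let i := chart_at p in let w := grad (metric_crd GI i) (height i) (crd i p) in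
  1 = inner (GI i p) w w + angle g F N p ^+ 2.
Proof.
move=> i w; have [+ _] := angle_decomposition N_gauss (dom_chart_at p) (dom_chart_at (F p).1).
by rewrite /w (height_gradE (dom_chart_at p) (dom_chart_at (F p).1)).
Qed.

Lemma angle_sqr_le1 p : angle g F N p ^+ 2 <= 1.
Proof. by rewrite (angle_sqr p) lerDr; apply: posdef_ge0; exact: induced_posdef (dom_chart_at p). Qed.

(** For a multigraph [- 1 <= theta <= 0], so [theta H >= theta lambda >= - lambda]; the last
    inequality rests on [lambda >= 0]. *)
Lemma wlaplacian_height_ge0 (lambda a : R) : 0 <= lambda ->
  (forall t, t <= a -> lambda <= derive1 v t) -> (forall p, (F p).2 <= a) ->
  let H := weighted_mean_curvature g F N psi in
  (forall p, `|H p| <= lambda) \/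
     ((forall p, angle g F N p <= 0) /\ (forall p, H p <= lambda)) ->
  forall p, 0 <= wlaplacian GI (psi \o F) u p.
Proof.
move=> l0 vl Fa H HH p; rewrite wlaplacian_height.
have vp := vl _ (Fa p).
have t1 : `|angle g F N p| <= 1.
  by rewrite -[leRHS]normr1 -ler_sqr ?nnegrE // -!normrX !ger0_norm ?expr1n ?sqr_ge0 ?angle_sqr_le1.
rewrite -/(H p); set th := angle g F N p in t1 *.
have : - lambda <= th * H p; last by lra.
case: HH => [Hb|[tn Hb]].
  have : `|th * H p| <= lambda.
    rewrite normrM; apply: le_trans (_ : 1 * lambda <= _); last by rewrite mul1r.
    by apply: ler_pM => //; exact: Hb.
  by rewrite ler_norml => /andP[].
have th0 : th <= 0 := tn p.
have : th * lambda <= th * H p by apply: ler_wnM2l => //; exact: Hb.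
apply: le_trans; move: t1; rewrite ler_norml => /andP[t1 _].
by rewrite -mulN1r; apply: ler_wpM2r.
Qed.

Lemma height_cst_weight (lambda a c : R) p :
  (forall t, t <= a -> lambda <= derive1 v t) -> (forall p, (F p).2 <= a) ->
  let H := weighted_mean_curvature g F N psi in
  (forall p, `|H p| <= lambda) \/
     ((forall p, angle g F N p <= 0) /\ (forall p, H p <= lambda)) ->
  (forall q, (F q).2 = c) -> derive1 v c = lambda.
Proof.
move=> vl Fa H HH Fc; apply/eqP; rewrite eq_le; apply/andP; split; last first.
  by apply: vl; rewrite -(Fc p); exact: Fa.
pose i := chart_at p; have Hx : halfspace n (crd i p) := crd_halfspace (dom_chart_at p).
have hc : height i = fun=> c by apply/funext => x; rewrite /height Fc.
have g0 : grad (metric_crd GI i) (height i) (crd i p) = 0.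
  rewrite hc /grad (_ : \row_k _ = 0) ?mul0mx //.
  by apply/rowP => k; rewrite mxE pderiv_cst // mxE.
have t1 : angle g F N p ^+ 2 = 1 by rewrite [RHS](angle_sqr p) g0 inner0l add0r.
have L0 : wlaplacian GI (psi \o F) u p = 0.
  rewrite /wlaplacian -/i -[u \o par i]/(height i) g0.
  rewrite innerC ?inner0l ?addr0; last by have [] := induced_posdef (dom_chart_at p).
  rewrite /lap (_ : hess _ _ _ = 0) ?mulmx0 ?mxtrace0 //.
  apply/matrixP => a' b'; rewrite !mxE big1 ?subr0 => [|k _]; last first.
    by rewrite hc pderiv_cst // mulr0.
  rewrite -(pderiv_cst a' 0 Hx); apply: (pderiv_near a' ltr01 Hx) => y Hy _.
  by rewrite hc pderiv_cst.
have := wlaplacian_height p; rewrite L0 Fc -/H => E.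
move: t1 E; set th := angle g F N p => t1 E.
have -> : derive1 v c = - (th * H p) by apply/eqP; rewrite -addr_eq0 addrC -E.
have th1 : `|th| = 1.
  by apply/eqP; rewrite -sqrp_eq1 // -normrX t1 normr1.
case: HH => [Hb|[tn Hb]].
  apply: le_trans (ler_norm _) _; rewrite normrN normrM th1 mul1r; exact: Hb.
(* The sign condition selects [theta = -1], so the derivative of [v] at [c] equals [H] itself and
   the one-sided bound suffices. *)
have : th = -1 by rewrite -th1 (ler0_norm (tn p)) opprK.
by move=> ->; rewrite mulN1r opprK; exact: Hb.
Qed.

(** The conormal is a multiple of the gradient of [x_0]; its pairing with a vector is a multiple of
    the component of index 0. *)
Lemma conormal_deriv_height p :
  (forall k, val k = 0%N ->
    grad (metric_crd GI (chart_at p)) (height (chart_at p)) (crd (chart_at p) p) ord0 k = 0) ->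
  conormal_deriv GI u p = 0.
Proof.
move=> w0; rewrite /conormal_deriv -[u \o par _]/(height (chart_at p)).
rewrite /conormal inner_sumr big1 // => k /eqP k0.
by rewrite innerZr (inner_row_inv _ _ (induced_posdef (dom_chart_at p))) w0 // mulr0.
Qed.

Lemma conormal_deriv_tangent a p : tangent_to_slice F a -> boundary p ->
  conormal_deriv GI u p = 0.
Proof.
move=> tg bp; have [_ /andP[/submxP [C EC] _]] := tg p bp.
apply: conormal_deriv_height => k _; rewrite /grad (_ : \row_b _ = 0) ?mul0mx ?mxE //.
apply/rowP => b; rewrite mxE -(differentialE (chart_at p) (chart_at (F p).1) p b).2 EC.
rewrite [RHS]mxE mxE big1 // => r _; rewrite row_mxEr mxE mulr0 //.
Qed.

End TestFunction.

(** Moving along [b], a direction other than that of [x_0], keeps a boundary point in the boundary.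
    Its image stays in the boundary of M, where the coordinate of index 0 is constantly 0. *)
Lemma base_jac_boundary i j p b (k : 'I_n) : chart_dom i p -> chart_dom j (F p).1 ->
  (forall q, boundary q -> boundary (F q).1) -> boundary p ->
  val k = 0%N -> b != k -> base_jac i j p b k = 0.
Proof.
move=> ip jp Fb bp k0 bk; rewrite base_jacE mxE; set x := crd i p.
have Hx : halfspace n x := crd_halfspace ip.
apply: ispd_pderiv Hx _; rewrite /ispd.
have F1 := incr_filter_filter b x.
have [d d0 dU] := (map_dom_ropen i j).2 _ (map_dom_crd ip jp).
have base0 y : map_dom F i j y -> y ord0 k = 0 -> base i j y ord0 k = 0.
  move=> [iy jy] yk; apply: boundary_crd0 => //; apply: Fb; exists i; first exact: par_dom.
  by move=> k' k'0; rewrite parK // (_ : k' = k) //; apply: val_inj; rewrite k'0 k0.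
have xk : x ord0 k = 0 by exact: boundary_crd0.
apply: (@dquot_near _ _ _ (fun=> 0)); last exact: dquot_cst.
  by rewrite /= pline0 base0 //; exact: map_dom_crd.
near=> s; rewrite /= base0 //; last by rewrite plineE xk eq_sym (negbTE bk) mulr0 addr0.
apply: dU; split; first by near: s; exact: incr_filter_cube.
by near: s; exact: incr_filter_halfspace.
Unshelve. all: by end_near. Qed.

(** Let [eta] be the lifted conormal of M; pairing with it reads off the component of index 0, up to
    the factor [c]. Both [xi] and [N] are orthogonal to [eta], hence so is the tangential part
    [w *m J0]. By [base_jac_boundary] only one term of the pairing survives, [c] times [w_0] times
    the entry [J_00]. This entry is nonzero: otherwise [eta] would be orthogonal to all coordinate
    fields and to [N], and would vanish. *)
Lemma conormal_deriv_free (N : field_along M S) p : gauss_map g F N ->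
  free_boundary g F N -> boundary p ->
  conormal_deriv (induced_metric g F) (fun p => (F p).2) p = 0.
Proof.
move=> N_gauss [Fb Fo] bp; apply: conormal_deriv_height => k k0.
have ip := dom_chart_at p; have jp := dom_chart_at (F p).1.
set i := chart_at p in ip *; set j := chart_at (F p).1 in jp.
rewrite (height_gradE ip jp).
have [_ ] := angle_decomposition N_gauss ip jp.
set w := _ *m invmx _; set J0 := differential F i j p => E.
have Gp := cyl_posdef jp; have gp : posdef (g j (F p).1) := riemannian_posdef jp.
set gi := invmx (g j (F p).1).
pose c := (Num.sqrt (gi k k))^-1.
have gk : 0 < gi k k by apply: posdef_diag; exact: posdef_inv.
have c0 : c != 0 by rewrite invr_eq0 gt_eqF // sqrtr_gt0.
have Ec : conormal g (F p).1 = c *: row k gi.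
  rewrite /conormal (bigD1 k) ?k0 //= -/j -/gi big1 ?addr0 // => l /andP[/eqP l0].
  by rewrite (_ : l = k) ?eqxx //; apply: val_inj; exact: etrans l0 (esym k0).
set eta := row_mx (conormal g (F p).1) (0 : 'rV[R]_1).
have inner_eta (V : 'rV[R]_(n + 1)) : inner (cyl_metric g j (F p)) V eta = c * V ord0 (lshift 1 k).
  rewrite -[V]hsubmxK /inner /eta tr_row_mx mul_row_block mul_row_col !mulmx0 !addr0 trmx0 mulmx0 addr0.
  rewrite -[LHS]/(inner (g j (F p).1) (lsubmx V) (conormal g (F p).1)).
  by rewrite Ec innerZr (inner_row_inv _ _ gp) row_mxEl.
have eta_neq0 : eta != 0.
  apply/eqP => e0; have : inner (cyl_metric g j (F p)) eta eta = 0 by rewrite e0 inner0l.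
  rewrite inner_eta /eta row_mxEl Ec !mxE => /eqP.
  by rewrite !mulf_eq0 (negbTE c0) /= gt_eqF.
have jac0 b : b != k -> J0 b (lshift 1 k) = 0.
  move=> bk; have := base_jac_boundary ip jp (fun q => (Fb q).1) bp k0 bk.
  by rewrite mxE.
have jackk : J0 k (lshift 1 k) != 0.
  apply: contraNneq eta_neq0 => Jkk.
  have J00 b : J0 b (lshift 1 k) = 0 by have [->//|/jac0] := eqVneq b k.
  have Nn : J0 *m cyl_metric g j (F p) *m (N j p)^T = 0.
    by case: N_gauss => _ _ _; apply.
  have N1 : inner (cyl_metric g j (F p)) (N j p) (N j p) = 1.
    by case: N_gauss => _ _ + _; apply.
  rewrite (normal_decomposition eta Gp (differential_free ip jp) Nn N1).
  rewrite [inner _ eta _]innerC ?Gp.1 // (Fo p bp) scale0r addr0.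
  rewrite (_ : eta *m cyl_metric g j (F p) *m J0^T = 0) ?mul0mx //.
  have Z : J0 *m cyl_metric g j (F p) *m eta^T = 0.
    apply/matrixP => b s; rewrite (ord1 s) [RHS]mxE -[RHS](mulr0 c) -(J00 b).
    by have := inner_eta (row b J0); rewrite /inner -!row_mul [row _ _ _ _]mxE [row b J0 _ _]mxE.
  by have := congr1 trmx Z; rewrite !trmx_mul trmxK Gp.1 trmx0 mulmxA.
have := inner_eta (xi R n); rewrite {1}E /xi row_mxEl mxE mulr0 addrC inner_add_scalel.
rewrite (Fo p bp) mulr0 add0r inner_eta mxE (bigD1 k) //= big1 ?addr0; last first.
  by move=> b bk; rewrite jac0 // mulr0.
by move/eqP; rewrite !mulf_eq0 (negbTE c0) (negbTE jackk) orbF => /eqP.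
Qed.

End MapsToCylinder.

(** The normal [- xi] is parallel, so its divergence is zero and only the derivative of the weight
    along [xi] remains. *)
Lemma slice_curvature (R : realType) (n : nat) (n_gt0 : (0 < n)%N) (M : manifold R n)
    (g : metric_on M) (g_riem : riemannian g) (h : M -> R) (v : R -> R) (s : R) (q : M) :
  Ck_fun 1 h -> (forall t, derivable v t 1) ->
  slice_mean_curvature g (fun q => h q.1 + v q.2) s q = derive1 v s.
Proof.
move=> h_smooth vd; rewrite /slice_mean_curvature /weighted_mean_curvature /slice_map /=.
set j := chart_at q; have jq : chart_dom j (q, s).1 := dom_chart_at q.
have Hy := cyl_crd_halfspace n_gt0 jq.
have -> : div_along g (slice_map s) (fun _ _ => - xi R n) q = 0.
  rewrite /div_along (_ : covariant_deriv _ _ _ _ _ _ = 0) ?mul0mx ?mulmx0 ?mxtrace0 //.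
  apply/matrixP => a k; rewrite mxE [RHS]mxE.
  rewrite pderiv_cst ?add0r; last exact: crd_halfspace (dom_chart_at q).
  rewrite big1 // => b _; rewrite big_split_ord /= big_ord1 big1 ?add0r => [|c _].
    rewrite /christoffel big1 ?mulr0 ?mul0r // => l _.
    rewrite pderiv_cyl_metric_lastl // pderiv_cyl_metric_vertical // pderiv_cyl_metric_lastr //.
    by rewrite addr0 subr0 mulr0.
  have -> : (- xi R n) ord0 (lshift 1 c) = 0 by rewrite mxE /xi row_mxEl mxE oppr0.
  by rewrite mulr0.
have Gu : cyl_metric g j (q, s) \in unitmx by apply: posdef_unit; exact: cyl_posdef.
rewrite /inner /grad oppr0 add0r /cyl_metric_crd cyl_parK // mulmxKV // linearN mulmxN mxE opprK.
rewrite /= mulmx_xiT mxE; exact: (weight_pderiv n_gt0 h_smooth vd jq).2.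
Qed.

(** * Surjectivity of complete local isometries *)

Section Norm1.
Variables (R : realType) (n : nat).
Implicit Types (u v x : 'rV[R]_n).

(** The norm in which [sdiff] measures increments. *)
Definition norm1 v : R := \sum_k `|v ord0 k|.

Lemma norm1_ge0 v : 0 <= norm1 v.
Proof. by apply: sumr_ge0. Qed.

Lemma norm1D u v : norm1 (u + v) <= norm1 u + norm1 v.
Proof. by rewrite -big_split /=; apply: ler_sum => k _; rewrite mxE ler_normD. Qed.

Lemma norm1N v : norm1 (- v) = norm1 v.
Proof. by apply: eq_bigr => k _; rewrite mxE normrN. Qed.

Lemma norm1B u v : norm1 (u - v) = norm1 (v - u).
Proof. by rewrite -norm1N opprB. Qed.

Lemma norm1Z (c : R) v : norm1 (c *: v) = `|c| * norm1 v.
Proof. by rewrite mulr_sumr; apply: eq_bigr => k _; rewrite mxE normrM. Qed.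

Lemma norm1_coord v k : `|v ord0 k| <= norm1 v.
Proof. by rewrite /norm1 (bigD1 k) //= lerDl sumr_ge0. Qed.

Lemma norm1_eq0 v : norm1 v <= 0 -> v = 0.
Proof.
move=> v0; apply/rowP => k; rewrite mxE; apply/eqP; rewrite -normr_le0.
exact: le_trans (norm1_coord v k) v0.
Qed.

Lemma norm1_le (c : R) v : (forall k, `|v ord0 k| <= c) -> norm1 v <= n%:R * c.
Proof.
move=> vc; apply: le_trans (_ : \sum_(k < n) c <= _); first by apply: ler_sum => k _.
by rewrite sumr_const card_ord mulr_natl.
Qed.

Lemma norm1_mulmx m (v : 'rV[R]_m) (B : 'M[R]_(m, n)) (e : R) :
  (forall a b, `|B a b| <= e) -> norm1 (v *m B) <= n%:R * e * \sum_k `|v ord0 k|.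
Proof.
move=> Be; rewrite -mulrA; apply: norm1_le => b; rewrite mxE.
apply: le_trans (ler_norm_sum _ _ _) _; rewrite mulr_sumr; apply: ler_sum => a _.
by rewrite normrM mulrC; apply: ler_wpM2r.
Qed.

Lemma norm1_sqr v : (\sum_k v ord0 k ^+ 2 <= norm1 v ^+ 2) /\
  (norm1 v ^+ 2 <= n%:R * \sum_k v ord0 k ^+ 2).
Proof.
split.
  rewrite expr2 [leRHS]mulr_suml; apply: ler_sum => k _.
  rewrite -real_normK ?num_real // expr2; apply: ler_wpM2l => //; exact: norm1_coord.
have -> : norm1 v ^+ 2 = \sum_k \sum_l `|v ord0 k| * `|v ord0 l|.
  by rewrite expr2 mulr_suml; apply: eq_bigr => k _; rewrite mulr_sumr.
apply: le_trans (_ : \sum_k \sum_l 2^-1 * (v ord0 k ^+ 2 + v ord0 l ^+ 2) <= _).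
  apply: ler_sum => k _; apply: ler_sum => l _.
  rewrite -(real_normK (num_real (v ord0 k))) -(real_normK (num_real (v ord0 l))).
  by move: (`|v ord0 k|) (`|v ord0 l|) => a b; have := sqr_ge0 (a - b); rewrite sqrrB; lra.
have -> : \sum_k \sum_l 2^-1 * (v ord0 k ^+ 2 + v ord0 l ^+ 2) =
    \sum_(k < n) 2^-1 * (n%:R * v ord0 k ^+ 2 + \sum_l v ord0 l ^+ 2).
  apply: eq_bigr => k _; rewrite -mulr_sumr big_split /= sumr_const card_ord.
  by rewrite mulr_natl.
rewrite -mulr_sumr big_split /= -mulr_sumr sumr_const card_ord -mulr_natl.
by move: (\sum_i _) => s; lra.
Qed.

Lemma finite_cube (I : finType) x (U : set 'rV[R]_n) (P : I -> 'rV[R]_n -> Prop) :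
  (forall k, exists2 d, 0 < d & forall y, U y -> cube x d y -> P k y) ->
  exists2 d, 0 < d & forall y, U y -> cube x d y -> forall k, P k y.
Proof.
move=> H; have : \forall y \near within U (nbhs x), forall k, P k y.
  apply: filter_forall => k; have [d d0 dP] := H k.
  by apply: filterS (cube_nbhs x d0) => y xy Uy; exact: dP.
by move=> /nbhs_cubeP [d d0 dP]; exists d => // y Uy xy; exact: dP.
Qed.

Lemma cube_open x (r : R) y : cube x r y -> exists2 d, 0 < d & cube y d `<=` cube x r.
Proof.
move=> xy; have [k|d d0 dP] := @finite_cube _ y setT (fun k z => `|z ord0 k - x ord0 k| < r).
  exists (r - `|y ord0 k - x ord0 k|); first by rewrite subr_gt0; exact: xy.
  move=> z _ /(_ k) yz; have -> : z ord0 k - x ord0 k =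
    (z ord0 k - y ord0 k) + (y ord0 k - x ord0 k) by ring.
  by apply: le_lt_trans (ler_normD _ _) _; rewrite -ltrBrDr.
by exists d => // z yz k; exact: dP.
Qed.

End Norm1.

(** * Local comparison of the metric with the coordinate norm *)

Section MetricComparison.
Variables (R : realType) (n : nat).

(** The Cauchy-Schwarz inequality for [v] and the row [e] of the inverse matrix: [e] represents the
    [k]-th coordinate, and its square norm is [b]. It is obtained from positivity of the form on
    [v - (v_k / b) e]. *)
Lemma posdef_coord_bound (G : 'M[R]_n) (v : 'rV[R]_n) k : posdef G ->
  v ord0 k ^+ 2 <= invmx G k k * inner G v v.
Proof.
move=> Gp; have b0 : 0 < invmx G k k by apply: posdef_diag; exact: posdef_inv.
set b := invmx G k k in b0 *; set e := row k (invmx G).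
have ve : inner G v e = v ord0 k by exact: inner_row_inv.
have ee : inner G e e = b by rewrite inner_row_inv // mxE.
have := posdef_ge0 ((- (v ord0 k / b)) *: e + v) Gp.
rewrite inner_add_scalel !inner_add_scaler ee (innerC e) ?Gp.1 // ve.
move: (inner G v v) (v ord0 k) => N a H.
have : 0 <= b * (- (a / b) * (- (a / b) * b + a) + (- (a / b) * a + N)).
  by rewrite mulr_ge0 // ltW.
have -> : b * (- (a / b) * (- (a / b) * b + a) + (- (a / b) * a + N)) = b * N - a ^+ 2.
  by field; rewrite gt_eqF.
by rewrite subr_ge0.
Qed.

Lemma metric_comparison (U : set 'rV[R]_n) (G : 'rV[R]_n -> 'M[R]_n) (y0 : 'rV[R]_n) :
  U y0 -> posdef (G y0) ->
  (forall a b, {within U, continuous (fun y => G y a b)}) ->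
  exists2 d : R, 0 < d & exists2 C : R, 0 < C & forall y v : 'rV[R]_n,
    U y -> cube y0 d y ->
    (forall k, `|v ord0 k| <= C * Num.sqrt (inner (G y) v v)) /\
    Num.sqrt (inner (G y) v v) <= C * norm1 v.
Proof.
move=> U0 Gp Gc.
pose B := 1 + \sum_k Num.sqrt (invmx (G y0) k k).
have B1 : 1 <= B by rewrite lerDl sumr_ge0 // => k _; exact: sqrtr_ge0.
have B0 : 0 < B by exact: lt_le_trans B1.
(* Since [norm1 v <= B * sqrt I0] (see [low1]), this choice makes the variation of the form at most
   half of its value at [y0]. *)
pose e := (2 * B ^+ 2)^-1.
have e0 : 0 < e by rewrite invr_gt0 mulr_gt0 // exprn_gt0.
have [ab|d d0 dG] := @finite_cube _ _ ('I_n * 'I_n)%type y0 U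
    (fun ab y => `|G y ab.1 ab.2 - G y0 ab.1 ab.2| <= e).
  have /within_contP/(_ y0 e U0 e0) [d d0 dG] := Gc ab.1 ab.2.
  by exists d => // y Uy xy; apply: ltW; exact: dG.
pose K := 1 + e + \sum_(ab : 'I_n * 'I_n) `|G y0 ab.1 ab.2|.
have K1 : 1 <= K.
  by rewrite /K -addrA lerDl; apply: addr_ge0; [exact: ltW | exact: sumr_ge0].
exists d => //; exists (2 * B + K); first by rewrite addr_gt0 ?mulr_gt0 // (lt_le_trans _ K1).
move=> y v Uy xy.
have dG' a b : `|G y a b - G y0 a b| <= e by exact: (dG y Uy xy (a, b)).
have N0 := norm1_ge0 v.
have diff : `|inner (G y) v v - inner (G y0) v v| <= e * norm1 v ^+ 2.
  rewrite !innerE -sumrB; apply: le_trans (ler_norm_sum _ _ _) _.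
  rewrite expr2 /norm1 mulrCA mulr_suml; apply: ler_sum => a _.
  rewrite -sumrB; apply: le_trans (ler_norm_sum _ _ _) _.
  rewrite mulrA mulr_sumr; apply: ler_sum => b _.
  have -> : v ord0 a * G y a b * v ord0 b - v ord0 a * G y0 a b * v ord0 b =
    (v ord0 a * v ord0 b) * (G y a b - G y0 a b) by ring.
  by rewrite !normrM [leLHS]mulrAC; apply: ler_wpM2r => //; apply: ler_wpM2l.
set I0 := inner (G y0) v v in diff; set I1 := inner (G y) v v in diff *.
have I00 : 0 <= I0 by exact: posdef_ge0.
have low0 k : `|v ord0 k| <= Num.sqrt (invmx (G y0) k k) * Num.sqrt I0.
  have b0 : 0 < invmx (G y0) k k by apply: posdef_diag; exact: posdef_inv.
  rewrite -sqrtrM; last exact: ltW.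
  by rewrite -sqrtr_sqr; apply: ler_wsqrtr; exact: posdef_coord_bound.
have low1 : norm1 v <= B * Num.sqrt I0.
  apply: le_trans (_ : (\sum_k Num.sqrt (invmx (G y0) k k)) * Num.sqrt I0 <= _).
    by rewrite mulr_suml; apply: ler_sum => k _; exact: low0.
  by apply: ler_wpM2r; [exact: sqrtr_ge0 | rewrite lerDr].
have sq0 : Num.sqrt I0 ^+ 2 = I0 by exact: sqr_sqrtr.
have half : e * norm1 v ^+ 2 <= I0 / 2.
  have -> : I0 / 2 = e * (B * Num.sqrt I0) ^+ 2.
    rewrite exprMn sq0 /e; field; rewrite gt_eqF //.
  rewrite ler_pM2l // ler_sqr ?nnegrE // mulr_ge0 ?sqrtr_ge0 //.
  exact: ltW.
have I01 : I0 <= 2 * I1.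
  move: diff half; rewrite ler_norml => /andP[+ _] => D1 D2.
  have : I0 / 2 <= I1 by lra.
  lra.
have I10 : 0 <= I1 by lra.
have s01 : Num.sqrt I0 <= 2 * Num.sqrt I1.
  rewrite -(@ler_sqr _ (Num.sqrt I0)) ?nnegrE ?mulr_ge0 ?sqrtr_ge0 //.
  by rewrite exprMn !sqr_sqrtr //; lra.
split=> [k|].
  apply: le_trans (norm1_coord v k) _; apply: le_trans low1 _.
  apply: le_trans (_ : 2 * B * Num.sqrt I1 <= _).
    by rewrite [2 * B]mulrC -mulrA; apply: ler_wpM2l => //; exact: ltW.
  by apply: ler_wpM2r; [exact: sqrtr_ge0 | rewrite lerDl; apply: le_trans K1].
have up : I1 <= K * norm1 v ^+ 2.
  have : I0 <= (\sum_(ab : 'I_n * 'I_n) `|G y0 ab.1 ab.2|) * norm1 v ^+ 2.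
    rewrite /I0 innerE pair_big /= mulr_suml; apply: ler_sum => -[a b] _ /=.
    apply: le_trans (ler_norm _) _; rewrite !normrM mulrAC [_ * `|G _ _ _|]mulrC expr2.
    by apply: ler_wpM2l => //; apply: ler_pM => //; exact: norm1_coord.
  move: diff; rewrite ler_norml => /andP[_ D1] D2.
  have := sqr_ge0 (norm1 v); rewrite /K; move: (norm1 v ^+ 2) (\sum_ab _) D1 D2 => s t D1 D2 s0.
  have -> : (1 + e + t) * s = s + e * s + t * s by ring.
  lra.
apply: le_trans (_ : K * norm1 v <= _).
  rewrite -(@ler_sqr _ (Num.sqrt I1)) ?nnegrE ?mulr_ge0 ?sqrtr_ge0 //; last exact: le_trans K1.
  rewrite sqr_sqrtr // exprMn; apply: le_trans up _.
  apply: ler_wpM2r; first exact: sqr_ge0.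
  by rewrite expr2 ler_peMl // (le_trans _ K1).
by apply: ler_wpM2r => //; rewrite lerDr mulr_ge0 // ltW.
Qed.

End MetricComparison.

Lemma finite_min (R : realType) (I : finType) (P : I -> R -> Prop) :
  (forall i d d', d' <= d -> P i d -> P i d') ->
  (forall i, exists2 d, 0 < d & P i d) -> exists2 d, 0 < d & forall i, P i d.
Proof.
move=> Pm Pd; have /choice [d dP] : forall i, exists d, 0 < d /\ P i d.
  by move=> i; have [d d0 Pi] := Pd i; exists d.
exists (\big[Num.min/1]_i d i).
  by apply: (big_ind (fun d : R => 0 < d)) => //= [a b a0 b0|i _]; [rewrite lt_min a0 | case: (dP i)].
by move=> i; apply: Pm (dP i).2; exact: bigmin_le_cond.
Qed.

Definition half_box (R : realType) n (x : 'rV[R]_n) (r : R) : set 'rV[R]_n :=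
  [set v | halfspace n v /\ forall k, `|v ord0 k - x ord0 k| <= r].

Lemma half_box_compact (R : realType) n (x : 'rV[R]_n) (r : R) : compact (half_box x r).
Proof.
pose lo (k : 'I_n) := if val k == 0%N then Num.max 0 (x ord0 k - r) else x ord0 k - r.
have -> : half_box x r =
    [set v | forall k, (`[lo k, x ord0 k + r]%classic : set R) (v ord0 k)].
  apply/seteqP; split=> v /=; last first.
    move=> bv; have bv' k : lo k <= v ord0 k <= x ord0 k + r.
      by have := bv k; rewrite /= in_itv.
    split=> [k k0|k].
      by have := bv' k; rewrite /lo k0 eqxx ge_max => /andP[/andP[]].
    have /andP[] := bv' k; rewrite ler_norml /lo; case: ifP => _.
      by rewrite ge_max => /andP[_ ? ?]; apply/andP; split; lra.
    by move=> ? ?; apply/andP; split; lra.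
  move=> [Hv xv] k; have := xv k; rewrite in_itv /= ler_norml => /andP[? ?].
  rewrite /lo; case: eqP => [kk|_]; last by apply/andP; split; lra.
  by rewrite ge_max; apply/andP; split; [apply/andP; split; [exact: Hv | lra] | lra].
have := @rV_compact R n (fun k => `[lo k, x ord0 k + r]%classic).
by apply=> k; exact: segment_compact.
Qed.

(** * Quantitative local inversion of the projection to M *)

Section LocalIsometry.
Variables (R : realType) (n : nat) (n_gt0 : (0 < n)%N).
Variables (M : manifold R n) (g : metric_on M) (g_riem : riemannian g).
Variables (S : manifold R n) (F : S -> M * R) (F_imm : immersion F).
Variable s0 : R.
Hypothesis F_height : forall p, (F p).2 = s0.
Hypothesis F_boundary : forall p, boundary p -> boundary (F p).1.
Implicit Types (i : chart_index S) (j : chart_index M) (p : S).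

Lemma differential_horizontal i j p : chart_dom i p ->
  differential F i j p = row_mx (base_jac F i j p) 0.
Proof.
move=> ip; rewrite -[LHS]hsubmxK; congr (row_mx _ _).
apply/matrixP => a b; rewrite (ord1 b) [RHS]mxE mxE (differentialE F i j p a).2.
have -> : height F i = fun=> s0 by apply/funext => x; exact: F_height.
by rewrite pderiv_cst //; exact: crd_halfspace.
Qed.

Lemma base_jac_unit i j p : chart_dom i p -> chart_dom j (F p).1 ->
  base_jac F i j p \in unitmx.
Proof.
move=> ip jp; have := differential_free F_imm ip jp.
by rewrite differential_horizontal // /row_free rank_row_mx0 -/(row_free _) row_free_unit.
Qed.

(** The strict differential of the projection at [p] is invertible, which bounds displacements in
    Sigma by those of their images. The second estimate, with the Jacobian taken at any point of the
    cube, will control the velocity along a whole coordinate segment by the displacement of the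
    images of its ends. *)
Lemma base_bilipschitz i j p : chart_dom i p -> chart_dom j (F p).1 ->
  exists2 d : R, 0 < d & (forall y, halfspace n y -> cube (crd i p) d y -> map_dom F i j y) /\
  exists2 c : R, 0 < c & forall z z', halfspace n z -> halfspace n z' ->
    cube (crd i p) d z -> cube (crd i p) d z' ->
    norm1 (z' - z) <= c * norm1 (base F i j z' - base F i j z) /\
    forall y, halfspace n y -> cube (crd i p) d y ->
      norm1 ((z' - z) *m jac (base F i j) y) <= 2 * norm1 (base F i j z' - base F i j z).
Proof.
move=> ip jp; set x := crd i p; set Y := base F i j.
set A := base_jac F i j p; have Au : A \in unitmx by exact: base_jac_unit.
have Uo := map_dom_ropen F_imm i j; have Ux := map_dom_crd ip jp.
pose tau := 1 + \sum_(ab : 'I_n * 'I_n) `|invmx A ab.1 ab.2|.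
have tauP a b : `|invmx A a b| <= tau.
  rewrite /tau (bigD1 (a, b)) //=.
  have : 0 <= \sum_(ab : 'I_n * 'I_n | ab != (a, b)) `|invmx A ab.1 ab.2| by exact: sumr_ge0.
  by move: (\sum_(_ | _) _) => s; lra.
have tau1 : 0 < tau by rewrite ltr_pwDl // sumr_ge0.
have nR : 0 < n%:R :> R by rewrite ltr0n.
pose T := n%:R * tau; have T0 : 0 < T by exact: mulr_gt0.
(* [T] bounds the inverse of [A], and [n e T = 1/4]. This absorbs the error in [D <= 2 T DY]; then
   [n e D <= DY / 2], and two such errors account for the factor 2 of the second estimate. *)
pose e := (4 * (n%:R * T))^-1.
have e0 : 0 < e by rewrite invr_gt0 !mulr_gt0.
have [d1 d10 dU] := Uo.2 _ Ux.
have [b d d' dd H y z Hy Hz xy xz|b|d2 d20 dS] := @finite_min R 'I_n (fun b d =>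
    forall y z, halfspace n y -> halfspace n z -> cube x d y -> cube x d z ->
    `|Y z ord0 b - Y y ord0 b - \sum_k pderiv k (fun y => Y y ord0 b) x * (z ord0 k - y ord0 k)|
      <= e * \sum_k `|z ord0 k - y ord0 k|).
- by apply: H => //; exact: cube_le dd _ _.
- by have [d d0 dP] := C1_sdiff Uo (base_smooth F_imm i j 1 b) Ux e0; exists d.
have [ab|d3 d30 dJ] := @finite_cube _ _ ('I_n * 'I_n)%type x (map_dom F i j)
    (fun ab y => `|jac Y y ab.1 ab.2 - A ab.1 ab.2| <= e).
  have [_ /(_ ab.1) [_ [/within_contP /(_ x e Ux e0) [d d0 dP] _]]] := base_smooth F_imm i j 1 ab.2.
  by exists d => // y Uy xy; apply: ltW; rewrite /A base_jacE !mxE; exact: dP.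
pose d := Num.min d1 (Num.min d2 d3).
have d0 : 0 < d by rewrite !lt_min d10 d20.
have cU y : halfspace n y -> cube x d y -> map_dom F i j y.
  by move=> Hy xy; apply: dU; split=> //; apply: cube_le xy; rewrite ge_min lexx.
exists d => //; split=> //; exists (2 * T); first exact: mulr_gt0.
move=> z z' Hz Hz' xz xz'; set D := z' - z; set DY := Y z' - Y z.
have sub2 : cube x d `<=` cube x d2 by apply: cube_le; rewrite /d !ge_min lexx orbT.
have S1 : norm1 (DY - D *m A) <= n%:R * e * norm1 D.
  rewrite -mulrA; apply: norm1_le => b.
  have := dS b z z' Hz Hz' (sub2 _ xz) (sub2 _ xz').
  congr (_ <= _); last by congr (_ * _); apply: eq_bigr => k _; rewrite !mxE.
  rewrite !mxE; congr (`| _ - _ |); apply: eq_bigr => k _.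
  by rewrite /A base_jacE !mxE mulrC.
have DA : norm1 (D *m A) <= norm1 DY + n%:R * e * norm1 D.
  have -> : D *m A = DY - (DY - D *m A) by rewrite opprB addrC subrK.
  by apply: le_trans (norm1D _ _) _; rewrite norm1N lerD2l.
have Dle : norm1 D <= T * norm1 (D *m A).
  by rewrite -{1}(mulmxK Au D); exact: norm1_mulmx.
have neT : T * (n%:R * e) = 4^-1 by rewrite /e; field; rewrite !gt_eqF.
have D1 : norm1 D <= 2 * T * norm1 DY.
  have H1 : norm1 D <= T * norm1 DY + 4^-1 * norm1 D.
    apply: le_trans Dle _; rewrite -neT -[T * _ * norm1 D]mulrA -mulrDr; apply: ler_wpM2l => //.
    exact: ltW.
  have := norm1_ge0 D; have : 0 <= T * norm1 DY by rewrite mulr_ge0 ?norm1_ge0 // ltW.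
  rewrite -mulrA; move: (T * _) (norm1 D) H1 => s t; lra.
split=> // y Hy xy.
have S2 : norm1 (D *m (jac Y y - A)) <= n%:R * e * norm1 D.
  apply: norm1_mulmx => a b; rewrite [(_ - A) _ _]mxE [(- A) _ _]mxE.
  apply: (dJ y (cU y Hy xy) _ (a, b)).
  by apply: cube_le xy; rewrite /d !ge_min lexx !orbT.
have -> : D *m jac Y y = D *m A + D *m (jac Y y - A) by rewrite -mulmxDr addrC subrK.
apply: le_trans (norm1D _ _) _.
have D2 : n%:R * e * norm1 D <= 2^-1 * norm1 DY.
  have -> : 2^-1 * norm1 DY = (n%:R * e) * (2 * T * norm1 DY).
    by rewrite mulrA [n%:R * e * _]mulrC -[2 * T * _]mulrA neT; field.
  by rewrite ler_wpM2l // mulr_ge0 // ltW.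
lra.
Qed.

(* The minimum of |Y - y|^2 over a small box is attained in its relative interior, and the
   first-order conditions there (one-sided on the boundary) force Y = y. *)
Lemma base_local_open i j p d : chart_dom i p -> chart_dom j (F p).1 -> 0 < d ->
  exists2 eta : R, 0 < eta & forall y, halfspace n y ->
    norm1 (y - base F i j (crd i p)) < eta ->
    exists x', [/\ map_dom F i j x', cube (crd i p) d x' & base F i j x' = y].
Proof.
move=> ip jp d0; set x := crd i p; set Y := base F i j.
have Hx : halfspace n x := crd_halfspace ip.
have [d1 d10 [dU [c c0 dc]]] := base_bilipschitz ip jp.
rewrite -/x -/Y in dU dc.
pose r := Num.min d d1 / 2.
have r0 : 0 < r by rewrite divr_gt0 // lt_min d0.
have rd1 : r < d1.
  have : Num.min d d1 <= d1 by rewrite ge_min lexx orbT.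
  by rewrite /r; lra.
have rd : r < d.
  have : Num.min d d1 <= d by rewrite ge_min lexx.
  by rewrite /r; lra.
have nR : 0 < n%:R :> R by rewrite ltr0n.
(* A minimum on the outer faces of the box would have [norm1 (Y xs - Y x) >= r / c = (n + 2) eta],
   hence [norm1 (Y xs - y) > (n + 1) eta], against [norm1 (Y x - y) < eta]. The factor [n + 1]
   outweighs the loss in passing between [norm1] and sums of squares. *)
pose eta := r / c / (n%:R + 2).
have eta0 : 0 < eta by apply: divr_gt0; [exact: divr_gt0 | exact: addr_gt0].
exists eta => // y Hy xy.
pose k0 : 'I_n := Ordinal n_gt0.
pose box := half_box x r.
have boxP v : box v <-> halfspace n v /\ forall k, `|v ord0 k - x ord0 k| <= r by [].
have boxU v : box v -> map_dom F i j v.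
  by move=> /boxP [Hv xv]; apply: dU => // k; apply: le_lt_trans rd1.
pose E v := \sum_b (Y v ord0 b - y ord0 b) ^+ 2.
have Ec : {within box, continuous E}.
  apply: (@continuous_subspaceW _ _ box (map_dom F i j)); first exact: boxU.
  apply/subspace_continuousP => v Uv; rewrite /E.
  apply: cvg_big; first exact: add_continuous.
  move=> b _; have [/subspace_continuousP /(_ v Uv) Yc _] := base_smooth F_imm i j 0 b.
  by rewrite expr2; under eq_fun do rewrite expr2; apply: cvgM; apply: cvgB => //; exact: cvg_cst.
have box0 : box !=set0 by exists x; apply/boxP; split=> // k; rewrite subrr normr0 ltW.
have boxc : compact box by exact: half_box_compact.
have [xs /set_mem bxs xmin] := EVT_min_rV box0 boxc Ec.
have [Hxs xsr] := (boxP xs).1 bxs.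
have Uxs := boxU xs bxs.
have bx : box x by apply/boxP; split=> // k; rewrite subrr normr0 ltW.
have xsmin v : box v -> E xs <= E v by move=> bv; apply: xmin; exact/mem_set.
have sq v : E v = \sum_b (Y v - y) ord0 b ^+ 2 by apply: eq_bigr => b _; rewrite !mxE.
have xin : cube x r xs.
  move=> k; rewrite lt_neqAle xsr andbT; apply/eqP => xk.
  have xsd1 : cube x d1 xs by move=> l; apply: le_lt_trans rd1.
  have [H _] := dc x xs Hx Hxs (cube_center x d10) xsd1.
  have rn : r <= c * norm1 (Y xs - Y x).
    by apply: le_trans H; rewrite -xk; have := norm1_coord (xs - x) k; rewrite !mxE.
  have yx : norm1 (Y x - y) < eta by rewrite norm1B.
  have big : (n%:R + 1) * eta < norm1 (Y xs - y).
    have t1 : norm1 (Y xs - Y x) <= norm1 (Y xs - y) + norm1 (Y x - y).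
      rewrite [norm1 (Y x - y)]norm1B; have -> : Y xs - Y x = (Y xs - y) + (y - Y x).
        by rewrite addrA subrK.
      exact: norm1D.
    have t2 : (n%:R + 2) * eta <= norm1 (Y xs - Y x).
      have -> : (n%:R + 2) * eta = r / c.
        by rewrite /eta mulrC divfK // gt_eqF // addr_gt0.
      by rewrite ler_pdivrMr // mulrC.
    by move: t1 t2 yx; move: (norm1 _) (norm1 _) (norm1 _) => t s u; lra.
  have := xsmin x bx; rewrite !sq.
  have [_ e1] := norm1_sqr (Y xs - y); have [e2 _] := norm1_sqr (Y x - y).
  have e3 : norm1 (Y x - y) ^+ 2 < eta ^+ 2 by rewrite ltr_sqr ?nnegrE ?norm1_ge0 // ltW.
  have e4 : ((n%:R + 1) * eta) ^+ 2 < norm1 (Y xs - y) ^+ 2.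
    by rewrite ltr_sqr ?nnegrE ?norm1_ge0 // mulr_ge0 ?ltW // addr_gt0.
  move: e1 e2 e3 e4; move: (norm1 _ ^+ 2) (norm1 _ ^+ 2) (\sum_k _ ^+ 2) (\sum_k _ ^+ 2).
  move=> u1 u2 u3 u4 e1 e2 e3 e4 e5.
  have h1 : n%:R * u4 <= n%:R * eta ^+ 2 by rewrite ler_wpM2l ?ltW // ; lra.
  have : ((n%:R + 1) * eta) ^+ 2 = n%:R * eta ^+ 2 + (n%:R * n%:R + n%:R + 1) * eta ^+ 2 by ring.
  have : 0 <= (n%:R * n%:R + n%:R + 1) * eta ^+ 2.
    by rewrite mulr_ge0 ?sqr_ge0 // !addr_ge0 // ?mulr_ge0 // ltW.
  lra.
exists xs; split=> //; first exact: cube_le (ltW rd) _ xin.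
have [rho rho0 rhoP] := cube_open xin.
have locmin v : halfspace n v -> cube xs rho v -> E xs <= E v.
  by move=> Hv xv; apply: xsmin; apply/boxP; split=> // k; apply/ltW/rhoP.
pose q : S := par i xs; have iq : chart_dom i q by exact: par_dom Uxs.1.
have jq : chart_dom j (F q).1 by exact: Uxs.2.
have qx : crd i q = xs by exact: parK Uxs.1.
pose A := base_jac F i j q; have Au : A \in unitmx by exact: base_jac_unit.
have AE a b : A a b = pderiv a (fun v => Y v ord0 b) xs by rewrite /A base_jacE mxE qx.
pose w := Y xs - y.
have dY a b : ispd a (fun v => Y v ord0 b) xs (A a b).
  by rewrite AE; exact: Ck1_ispd (base_smooth F_imm i j 1 b) Uxs.
have dE a : ispd a E xs (2 * \sum_b A a b * w ord0 b).
  have D b : ispd a (fun v => (Y v ord0 b - y ord0 b) * (Y v ord0 b - y ord0 b)) xs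
      ((A a b + 0) * (Y xs ord0 b - y ord0 b) + (Y xs ord0 b - y ord0 b) * (A a b + 0)).
    by apply: ispdM; apply: ispdD (dY a b) (@ispd_cst _ _ a _ xs).
  have := ispd_sum D; congr (ispd _ _ _ _).
  by rewrite mulr_sumr; apply: eq_bigr => b _; rewrite !mxE; ring.
have Aw a : (A *m w^T) a ord0 = \sum_b A a b * w ord0 b.
  by rewrite mxE; apply: eq_bigr => b _; rewrite [w^T _ _]mxE.
have w_of : A *m w^T = 0 -> Y xs = y.
  move=> Aw0; have : w^T = 0 by rewrite -[w^T](mulKmx Au) Aw0 mulmx0.
  by move=> /(congr1 trmx); rewrite trmxK trmx0 => /eqP; rewrite subr_eq0 => /eqP.
have interior a : (val a = 0%N -> 0 < xs ord0 a) -> \sum_b A a b * w ord0 b = 0.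
  move=> a0; have := ispd_min_eq0 rho0 Hxs a0 locmin (dE a).
  by move/eqP; rewrite mulf_eq0 pnatr_eq0 /= => /eqP.
have [xk0|xk0] := ltP 0 (xs ord0 k0).
  apply: w_of; apply/matrixP => a b; rewrite (ord1 b) Aw [RHS]mxE; apply: interior => a0.
  by rewrite (_ : a = k0) //; apply: val_inj; rewrite a0.
(* On the face, the column 0 of [A] reduces to its diagonal entry. The first-order conditions then
   make [w] the multiple [al / A k0 k0] of the vector of index 0, with [al >= 0] and [A k0 k0 > 0];
   but its component is [- y_0 <= 0], so [al = 0]. *)
have xk : xs ord0 k0 = 0 by apply/eqP; rewrite eq_le xk0 Hxs.
have bq : boundary q.
  by exists i => // k k0'; rewrite qx (_ : k = k0) //; apply: val_inj; rewrite k0'.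
have Yk : Y xs ord0 k0 = 0 by apply: boundary_crd0 => //; exact: F_boundary.
have A0 b : b != k0 -> A b k0 = 0.
  by move=> bk; apply: (base_jac_boundary F_imm iq jq F_boundary bq _ bk).
have YH v : map_dom F i j v -> 0 <= Y v ord0 k0.
  by move=> [_ jv]; exact: (crd_halfspace jv).
have Ak_ge0 : 0 <= A k0 k0.
  apply: (ispd_min_ge0 rho0 Hxs _ (dY k0 k0)) => v Hv xv; rewrite Yk; apply: YH.
  by apply: boxU; apply/boxP; split=> // k; apply/ltW/rhoP.
have Acol : A *m delta_mx k0 (ord0 : 'I_1) = A k0 k0 *: delta_mx k0 ord0.
  rewrite -colE; apply/matrixP => a b; rewrite (ord1 b) mxE [RHS]mxE [delta_mx _ _ _ _]mxE.
  have [->|ak] := eqVneq a k0; first by rewrite eqxx mulr1.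
  rewrite (A0 _ ak).
  by rewrite /= mulr0.
have Ak_neq0 : A k0 k0 != 0.
  apply/eqP => Ak0; have : delta_mx k0 (ord0 : 'I_1) = 0 :> 'M[R]_(n, 1).
    by rewrite -[LHS](mulKmx Au) Acol Ak0 scale0r mulmx0.
  by move/matrixP/(_ k0 ord0)/eqP; rewrite !mxE !eqxx oner_eq0.
set al := \sum_b A k0 b * w ord0 b.
have al_ge0 : 0 <= al.
  by have := ispd_min_ge0 rho0 Hxs locmin (dE k0); rewrite pmulr_rge0.
have Aw_al : A *m w^T = al *: delta_mx k0 ord0.
  apply/matrixP => a b; rewrite (ord1 b) Aw !mxE.
  have [->|ak] := eqVneq a k0; first by rewrite eqxx mulr1.
  rewrite interior ?mulr0 // => a0; case/eqP: ak; exact: val_inj.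
have wE : w^T = (al / A k0 k0) *: delta_mx k0 ord0.
  have H : A *m w^T = A *m ((al / A k0 k0) *: delta_mx k0 ord0).
    by rewrite Aw_al -scalemxAr Acol scalerA divfK.
  by rewrite -[LHS](mulKmx Au) H mulKmx.
have wk : w ord0 k0 = al / A k0 k0.
  by have /matrixP/(_ k0 ord0) := wE; rewrite [LHS]mxE !mxE !eqxx mulr1.
have al0 : al = 0.
  apply/eqP; rewrite eq_le al_ge0 andbT.
  have : w ord0 k0 <= 0 by rewrite !mxE Yk sub0r oppr_le0; exact: Hy.
  by rewrite wk pmulr_lle0 // invr_gt0 lt_def Ak_neq0.
by apply: w_of; rewrite Aw_al al0 scale0r.
Qed.

End LocalIsometry.

(** * Bounds for lengths *)

Section IntegralBounds.
Variable R : realType.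
Local Notation mu := (@lebesgue_measure R).

(* Monotonicity without measurability: the integral of a nonnegative function is a supremum
   over the simple functions below it. *)
Lemma ge0_integral_le (D1 D2 : set R) (f1 f2 : R -> R) : D1 `<=` D2 ->
  (forall t, D1 t -> 0 <= f1 t) -> (forall t, D2 t -> 0 <= f2 t) ->
  (forall t, D1 t -> f1 t <= f2 t) ->
  (\int[mu]_(t in D1) (f1 t)%:E <= \int[mu]_(t in D2) (f2 t)%:E)%E.
Proof.
move=> D12 f10 f20 f12; rewrite integral_mkcond [leRHS]integral_mkcond.
have p1 t : (0 <= ((fun t => (f1 t)%:E) \_ D1) t)%E.
  by apply: erestrict_ge0 => {}t /f10; rewrite lee_fin.
have p2 t : (0 <= ((fun t => (f2 t)%:E) \_ D2) t)%E.
  by apply: erestrict_ge0 => {}t /f20; rewrite lee_fin.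
rewrite !ge0_integralTE //; apply: le_ereal_sup => _ [h hle <-]; exists h => // t.
apply: le_trans (hle t) _; rewrite /patch; case: ifPn => [/set_mem D1t|_].
  by rewrite (mem_set (D12 _ D1t)) lee_fin f12.
by have := p2 t; rewrite /patch.
Qed.

Lemma integral_le_cst (f : R -> R) (a b K : R) : a <= b ->
  (forall t, 0 <= f t) -> (forall t, f t <= K) ->
  (\int[mu]_(t in `[a, b]) (f t)%:E <= (K * (b - a))%:E)%E.
Proof.
move=> ab f0 fK; apply: le_trans (_ : \int[mu]_(t in `[a, b]) (cst K t)%:E <= _)%E.
  by apply: ge0_integral_le => // t _; exact: le_trans (f0 t) (fK t).
rewrite (_ : (fun t => (cst K t)%:E) = cst K%:E) // integral_cst //=.
rewrite lebesgue_measure_itv /= lte_fin; case: ifP => [_|]; first by rewrite -EFinB -EFinM.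
rewrite mule0 lee_fin mulr_ge0 ?subr_ge0 //.
exact: le_trans (f0 0) (fK 0).
Qed.

(** The fundamental theorem on [[a, b]], followed by monotonicity. [f] will be the speed of a curve,
    computed at each instant in the chart chosen at that point, so its measurability is not at
    hand. *)
Lemma C1_at_integral_bound (phi f : R -> R) (a0 a b : R) : a0 <= a -> a < b ->
  (forall t, a <= t <= b -> C1_at phi t) ->
  (forall t, 0 <= f t) ->
  (forall t, a <= t <= b -> `|derive1 phi t| <= f t) ->
  (`|phi b - phi a|%:E <= \int[mu]_(t in `[a0, b]) (f t)%:E)%E.
Proof.
move=> a0a ab pC f0 pf.
have pc : {within `[a, b], continuous (derive1 phi)}.
  apply/subspace_continuousP => t; rewrite /= in_itv /= => tab.
  by apply: cvg_trans (pC t tab).2; apply: cvg_app; exact: cvg_within.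
have pcont t : a <= t <= b -> {for t, continuous phi}.
  by move=> tab; apply: derivable_continuous1; have [/nbhs_singleton] := pC t tab.
have FTC : (\int[mu]_(t in `[a, b]) (derive1 phi t)%:E = (phi b)%:E - (phi a)%:E)%E.
  apply: continuous_FTC2 => //; split.
  - move=> t; rewrite in_itv /= => /andP[/ltW a1 /ltW b1].
    by have [pd _] := pC t (introT andP (conj a1 b1)); exact: (nbhs_singleton pd).
  - by apply: cvg_at_right_filter; apply: pcont; rewrite lexx ltW.
  - by apply: cvg_at_left_filter; apply: pcont; rewrite lexx ltW.
rewrite -abse_EFin EFinB -FTC.
apply: le_trans (_ : \int[mu]_(t in `[a, b]) `|derive1 phi t|%:E <= _)%E.
  apply: le_trans (le_abse_integral _ _ _) _ => //.
  apply/measurable_EFinP; apply: subspace_continuous_measurable_fun => //.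
apply: ge0_integral_le => //.
by move=> t; rewrite /= !in_itv /= => /andP[at_ ->]; rewrite (le_trans a0a).
Qed.

End IntegralBounds.

(** * An explicit C^1 step function *)

Section SmoothStep.
Variable R : realType.

Lemma C1_at_ext (phi dphi : R -> R) (t : R) : (forall s : R, is_derive s 1 phi (dphi s)) ->
  continuous dphi -> C1_at phi t /\ derive1 phi t = dphi t.
Proof.
move=> pd dc; have E : derive1 phi = dphi.
  by apply/funext => s; rewrite derive1E; case: (pd s).
split; last by rewrite E.
split; first by apply: filterE => s; case: (pd s).
by rewrite E; exact: dc.
Qed.

Definition ramp (t : R) : R := Num.max 0 t.

Lemma ramp_sqr_derive (t : R) : is_derive t 1 (fun s => ramp s ^+ 2) (2 * ramp t).
Proof.
apply/dquot_is_derive/cvgrPdist_lt => e e0.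
near=> s.
have s0 : s != 0 by near: s; exact: (@nbhs_dnbhs_neq R 0).
have se : `|s| < e.
  near: s; apply: nbhs_dnbhs; apply/nbhs_ballP; exists e => //= u.
  by rewrite -ball_normE /= sub0r normrN.
rewrite distrC; apply: le_lt_trans se; rewrite /dquot addr0.
have -> : s^-1 * (ramp (t + s) ^+ 2 - ramp t ^+ 2) - 2 * ramp t =
    s^-1 * (ramp (t + s) ^+ 2 - ramp t ^+ 2 - 2 * ramp t * s) by field.
rewrite normrM normfV ler_pdivrMl ?normr_gt0 // -expr2 real_normK ?num_real //.
rewrite /ramp ler_norml; apply/andP; case: (ltP 0 (t + s)) => h1; case: (ltP 0 t) => h2; split; nra.
Unshelve. all: by end_near. Qed.

Lemma ramp_continuous : continuous ramp.
Proof.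
move=> t; apply/cvgrPdist_lt => e e0; near=> s.
have : `|t - s| < e by near: s; apply/nbhs_ballP; exists e => //= u; rewrite -ball_normE.
apply: le_lt_trans; rewrite /ramp.
case: (ltP 0 t) => h1; case: (ltP 0 s) => h2; rewrite // ?subrr ?normr0 //.
  rewrite subr0 !ger0_norm; lra.
by rewrite sub0r normrN [leRHS]distrC !ger0_norm; lra.
Unshelve. all: by end_near. Qed.

(* A [C^1] step from 0 on (-oo, 1/4] to 1 on [3/4, +oo). *)
Definition smooth_step (t : R) : R :=
  8 * (ramp (t - 4^-1) ^+ 2 - 2 * ramp (t - 2^-1) ^+ 2 + ramp (t - 3 / 4) ^+ 2).

(** A tent on [[1/4, 3/4]] of height 4 and integral 1. *)
Definition smooth_step' (t : R) : R :=
  16 * (ramp (t - 4^-1) - 2 * ramp (t - 2^-1) + ramp (t - 3 / 4)).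

Lemma smooth_step0 t : t <= 4^-1 -> smooth_step t = 0.
Proof.
move=> t0; rewrite /smooth_step /ramp.
case: (ltP 0 (t - 4^-1)) => h1; case: (ltP 0 (t - 2^-1)) => h2; case: (ltP 0 (t - 3 / 4)) => h3; lra.
Qed.

Lemma smooth_step1 t : 3 / 4 <= t -> smooth_step t = 1.
Proof.
move=> t0; rewrite /smooth_step /ramp.
case: (ltP 0 (t - 4^-1)) => h1; case: (ltP 0 (t - 2^-1)) => h2; case: (ltP 0 (t - 3 / 4)) => h3;
  try lra; try (by rewrite !expr2; field); try (have -> : t = 3 / 4 by lra); by field.
Qed.

Lemma smooth_step_itv t : 0 <= smooth_step t <= 1.
Proof.
rewrite /smooth_step /ramp; apply/andP.
case: (ltP 0 (t - 4^-1)) => h1; case: (ltP 0 (t - 2^-1)) => h2; case: (ltP 0 (t - 3 / 4)) => h3;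
 split; try lra; nra.
Qed.

Lemma smooth_step'_bound t : `|smooth_step' t| <= 4.
Proof.
rewrite /smooth_step' /ramp ler_norml; apply/andP.
case: (ltP 0 (t - 4^-1)) => h1; case: (ltP 0 (t - 2^-1)) => h2; case: (ltP 0 (t - 3 / 4)) => h3;
 split; lra.
Qed.

Lemma smooth_step'_continuous : continuous smooth_step'.
Proof.
move=> s; rewrite /smooth_step'; apply: cvgM; first exact: cvg_cst.
have rc (c : R) : {for s, continuous (fun s => ramp (s - c))}.
  apply: (@cvg_comp _ _ _ (fun s => s - c) ramp _ (nbhs (s - c))); last exact: ramp_continuous.
  by apply: cvgB; [exact: cvg_id | exact: cvg_cst].
apply: cvgD; last exact: rc.
apply: cvgB; first exact: rc.
by apply: cvgM; [exact: cvg_cst | exact: rc].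
Qed.

Lemma smooth_step_C1 t : C1_at smooth_step t /\ derive1 smooth_step t = smooth_step' t.
Proof.
have sh (c s : R) : is_derive s 1 (fun s : R => ramp (s - c) ^+ 2) (2 * ramp (s - c)).
  have /dquot_is_derive H := ramp_sqr_derive (s - c); apply/dquot_is_derive.
  by have -> : (fun u => ramp (s + u - c) ^+ 2) = fun u => ramp (s - c + u) ^+ 2
    by apply/funext => u; rewrite addrAC.
apply: C1_at_ext.
  move=> s; apply: is_derive_eq.
  rewrite /smooth_step' /GRing.scale /=; ring.
exact: smooth_step'_continuous.
Qed.

End SmoothStep.

(** * Paths of speed at most 1 and their concatenation *)

Section Paths.
Variables (R : realType) (n : nat) (X : manifold R n) (gX : metric_on X).
Implicit Types (gam : R -> X) (p q : X) (i : chart_index X).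

Definition C1_path_at gam t : Prop := {for t, continuous gam} /\
  forall i (k : 'I_n), chart_dom i (gam t) -> C1_at (curve_crd gam i k) t.

Lemma C1_path_near gam gam' t : (\forall s \near t, gam s = gam' s) ->
  C1_path_at gam t -> C1_path_at gam' t /\ speed gX gam' t = speed gX gam t.
Proof.
move=> E [gc gd]; have Et : gam t = gam' t := nbhs_singleton E.
have Ek i k : \forall s \near t, curve_crd gam i k s = curve_crd gam' i k s.
  by apply: filterS E => s; rewrite /curve_crd => ->.
split.
  split.
    suff : gam' @ t --> gam t by rewrite Et.
    by apply: cvg_trans gc; apply: near_eq_cvg; apply: filterS E => s ->.
  move=> i k; rewrite -Et => it; have [] := C1_at_near (Ek i k) (gd i k it).
  by [].
rewrite /speed -Et; set i := chart_at (gam t).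
have -> : \row_k derive1 (curve_crd gam' i k) t = \row_k derive1 (curve_crd gam i k) t.
  apply/rowP => k; rewrite !mxE.
  by have [] := C1_at_near (Ek i k) (gd i k (dom_chart_at _)).
by [].
Qed.

Lemma C1_at_shift (phi : R -> R) (c t : R) : C1_at phi (t - c) ->
  C1_at (fun s => phi (s - c)) t /\ derive1 (fun s => phi (s - c)) t = derive1 phi (t - c).
Proof.
have sc (u : R) : (fun s : R => s - c) @ u --> u - c.
  by apply: cvgB; [exact: cvg_id | exact: cvg_cst].
have E s : (fun h => h^-1 *: (((fun s => phi (s - c)) \o shift s) (h *: 1) - phi (s - c))) =
    (fun h => h^-1 *: ((phi \o shift (s - c)) (h *: 1) - phi (s - c))).
  by apply/funext => h; rewrite /= /shift /= addrA.
have D s : derive1 (fun s => phi (s - c)) s = derive1 phi (s - c).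
  by rewrite !derive1E /derive E.
have Dc : derive1 (fun s => phi (s - c)) = derive1 phi \o (fun s => s - c).
  by apply/funext => s; rewrite D.
move=> [pd pc]; split; last exact: D.
split.
  have pdc : nbhs t ((fun s : R => s - c) @^-1` [set s | derivable phi s 1]) := sc t _ pd.
  by apply: filterS pdc => s sd; rewrite /derivable E; exact: sd.
rewrite Dc; apply: (@cvg_comp _ _ _ (fun s => s - c) (derive1 phi) _ (nbhs (t - c))).
  exact: sc.
exact: pc.
Qed.

Lemma C1_path_shift gam (c t : R) : C1_path_at gam (t - c) ->
  C1_path_at (fun s => gam (s - c)) t /\
  speed gX (fun s => gam (s - c)) t = speed gX gam (t - c).
Proof.
move=> [gc gd]; split.
  split.
    apply: (@cvg_comp _ _ _ (fun s => s - c) gam _ (nbhs (t - c))) => //.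
    by apply: cvgB; [exact: cvg_id | exact: cvg_cst].
  by move=> i k it; have [] := C1_at_shift (gd i k it).
rewrite /speed; set i := chart_at (gam (t - c)).
have -> : \row_k derive1 (curve_crd (fun s => gam (s - c)) i k) t =
    \row_k derive1 (curve_crd gam i k) (t - c).
  apply/rowP => k; rewrite !mxE.
  by have [_ <-] := C1_at_shift (gd i k (dom_chart_at _)).
by [].
Qed.

(* The path is stationary near both ends, so that such paths can be concatenated. *)
Definition joins p q (L : R) : Prop := 0 < L /\ exists gam, exists2 e : R, 0 < e &
  [/\ forall t, C1_path_at gam t, forall t, t <= e -> gam t = p,
      forall t, L - e <= t -> gam t = q & forall t, speed gX gam t <= 1].

Lemma joins_trans p q r (L L' : R) : joins p q L -> joins q r L' -> joins p r (L + L').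
Proof.
move=> [L0 [g1 [e1 e10 [C1 p1 q1 s1]]]] [L'0 [g2 [e2 e20 [C2 q2 r2 s2]]]].
split; first exact: addr_gt0.
(* Both pieces equal [q] on [(L - e, L + e)], so the glued path locally coincides with one of them.
   The bounds [L / 2] and [L' / 2] keep the resting intervals of the new path within the first and
   the last piece. *)
pose e := Num.min (Num.min e1 e2) (Num.min (L / 2) (L' / 2)).
have e0 : 0 < e by rewrite !lt_min e10 e20 !divr_gt0.
have [ee1 ee2 eL eL'] : [/\ e <= e1, e <= e2, e <= L / 2 & e <= L' / 2].
  by rewrite /e; split; rewrite !ge_min lexx ?orbT.
pose gam t := if t <= L then g1 t else g2 (t - L).
have near1 t : t < L + e -> \forall s \near t, g1 s = gam s.
  move=> tL; near=> s; rewrite /gam; case: ifPn => //; rewrite -ltNge => Ls.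
  have sL : s < L + e by near: s; exact: lt_nbhsl.
  by rewrite q1 ?q2 //; lra.
have near2 t : L - e < t -> \forall s \near t, g2 (s - L) = gam s.
  move=> tL; near=> s; rewrite /gam; case: ifPn => // sL.
  have Ls : L - e < s by near: s; exact: lt_nbhsr.
  by rewrite q1 ?q2 //; lra.
have loc t : C1_path_at gam t /\ speed gX gam t <= 1.
  have [tL|tL] := ltP t (L + e).
    have [H HE] := C1_path_near (near1 t tL) (C1 t).
    by split; [exact: H | rewrite HE; exact: s1].
  have tL' : L - e < t by lra.
  have [H1 H2] := C1_path_shift (C2 (t - L)).
  have [H HE] := C1_path_near (near2 t tL') H1.
  by split; [exact: H | rewrite HE H2; exact: s2].
exists gam; exists e; first exact: e0.
split=> t; first by have [H _] := loc t; exact: H.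
- by move=> te; rewrite /gam ifT ?p1 //; lra.
- move=> te; rewrite /gam ifF; first by rewrite r2 //; lra.
  by apply/negbTE; rewrite -ltNge; lra.
- by have [_ H] := loc t; exact: H.
Unshelve. all: by end_near. Qed.

Lemma dist_joins p q L : joins p q L -> (dist gX p q <= L%:E)%E.
Proof.
move=> [L0 [gam [e e0 [gC gp gq gs]]]].
apply: le_trans (_ : curve_length gX gam 0 L <= _)%E; last first.
  have := @integral_le_cst R (speed gX gam) 0 L 1 (ltW L0) _ gs.
  by rewrite mul1r subr0; apply=> t; exact: sqrtr_ge0.
apply: ereal_inf_lbound; exists gam, 0, L; split=> //.
- split; first exact: ltW.
  by move=> t _; have [? gd] := gC t; split=> // i k it; exact: gd.
- by apply: gp; exact: ltW.
- by apply: gq; lra.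
Qed.

End Paths.

(** * Coordinate segments as paths of controlled length *)

Section PathsInLocalIsometry.
Variables (R : realType) (n : nat) (n_gt0 : (0 < n)%N).
Variables (M : manifold R n) (g : metric_on M) (g_riem : riemannian g).
Variables (S : manifold R n) (F : S -> M * R) (F_imm : immersion F).
Variable s0 : R.
Hypothesis F_height : forall p, (F p).2 = s0.
Hypothesis F_boundary : forall p, boundary p -> boundary (F p).1.
Implicit Types (i : chart_index S) (j : chart_index M) (p : S).
Local Notation GI := (induced_metric g F).

Lemma chart_near i (gam : R -> S) t : {for t, continuous gam} -> chart_dom i (gam t) ->
  \forall s \near t, chart_dom i (gam s).
Proof.
by move=> gc it; apply: gc; apply: open_nbhs_nbhs; split=> //; exact: dom_open.
Qed.

Lemma chart_near_image j (gam : R -> S) t : {for t, continuous gam} ->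
  chart_dom j (F (gam t)).1 -> \forall s \near t, chart_dom j (F (gam s)).1.
Proof.
move=> gc jt; have Fc : {for t, continuous (fun s => (F (gam s)).1)}.
  apply: (@cvg_comp _ _ _ gam (fun p => (F p).1) _ (nbhs (gam t))) => //.
  exact: (F_continuous1 F_imm).
by apply: Fc; apply: open_nbhs_nbhs; split=> //; exact: dom_open.
Qed.

Lemma image_C1 j (gam : R -> S) t : C1_path_at gam t -> chart_dom j (F (gam t)).1 ->
  forall k, C1_at (fun s => crd j (F (gam s)).1 ord0 k) t.
Proof.
move=> [gc gd] jt k; set i := chart_at (gam t); have it := dom_chart_at (gam t).
pose c s := crd i (gam s).
have Un : \forall s \near t, map_dom F i j (c s).
  near=> s; apply: map_dom_crd; near: s; first exact: chart_near gc it.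
  exact: chart_near_image.
have [H _] := C1_at_comp (map_dom_ropen F_imm i j) (base_smooth F_imm i j 1 k) Un
  (fun a => gd i a it).
have E : \forall s \near t, ((fun x => base F i j x ord0 k) \o c) s = crd j (F (gam s)).1 ord0 k.
  near=> s; rewrite /= /base /c crdK //; near: s; exact: chart_near gc it.
by have [] := C1_at_near E H.
Unshelve. all: by end_near. Qed.

(** At constant height the induced metric is the pullback of [g] by the projection, so speeds in
    Sigma can be computed in any chart of M around the image. *)
Lemma speed_image j (gam : R -> S) t : C1_path_at gam t -> chart_dom j (F (gam t)).1 ->
  let V := \row_k derive1 (fun s => crd j (F (gam s)).1 ord0 k) t in
  speed GI gam t = Num.sqrt (inner (g j (F (gam t)).1) V V).
Proof.
move=> [gc gd] jt V; set i := chart_at (gam t); have it := dom_chart_at (gam t).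
pose c s := crd i (gam s).
have Un : \forall s \near t, map_dom F i j (c s).
  near=> s; apply: map_dom_crd; near: s; first exact: chart_near gc it.
  exact: chart_near_image.
pose w := \row_k derive1 (curve_crd gam i k) t.
have VE : V = w *m base_jac F i j (gam t).
  apply/rowP => k; rewrite mxE.
  have [H HE] := C1_at_comp (map_dom_ropen F_imm i j) (base_smooth F_imm i j 1 k) Un
    (fun a => gd i a it).
  have E : \forall s \near t, ((fun x => base F i j x ord0 k) \o c) s = crd j (F (gam s)).1 ord0 k.
    near=> s; rewrite /= /base /c crdK //; near: s; exact: chart_near gc it.
  have [_ ->] := C1_at_near E H; rewrite HE [RHS]mxE; apply: eq_bigr => a _.
  by rewrite base_jacE !mxE mulrC.
rewrite /speed -/i -/w (induced_metricE g_riem F_imm it jt) inner_mulmx.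
rewrite (differential_horizontal F_height _ it) mul_mx_row mulmx0 -VE.
by rewrite /inner tr_row_mx mul_row_block mul_row_col !mulmx0 !addr0 trmx0 mulmx0 addr0.
Unshelve. all: by end_near. Qed.

Lemma affine_halfspace (x x' : 'rV[R]_n) (s : R) : 0 <= s <= 1 ->
  halfspace n x -> halfspace n x' -> halfspace n (x + s *: (x' - x)).
Proof.
move=> /andP[s_ge0 s1] Hx Hx' k k0; rewrite !mxE.
have := Hx k k0; have := Hx' k k0; move: (x ord0 k) (x' ord0 k) => a b; nra.
Qed.

Lemma affine_cube (y x x' : 'rV[R]_n) (s d : R) : 0 <= s <= 1 ->
  cube y d x -> cube y d x' -> cube y d (x + s *: (x' - x)).
Proof.
move=> /andP[s_ge0 s1] yx yx' k; rewrite !mxE.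
have := yx k; have := yx' k; rewrite !ltr_norml => /andP[a1 a2] /andP[a3 a4].
move: (x ord0 k) (x' ord0 k) (y ord0 k) a1 a2 a3 a4 => a b u a1 a2 a3 a4.
have [->|sn0] := eqVneq s 0; first by rewrite mul0r addr0 a3.
have sp : 0 < s by rewrite lt_def sn0.
have h1 : 0 < s * (d - (b - u)) by rewrite mulr_gt0 // subr_gt0.
have h2 : 0 < s * (b - u + d) by rewrite mulr_gt0 //; lra.
have h3 : 0 <= (1 - s) * (d - (a - u)) by rewrite mulr_ge0 //; lra.
have h4 : 0 <= (1 - s) * (a - u + d) by rewrite mulr_ge0 //; lra.
by apply/andP; split; lra.
Qed.

(* Uniformity: [C] bounds [g] near [y0] and does not depend on the point [p]. *)
Lemma chart_line_joins i j p (y0 : 'rV[R]_n) (d0 C : R) : chart_dom i p -> chart_dom j (F p).1 ->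
  (forall y v : 'rV[R]_n, @chart_cod _ _ M j y -> cube y0 d0 y ->
     Num.sqrt (inner (g j (par j y)) v v) <= C * norm1 v) -> 0 < C ->
  cube y0 d0 (crd j (F p).1) ->
  exists2 d : R, 0 < d & forall x x', halfspace n x -> halfspace n x' ->
    cube (crd i p) d x -> cube (crd i p) d x' -> forall L : R, 0 < L ->
    8 * C * norm1 (base F i j x' - base F i j x) <= L -> joins GI (par i x) (par i x') L.
Proof.
move=> ip jp gC C0 yp; set x0 := crd i p; set Y := base F i j.
have [d1 d10 [dU [c c0 dc]]] := base_bilipschitz n_gt0 F_imm F_height ip jp.
rewrite -/x0 -/Y in dU dc.
have Hx0 : halfspace n x0 := crd_halfspace ip.
have [k|d2 d20 dY] := @finite_cube _ _ 'I_n x0 (map_dom F i j)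
    (fun k y => `|Y y ord0 k - y0 ord0 k| < d0).
  have [/within_contP Yc _] := base_smooth F_imm i j 0 k.
  have h0 : 0 < d0 - `|Y x0 ord0 k - y0 ord0 k|.
    by rewrite subr_gt0 /Y /base /x0 crdK //; exact: yp.
  have [d d_gt0 dP] := Yc x0 _ (map_dom_crd ip jp) h0.
  exists d => // y Uy xy; have := dP y Uy xy.
  have -> : Y y ord0 k - y0 ord0 k = (Y y ord0 k - Y x0 ord0 k) + (Y x0 ord0 k - y0 ord0 k) by ring.
  by move=> H; apply: le_lt_trans (ler_normD _ _) _; rewrite -ltrBrDr.
pose d := Num.min d1 d2; have d_gt0 : 0 < d by rewrite lt_min d10.
exists d => // x x' Hx Hx' xx xx' L L0 LC.
(* The segment is run through with a step function, which makes the path stationary on the first and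
   last quarters of [[0, L]]. *)
pose sg t := smooth_step (t / L).
pose l t := x + sg t *: (x' - x).
have lH t : halfspace n (l t) by apply: affine_halfspace => //; exact: smooth_step_itv.
have lcube t : cube x0 d (l t) by apply: affine_cube => //; exact: smooth_step_itv.
have sub1 : cube x0 d `<=` cube x0 d1 by apply: cube_le; rewrite ge_min lexx.
have lU t : map_dom F i j (l t) by apply: dU => //; exact: sub1.
have lcod t : @chart_cod _ _ S i (l t) by have [] := lU t.
have sgC t : C1_at sg t /\ derive1 sg t = smooth_step' (t / L) / L.
  have D s : is_derive (s : R) 1 (fun s : R => s / L) L^-1.
    have H : is_derive s 1 (fun s : R => s) 1 by exact: is_derive_id.
    by apply: is_derive_eq; rewrite /GRing.scale /= mulr1 mulr0 add0r.
  have Dsg s : is_derive (s : R) 1 sg (smooth_step' (s / L) / L).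
    have [[/nbhs_singleton sd _] sE] := smooth_step_C1 (s / L).
    have H : is_derive (s / L) 1 (@smooth_step R) (smooth_step' (s / L)).
      by rewrite -sE derive1E; apply: DeriveDef.
    by apply: is_derive_eq.
  apply: (C1_at_ext t Dsg) => s; apply: cvgM; last exact: cvg_cst.
  apply: (@cvg_comp _ _ _ (fun s => s / L) (@smooth_step' R) _ (nbhs (s / L))).
    by apply: cvgM; [exact: cvg_id | exact: cvg_cst].
  exact: smooth_step'_continuous.
have lC t k : C1_at (fun s => l s ord0 k) t /\
    derive1 (fun s => l s ord0 k) t = (smooth_step' (t / L) / L) * (x' - x) ord0 k.
  have E : (fun s => l s ord0 k) = fun s => x ord0 k + sg s * (x' - x) ord0 k.
    by apply/funext => s; rewrite /l !mxE.
  rewrite E; apply: (@C1_at_ext R _ (fun s => smooth_step' (s / L) / L * (x' - x) ord0 k)).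
    move=> s; have [[/nbhs_singleton sd _] sE] := sgC s.
    have H : is_derive s 1 sg (smooth_step' (s / L) / L) by rewrite -sE derive1E; apply: DeriveDef.
    by apply: is_derive_eq; rewrite /GRing.scale /=; ring.
  move=> s; apply: cvgM; last exact: cvg_cst.
  apply: cvgM; last exact: cvg_cst.
  apply: (@cvg_comp _ _ _ (fun s => s / L) (@smooth_step' R) _ (nbhs (s / L))).
    by apply: cvgM; [exact: cvg_id | exact: cvg_cst].
  exact: smooth_step'_continuous.
have lcont t : forall k, {for t, continuous (fun s => l s ord0 k)}.
  move=> k; apply: derivable_continuous1; have [[ld _] _] := lC t k.
  exact: (nbhs_singleton ld).
pose gam t : S := par i (l t).
have gamC t : C1_path_at gam t.
  split.
    move=> B nB; have [d3 d30 dB] := (within_cubeP _ _).1 (@par_continuous _ _ S i) (l t) B (lcod t) nB.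
    have := curve_cube (lcont t) d30; apply: filterS => s ls; apply: dB => //; exact: lcod.
  move=> i' k i't; have Ov : overlap i i' (l t) by split=> //; exact: lcod.
  have [d3 d30 dO] := (overlap_ropen i i').2 _ Ov.
  have On : \forall s \near t, overlap i i' (l s).
    have := curve_cube (lcont t) d30; apply: filterS => s ls; apply: dO; split=> //; exact: lH.
  have [] := C1_at_comp (overlap_ropen i i') (transition_smooth i i' k 1) On (fun a => (lC t a).1).
  by [].
have gamj t : chart_dom j (F (gam t)).1 by have [] := lU t.
split=> //; exists gam; exists (L / 4); first by rewrite divr_gt0.
have l0 t : t <= L / 4 -> l t = x.
  move=> tL; rewrite /l /sg smooth_step0 ?scale0r ?addr0 //.
  by rewrite ler_pdivrMr //; lra.
have l1 t : L - L / 4 <= t -> l t = x'.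
  move=> tL; rewrite /l /sg smooth_step1; first by rewrite scale1r addrC subrK.
  by rewrite ler_pdivlMr //; lra.
split=> [//|t tL|t tL|t].
- by rewrite /gam l0.
- by rewrite /gam l1.
rewrite (speed_image (gamC t) (gamj t)); set V := \row_k _.
have VE : V = (smooth_step' (t / L) / L) *: ((x' - x) *m jac Y (l t)).
  apply/rowP => k; rewrite mxE.
  have Un : \forall s \near t, map_dom F i j (l s) by apply: filterE.
  have [_ H] := C1_at_comp (map_dom_ropen F_imm i j) (base_smooth F_imm i j 1 k) Un
    (fun a => (lC t a).1).
  rewrite [LHS]H [RHS]mxE [(_ *m _) _ _]mxE mulr_sumr; apply: eq_bigr => a _.
  by rewrite (lC t a).2 [jac _ _ _ _]mxE; ring.
have gy : g j (F (gam t)).1 = g j (par j (Y (l t))) by rewrite /Y /base (crdK (gamj t)).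
rewrite gy; have Yc : cube y0 d0 (Y (l t)).
  by move=> k; apply: dY => //; apply: cube_le (lcube t); rewrite ge_min lexx orbT.
apply: le_trans (gC _ V (crd_cod (gamj t)) Yc) _.
have [_ /(_ (l t) (lH t) (sub1 _ (lcube t))) H2] := dc x x' Hx Hx' (sub1 _ xx) (sub1 _ xx').
rewrite VE norm1Z.
have H3 : `|smooth_step' (t / L) / L| <= 4 / L.
  have Li : 0 < L^-1 by rewrite invr_gt0.
  by rewrite normrM (gtr0_norm Li) ler_pM2r //; exact: smooth_step'_bound.
(* The constant 8 of the statement is the slope bound 4 of the step times the factor 2 of
   [base_bilipschitz]. *)
apply: le_trans (_ : C * (4 / L * (2 * norm1 (Y x' - Y x))) <= _).
  by rewrite ler_pM2l //; apply: ler_pM => //; exact: norm1_ge0.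
have -> : C * (4 / L * (2 * norm1 (Y x' - Y x))) = (8 * C * norm1 (Y x' - Y x)) / L.
  by field; rewrite gt_eqF.
by rewrite ler_pdivrMr // mul1r.
Qed.

Lemma C1_at_scale (phi : R -> R) (c t : R) : C1_at phi t ->
  C1_at (fun s => c * phi s) t /\ derive1 (fun s => c * phi s) t = c * derive1 phi t.
Proof.
move=> [pd pc].
have D : \forall s \near t, is_derive (s : R) 1 (fun s => c * phi s : R) (c * derive1 phi s).
  apply: filterS pd => s sd.
  have H : is_derive s 1 phi (derive1 phi s) by rewrite derive1E; apply: DeriveDef.
  by apply: is_derive_eq; rewrite /GRing.scale /=; ring.
have D1 : \forall s \near t, derive1 (fun s => c * phi s) s = c * derive1 phi s.
  by apply: filterS D => s [_ <-]; rewrite derive1E.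
split; last exact: (nbhs_singleton D1).
split; first by apply: filterS D => s [].
suff : derive1 (fun s => c * phi s) @ t --> c * derive1 phi t by rewrite -(nbhs_singleton D1).
apply: cvg_trans (_ : (fun s => c * derive1 phi s) @ t --> _).
  by apply: near_eq_cvg; apply: filterS D1 => s ->.
by apply: cvgM; [exact: cvg_cst | exact: pc].
Qed.

End PathsInLocalIsometry.

(** * Convergence for the distance implies convergence in the manifold *)

Section DistanceTopology.
Variables (R : realType) (n : nat) (n_gt0 : (0 < n)%N).
Variables (M : manifold R n) (g : metric_on M) (g_riem : riemannian g).
Variables (S : manifold R n) (F : S -> M * R) (F_imm : immersion F).
Variable s0 : R.
Hypothesis F_height : forall p, (F p).2 = s0.
Hypothesis F_boundary : forall p, boundary p -> boundary (F p).1.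
Implicit Types (i : chart_index S) (j : chart_index M) (p : S).
Local Notation GI := (induced_metric g F).

Lemma chart_cube_nbhs (X : manifold R n) (i : chart_index X) (p : X) (d : R) :
  chart_dom i p -> 0 < d ->
  \forall q \near p, chart_dom i q /\ cube (crd i p) d (crd i q).
Proof.
move=> ip d0; apply: filterI.
  by apply: open_nbhs_nbhs; split=> //; exact: dom_open.
by apply: (crd_continuous ip); exact: cube_nbhs.
Qed.

Lemma image_cube_nbhs j p (d : R) : chart_dom j (F p).1 -> 0 < d ->
  \forall q \near p, chart_dom j (F q).1 /\ cube (crd j (F p).1) d (crd j (F q).1).
Proof.
move=> jp d0; have := chart_cube_nbhs jp d0; exact: (F_continuous1 F_imm).
Qed.

(** The image is compact in a Hausdorff space. Closedness in the whole manifold matters, since a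
    curve or a limit point could leave the domain of the chart. *)
Lemma par_half_box_closed (X : manifold R n) (i : chart_index X) (x : 'rV[R]_n) (r : R) :
  half_box x r `<=` @chart_cod _ _ X i -> closed ((@par _ _ X i) @` half_box x r).
Proof.
move=> bc; apply: compact_closed; first exact: man_hausdorff.
apply: continuous_compact; last exact: half_box_compact.
by apply: continuous_subspaceW bc _; exact: par_continuous.
Qed.

(* A path leaving a small coordinate cube has length bounded below: up to its first exit its
   image in a chart of [M] moves by a definite amount, at speed controlled by [g]. *)
Lemma dist_cube i p (e : R) : chart_dom i p -> 0 < e ->
  exists2 eta : R, 0 < eta & forall q, (dist GI q p < eta%:E)%E ->
    chart_dom i q /\ cube (crd i p) e (crd i q).
Proof.
move=> ip e0; set x0 := crd i p; pose j := chart_at (F p).1.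
have jp : chart_dom j (F p).1 := dom_chart_at _.
set Y := base F i j; have Yx0 : Y x0 = crd j (F p).1 by rewrite /Y /base crdK.
have Hx0 : halfspace n x0 := crd_halfspace ip.
have [d1 d10 [dU [c c0 dc]]] := base_bilipschitz n_gt0 F_imm F_height ip jp.
rewrite -/x0 -/Y in dU dc.
have gcont a b : {within @chart_cod _ _ M j, continuous (fun y => g j (par j y) a b)}.
  by case: g_riem => _ _ gs _; have [] := gs j a b 0%N.
have gpos : posdef (g j (par j (Y x0))).
  by rewrite Yx0 crdK //; exact: riemannian_posdef.
have Ycod : @chart_cod _ _ M j (Y x0) by rewrite Yx0; exact: crd_cod.
have [d0 d00 [C C0 gC]] := metric_comparison Ycod gpos gcont.
have [k|d2 d20 dY] := @finite_cube _ _ 'I_n x0 (map_dom F i j)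
    (fun k y => `|Y y ord0 k - Y x0 ord0 k| < d0).
  have [/within_contP Yc _] := base_smooth F_imm i j 0 k.
  exact: Yc (map_dom_crd ip jp) d00.
pose r := Num.min e (Num.min d1 d2) / 2.
have r0 : 0 < r by rewrite divr_gt0 // !lt_min e0 d10.
have [re rd1 rd2] : [/\ r < e, r < d1 & r < d2].
  have : Num.min e (Num.min d1 d2) <= e by rewrite ge_min lexx.
  have : Num.min e (Num.min d1 d2) <= d1 by rewrite !ge_min lexx orbT.
  have : Num.min e (Num.min d1 d2) <= d2 by rewrite !ge_min lexx !orbT.
  have : 0 < Num.min e (Num.min d1 d2) by rewrite !lt_min e0 d10.
  by rewrite /r => *; split; lra.
have nR : 0 < n%:R :> R by rewrite ltr0n.
(* A curve of length below [eta] moves each image coordinate by at most [C * eta], hence the image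
   by at most [n C eta] and the point in the chart by at most [c n C eta = r / 2], too little to
   reach the outer faces of the cube. *)
pose eta := r / (2 * (c * (n%:R * C))).
have eta0 : 0 < eta by rewrite divr_gt0 // !mulr_gt0.
exists eta => // q /ereal_inf_lt [l [gam [a [b [[ab gC1] ga gb ->]]]] len].
pose O (q : S) := chart_dom i q /\ cube x0 r (crd i q).
suff : O q by move=> [iq qr]; split=> //; exact: cube_le (ltW re) _ qr.
apply: contrapT => nOq.
have Onbhs q' : O q' -> \forall q'' \near q', O q''.
  move=> [iq' xq']; have [d d_gt0 dsub] := cube_open xq'.
  by apply: filterS (chart_cube_nbhs iq' d_gt0) => q'' [? ?]; split=> //; exact: dsub.
have boxcod : half_box x0 r `<=` @chart_cod _ _ S i.
  move=> x [Hx xr]; have [] // : map_dom F i j x.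
  by apply: dU => // k; apply: le_lt_trans rd1.
pose K := (@par _ _ S i) @` half_box x0 r.
have Kcl : closed K by exact: par_half_box_closed.
have OK q' : O q' -> K q'.
  move=> [iq' xq']; exists (crd i q'); last by rewrite crdK.
  by split=> [|k]; [exact: crd_halfspace | apply: ltW; exact: xq'].
have gpath t : a <= t <= b -> C1_path_at gam t.
  by move=> /gC1 [? ?]; split.
(* The curve runs from [q] to [p], so [T] is its last time outside the open set [O]. Since [K] is
   closed and contains [O], the point at time [T] still lies in [K], and the chart estimates hold on
   all of [[T, b]]. *)
pose B := [set t | a <= t <= b /\ ~ O (gam t)].
have Ba : B a by split; [rewrite lexx | rewrite ga].
have Bub : has_ubound B by exists b => t [/andP[]].
have Bne : B !=set0 by exists a.
set T := sup B.
have aT : a <= T by exact: ub_le_sup Bub _ Ba.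
have Tb : T <= b by apply: ge_sup => // t [/andP[]].
have OT : ~ O (gam T).
  move=> OT; have [gc _] := gpath T (introT andP (conj aT Tb)).
  have /nbhs_ballP [d /= d_gt0 dO] := gc _ (Onbhs _ OT).
  have [t Bt tT] := sup_adherent d_gt0 (conj Bne Bub).
  have tT' : t <= T by exact: ub_le_sup Bub _ Bt.
  have [_] := Bt; apply; apply: (dO t).
  by rewrite -ball_normE /= ger0_norm ?subr_ge0 //; rewrite -/T in tT; lra.
have Ob : O (gam b) by rewrite gb; split=> //; exact: cube_center.
have TltB : T < b by rewrite lt_neqAle Tb andbT; apply/eqP => E; apply: OT; rewrite E.
have Oafter t : T < t <= b -> O (gam t).
  move=> /andP[Tt tb]; apply: contrapT => nO; have : t <= T.
    by apply: (ub_le_sup Bub); split=> //; rewrite tb andbT (le_trans aT) // ltW.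
  by rewrite leNgt Tt.
have KT : K (gam T).
  apply: contrapT => nK; have [gc _] := gpath T (introT andP (conj aT Tb)).
  have : \forall s \near T, ~ K (gam s).
    have nKc : nbhs (gam T) (~` K) by apply: open_nbhs_nbhs; split=> //; exact: closed_openC.
    exact: (gc _ nKc).
  move=> /nbhs_ballP [d /= d_gt0 dK].
  pose s := Num.min b (T + d / 2).
  have sT : T < s by rewrite lt_min TltB ltrDl divr_gt0.
  have sb : s <= b by rewrite ge_min lexx.
  have sd : s <= T + d / 2 by rewrite ge_min lexx orbT.
  apply: (dK s); last by apply: OK; apply: Oafter; rewrite sT.
  by rewrite -ball_normE /= distrC ger0_norm ?subr_ge0 ?(ltW sT) //; lra.
have Kall t : T <= t <= b -> K (gam t).
  by rewrite le_eqVlt => /andP[/orP[/eqP <- //|Tt] tb]; apply: OK; apply: Oafter; rewrite Tt.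
have Kinfo t : T <= t <= b -> chart_dom j (F (gam t)).1 /\ cube (Y x0) d0 (crd j (F (gam t)).1).
  move=> /Kall [x [Hx xr] E]; have Ux : map_dom F i j x.
    by apply: dU => // k; apply: le_lt_trans rd1.
  have [_ jx] := Ux; rewrite -E; split=> // k.
  by apply: (dY x Ux _ k) => l'; apply: le_lt_trans rd2.
have [xT [HxT xTr] ET] := KT.
have lenk k : `|(Y x0 - Y xT) ord0 k| <= C * eta.
  pose phi t := crd j (F (gam t)).1 ord0 k.
  have phiC t : T <= t <= b -> C1_at phi t.
    move=> tT; apply: (image_C1 F_imm); last by have [] := Kinfo t tT.
    by apply: gpath; move/andP: tT => [Tt ->]; rewrite (le_trans aT).
  have phisp t : T <= t <= b -> `|derive1 (fun s => C^-1 * phi s) t| <= speed GI gam t.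
    move=> tT; have [jt yt] := Kinfo t tT.
    have [_ ->] := C1_at_scale C^-1 (phiC t tT).
    have pt : C1_path_at gam t.
      by apply: gpath; move/andP: tT => [Tt ->]; rewrite (le_trans aT).
    rewrite (speed_image g_riem F_imm F_height pt jt); set V := \row__ _.
    have [/(_ k) Vk _] := gC (crd j (F (gam t)).1) V (crd_cod jt) yt.
    rewrite crdK // in Vk; rewrite normrM gtr0_norm ?invr_gt0 // mulrC ler_pdivrMr // mulrC.
    by apply: le_trans Vk; rewrite mxE.
  have := @C1_at_integral_bound R (fun s => C^-1 * phi s) (speed GI gam) a T b aT TltB.
  have C1s t : T <= t <= b -> C1_at (fun s => C^-1 * phi s) t.
    by move=> tT; have [] := C1_at_scale C^-1 (phiC t tT).
  move=> /(_ C1s (fun t => sqrtr_ge0 _) phisp) H.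
  have := le_lt_trans H len; rewrite lte_fin -mulrBr normrM gtr0_norm ?invr_gt0 //.
  rewrite mulrC ltr_pdivrMr // mulrC => /ltW; congr (_ <= _).
  by rewrite /phi gb -ET -Yx0 !mxE.
have xsd1 : cube x0 d1 xT by move=> k; apply: le_lt_trans rd1.
have [H _] := dc xT x0 HxT Hx0 xsd1 (cube_center x0 d10).
have : norm1 (xT - x0) <= r / 2.
  rewrite norm1B; apply: le_trans H _; apply: le_trans (_ : c * (n%:R * (C * eta)) <= _).
    by rewrite ler_pM2l //; exact: norm1_le.
  by rewrite /eta le_eqVlt; apply/orP; left; apply/eqP; field; rewrite !gt_eqF.
move=> small; apply: OT; rewrite -ET; split; first exact: par_dom (boxcod _ _).
rewrite parK; last exact: boxcod.
move=> k; have := norm1_coord (xT - x0) k; rewrite !mxE => xk.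
by apply: le_lt_trans xk _; lra.
Qed.

(** This turns the limit for [dist] supplied by completeness into a topological one. *)
Lemma dist_nbhs p (B : set S) : nbhs p B ->
  exists2 eta : R, 0 < eta & forall q, (dist GI q p < eta%:E)%E -> B q.
Proof.
move=> nB; pose i := chart_at p; have ip : chart_dom i p := dom_chart_at p.
have [|d d0 dB] := (within_cubeP _ _).1 (@par_continuous _ _ S i) (crd i p) B (crd_cod ip).
  by rewrite crdK.
have [eta eta0 H] := dist_cube ip d0; exists eta => // q /H [iq xq].
by rewrite -(crdK iq); apply: dB => //; exact: crd_cod.
Qed.

End DistanceTopology.

(** * Descent along paths and surjectivity of the projection *)

Section Completeness.
Variables (R : realType) (n : nat) (n_gt0 : (0 < n)%N).
Variables (M : manifold R n) (g : metric_on M) (g_riem : riemannian g).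
Variables (S : manifold R n) (F : S -> M * R) (F_imm : immersion F).
Variable s0 : R.
Hypothesis F_height : forall p, (F p).2 = s0.
Hypothesis F_boundary : forall p, boundary p -> boundary (F p).1.
Implicit Types (i : chart_index S) (j : chart_index M) (p q : S).
Local Notation GI := (induced_metric g F).
Hypothesis GI_complete : riem_complete GI.

(** Both orientations are recorded, which spares the reversal of curves when [dist] is estimated for
    the Cauchy condition. *)
Definition connects p q (L : R) : Prop := joins GI p q L /\ joins GI q p L.

Lemma connects_trans p q r (L L' : R) :
  connects p q L -> connects q r L' -> connects p r (L + L').
Proof.
move=> [pq qp] [qr rq]; split; first exact: joins_trans qr.
by rewrite addrC; exact: joins_trans qp.
Qed.

(* Ekeland's argument: an almost steepest descent is a Cauchy sequence, since its length is
   controlled by the decrease of [phi]; its limit admits no further descent step. *)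
Lemma descent (Om : set S) (phi : S -> R) (K : R) (p0 : S) :
  0 < K -> (forall p, 0 <= phi p) -> closed Om ->
  (forall p, Om p -> forall e : R, 0 < e -> \forall q \near p, `|phi q - phi p| < e) ->
  (forall p, Om p -> 0 < phi p -> exists p', [/\ Om p', phi p' < phi p &
     \forall q \near p, connects q p' (K * (phi q - phi p'))]) ->
  Om p0 -> exists2 p, Om p & phi p = 0.
Proof.
move=> K0 phi_ge0 Om_closed phi_cont step Om0; apply: contrapT => none.
have phi_gt0 p : Om p -> 0 < phi p.
  move=> Op; rewrite lt_def phi_ge0 andbT; apply/eqP => p_eq0; apply: none; by exists p.
pose A p p' := Om p' /\ connects p p' (K * (phi p - phi p')).
have A_lt p p' : A p p' -> phi p' < phi p.
  by move=> [_ [[+ _] _]]; rewrite pmulr_rgt0 // subr_gt0.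
(* [s p] achieves at least half of the decrease that any admissible step from [p] could give: its
   value lies below the midpoint of [phi p] and the infimum. Outside [Om] the choice is a dummy. *)
have /choice [s sP] : forall p, exists p', Om p ->
    A p p' /\ forall p'', A p p'' -> phi p' <= (phi p + phi p'') / 2.
  move=> p; have [Op|nOp] := pselect (Om p); last by exists p.
  pose E := phi @` A p.
  have [p1 [Op1 _ /nbhs_singleton cp1]] := step p Op (phi_gt0 p Op).
  have E1 : E (phi p1) by exists p1.
  have Elb : has_lbound E by exists 0 => _ [p' _ <-]; exact: phi_ge0.
  have m_lt : inf E < phi p.
    by apply: le_lt_trans (ge_inf Elb E1) _; apply: A_lt.
  have e0 : 0 < (phi p - inf E) / 2 by rewrite divr_gt0 // subr_gt0.
  have [_ [p' Ap' <-] p'lt] := inf_adherent e0 (conj (ex_intro _ _ E1) Elb).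
  exists p' => _; split=> // p'' Ap''.
  have m_le : inf E <= phi p'' by apply: ge_inf Elb _ _; exists p''.
  by lra.
pose u k := iter k s p0.
have Ou k : Om (u k) by elim: k => // k IH; have [[]] := sP _ IH.
have Au k : A (u k) (u k.+1) by have [] := sP _ (Ou k).
have conn k l : (k < l)%N -> connects (u k) (u l) (K * (phi (u k) - phi (u l))).
  elim: l => // l IH; rewrite ltnS leq_eqVlt => /orP[/eqP ->|/IH kl]; first by have [] := Au l.
  have -> : K * (phi (u k) - phi (u l.+1)) =
    K * (phi (u k) - phi (u l)) + K * (phi (u l) - phi (u l.+1)) by ring.
  by apply: connects_trans kl _; have [] := Au l.
have anti k l : (k <= l)%N -> phi (u l) <= phi (u k).
  rewrite leq_eqVlt => /orP[/eqP -> //|kl]; have [[]] := conn k l kl.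
  by rewrite pmulr_rgt0 // subr_gt0 => /ltW.
pose E := range (fun k => phi (u k)).
have Elb : has_lbound E by exists 0 => _ [k _ <-]; exact: phi_ge0.
have E0 : E !=set0 by exists (phi (u 0%N)); exists 0%N.
have tail (e : R) : 0 < e -> exists N, forall k l, (N <= k)%N -> (N <= l)%N ->
    phi (u k) - phi (u l) < e.
  move=> e0; have [_ [N _ <-] Ne] := inf_adherent e0 (conj E0 Elb).
  exists N => k l Nk _; have : inf E <= phi (u l) by apply: ge_inf Elb _ _; exists l.
  by have := anti _ _ Nk; lra.
have [|p pP] := GI_complete (u := u).
  (* The factor 2 serves the case [k = l]: as [joins] has positive length, [u k] is joined to itself
     by a loop through [u k.+1]. *)
  move=> e e0; have K20 : 0 < 2 * K by exact: mulr_gt0.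
  have [N NP] := tail (e / (2 * K)) (divr_gt0 e0 K20).
  exists N => k l Nk Nl.
  have small k' l' : (N <= k')%N -> (N <= l')%N -> 2 * K * (phi (u k') - phi (u l')) < e.
    by move=> Nk' Nl'; have := NP k' l' Nk' Nl'; rewrite ltr_pdivlMr // mulrC.
  have Klt (d : R) : 0 < K * d -> 2 * K * d < e -> K * d < e by lra.
  have [kl|lk|<-] := ltngtP k l.
  - have [H _] := conn k l kl; apply: le_lt_trans (dist_joins H) _; rewrite lte_fin.
    by apply: Klt (small _ _ Nk Nl); case: H.
  - have [_ H] := conn l k lk; apply: le_lt_trans (dist_joins H) _; rewrite lte_fin.
    by apply: Klt (small _ _ Nl Nk); case: H.
  have [_ [H1 H2]] := Au k; apply: le_lt_trans (dist_joins (joins_trans H1 H2)) _.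
  rewrite lte_fin; have := small k k.+1 Nk (leqW Nk); lra.
have u_near B : nbhs p B -> exists N, forall k, (N <= k)%N -> B (u k).
  move=> nB; have [eta eta0 H] := dist_nbhs n_gt0 g_riem F_imm F_height nB.
  by have [N NP] := pP eta eta0; exists N => k /NP /H.
have Op : Om p.
  apply: Om_closed => B /u_near [N NP]; exists (u N); split; first exact: Ou.
  exact: NP.
have [p' [Op' p'p cp']] := step p Op (phi_gt0 p Op).
(* The step to [p'] is available from all points near [p], in particular from [u N]. By the choice
   of [s], [phi (u N.+1)] is at most the midpoint of [phi (u N)] and [phi p'], which is below
   [phi p - 7 e / 2], although it differs from [phi p] by less than [e]. *)
pose e := (phi p - phi p') / 8.
have e0 : 0 < e by rewrite divr_gt0 // subr_gt0.
have [N NP] := u_near _ (filterI cp' (phi_cont p Op e e0)).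
have [cN] := NP N (leqnn _); have [_] := NP N.+1 (leqnSn _).
rewrite !ltr_norml => /andP[h1 _] /andP[_ h2].
have [_ /(_ p' (conj Op' cN))] := sP _ (Ou N).
by rewrite -[s _]/(u N.+1) /e in h1 h2 *; lra.
Qed.

(** [descent] is applied to [phi], the coordinate distance of the projection to [y1]. [Om] is closed
    because the box around [y1] lies inside the chart. A descent step moves the image along the
    segment towards [y1], and [base_local_open] supplies a nearby point of Sigma above it. *)
Lemma base_reach j (y1 : 'rV[R]_n) (rho d0 C : R) p0 : 0 < C -> rho < d0 ->
  half_box y1 rho `<=` @chart_cod _ _ M j -> halfspace n y1 ->
  (forall y v : 'rV[R]_n, @chart_cod _ _ M j y -> cube y1 d0 y ->
     Num.sqrt (inner (g j (par j y)) v v) <= C * norm1 v) ->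
  chart_dom j (F p0).1 -> norm1 (crd j (F p0).1 - y1) <= rho ->
  exists p, (F p).1 = par j y1.
Proof.
move=> C0 rd boxcod Hy1 gC jp0 p0rho.
pose phi p := norm1 (crd j (F p).1 - y1).
pose Om := [set p | chart_dom j (F p).1 /\ phi p <= rho].
have box_of p : chart_dom j (F p).1 -> phi p <= rho -> half_box y1 rho (crd j (F p).1).
  move=> jp pr; split=> [|k]; first exact: crd_halfspace.
  by apply: le_trans pr; have := norm1_coord (crd j (F p).1 - y1) k; rewrite !mxE.
have nR : 0 < n%:R :> R by rewrite ltr0n.
have phi_cont p : chart_dom j (F p).1 -> forall e : R, 0 < e ->
    \forall q \near p, chart_dom j (F q).1 /\
      norm1 (crd j (F q).1 - crd j (F p).1) <= e.
  move=> jp e e0; have en : 0 < e / n%:R by exact: divr_gt0.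
  apply: filterS (image_cube_nbhs F_imm jp en) => q [jq xq]; split=> //.
  have -> : e = n%:R * (e / n%:R) by rewrite mulrC divfK // gt_eqF.
  by apply: norm1_le => k; rewrite !mxE; exact/ltW/xq.
have phi_diff p q : `|phi q - phi p| <= norm1 (crd j (F q).1 - crd j (F p).1).
  rewrite ler_norml; apply/andP; split.
    have := norm1D (crd j (F p).1 - crd j (F q).1) (crd j (F q).1 - y1).
    by rewrite addrA subrK norm1B -/(phi p) -/(phi q); lra.
  have := norm1D (crd j (F q).1 - crd j (F p).1) (crd j (F p).1 - y1).
  by rewrite addrA subrK -/(phi p) -/(phi q); lra.
(* The constant is the [8 * C] of [chart_line_joins] times the factor 2 of the estimate [D]
   below. *)
have K0 : 0 < 16 * C by exact: mulr_gt0.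
have Om0 : Om p0 by split.
have phi_ge0 p : 0 <= phi p by exact: norm1_ge0.
have [p clp|p Op e e0|p [jp pr] p_gt0|p Op p_eq0] := @descent Om phi _ p0 K0 phi_ge0 _ _ _ Om0.
-  have jp : chart_dom j (F p).1.
    have : closed ((fun p => (F p).1) @^-1` (par j @` half_box y1 rho)).
      apply: closed_comp; last exact: par_half_box_closed.
      by move=> q _; exact: (F_continuous1 F_imm).
    move=> /(_ p) H; have [|y yb E] := H.
      move=> B nB; have [q [[jq qr] Bq]] := clp B nB; exists q; split=> //.
      by exists (crd j (F q).1); [exact: box_of | rewrite crdK].
    by rewrite -E; apply: par_dom; exact: boxcod.
  split=> //; rewrite leNgt; apply/negP => rp.
  have e0 : 0 < (phi p - rho) / 2 by rewrite divr_gt0 // subr_gt0.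
  have [q [[_ qr] [_ H]]] := clp _ (phi_cont p jp _ e0).
  have := le_trans (phi_diff p q) H; rewrite ler_norml => /andP[+ _]; lra.
- have e2 : 0 < e / 2 by exact: divr_gt0.
  apply: filterS (phi_cont p Op.1 _ e2) => q [_ H].
  by apply: le_lt_trans (phi_diff p q) _; apply: le_lt_trans H _; lra.
- pose i := chart_at p; have ip : chart_dom i p := dom_chart_at p.
  set z := crd j (F p).1; set x0 := crd i p; set Y := base F i j.
  have Yx0 : Y x0 = z by rewrite /Y /base crdK.
  have pcube : cube y1 d0 z by move=> k; apply: le_lt_trans rd; have [] := box_of p jp pr.
  have [d d_gt0 dj] := chart_line_joins n_gt0 g_riem F_imm F_height ip jp gC C0 pcube.
  have [eta eta0 etaP] := base_local_open n_gt0 F_imm F_height F_boundary ip jp d_gt0.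
  rewrite -/x0 -/Y in dj etaP.
  (* The new image is at distance [tau * phi p < eta] from [z], within reach of [base_local_open];
     [tau <= 1] keeps it on the segment to [y1], hence in the half-space. *)
  pose tau := Num.min 1 (eta / (2 * phi p)).
  have p2 : 0 < 2 * phi p by exact: mulr_gt0.
  have tau0 : 0 < tau by rewrite lt_min ltr01 divr_gt0.
  have tau1 : tau <= 1 by rewrite ge_min lexx.
  have taueta : tau * phi p < eta.
    have : tau <= eta / (2 * phi p) by rewrite ge_min lexx orbT.
    by rewrite ler_pdivlMr //; have := mulr_gt0 tau0 p_gt0; lra.
  pose y := z + tau *: (y1 - z).
  have yz : norm1 (y - z) = tau * phi p.
    by rewrite /y addrC addKr norm1Z ger0_norm ?(ltW tau0) // norm1B.
  have Hy : halfspace n y.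
    by apply: affine_halfspace => //; [rewrite (ltW tau0) | exact: crd_halfspace].
  have [|x' [Ux' xx' Yx']] := etaP y Hy; first by rewrite Yx0 yz.
  pose p' : S := par i x'.
  have jp' : chart_dom j (F p').1 by have [] := Ux'.
  have p'y : crd j (F p').1 = y by exact: Yx'.
  have phip' : phi p' = (1 - tau) * phi p.
    rewrite /phi p'y; have -> : y - y1 = (1 - tau) *: (z - y1).
      by apply/rowP => k; rewrite /y !mxE; ring.
    by rewrite norm1Z ger0_norm // subr_ge0.
  have tp : 0 < tau * phi p by exact: mulr_gt0.
  exists p'; split.
  + by split=> //; apply: le_trans pr; rewrite phip'; lra.
  + by rewrite phip'; lra.
  (* For [q] this close to [p], the image of [q] is at most [4/3 tau phi p] away from [y], while
     [phi q - phi p'] is at least [2/3 tau phi p]; the ratio is the factor 2 of [D]. *)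
  have tp3 : 0 < tau * phi p / 3 by exact: divr_gt0.
  apply: filterS (filterI (chart_cube_nbhs ip d_gt0) (phi_cont p jp _ tp3)).
  move=> q [[iq xq] [jq yq]].
  have D : norm1 (Y x' - Y (crd i q)) <= 2 * (phi q - phi p').
    have YE : Y (crd i q) = crd j (F q).1 by rewrite /Y /base crdK.
    rewrite Yx' YE; have := norm1D (y - z) (z - crd j (F q).1).
    rewrite addrA subrK yz [norm1 (z - _)]norm1B.
    have := le_trans (phi_diff p q) yq; rewrite ler_norml phip' => /andP[h1 _].
    by rewrite -/z in yq; lra.
  have L0 : 0 < 16 * C * (phi q - phi p').
    rewrite !mulr_gt0 // phip'.
    by have := le_trans (phi_diff p q) yq; rewrite ler_norml => /andP[h1 _]; lra.
  have DC : 8 * C * norm1 (Y x' - Y (crd i q)) <= 16 * C * (phi q - phi p').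
    have -> : 16 * C * (phi q - phi p') = 8 * C * (2 * (phi q - phi p')) by ring.
    by rewrite ler_pM2l // mulr_gt0.
  have Hx' : halfspace n x' by case: Ux' => /(cod_ropen i).1.
  have Hq := crd_halfspace iq.
  split; rewrite -{1}(crdK iq); apply: dj => //; by rewrite // norm1B.
exists p; have -> : y1 = crd j (F p).1.
  have : crd j (F p).1 - y1 = 0 by apply: norm1_eq0; rewrite -/(phi p) p_eq0.
  by move/eqP; rewrite subr_eq0 => /eqP.
by rewrite crdK //; case: Op.
Qed.

Lemma base_surjective : connected [set: M] -> [set: S] !=set0 -> forall q : M, exists p, (F p).1 = q.
Proof.
move=> Mconn [p0 _].
pose f p := (F p).1.
have loc (q : M) : exists2 V, nbhs q V & forall q0 q1 : M, V q0 -> V q1 -> range f q0 -> range f q1.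
  pose j := chart_at q; have jq : chart_dom j q := dom_chart_at q.
  set y := crd j q; have ycod : @chart_cod _ _ M j y by exact: crd_cod.
  have gcont a b : {within @chart_cod _ _ M j, continuous (fun y => g j (par j y) a b)}.
    by case: g_riem => _ _ gs _; have [] := gs j a b 0%N.
  have gpos : posdef (g j (par j y)) by rewrite /y crdK //; exact: riemannian_posdef.
  have [d d_gt0 [C C0 gC]] := metric_comparison ycod gpos gcont.
  have [d' d'_gt0 dcod] := (cod_ropen j).2 _ ycod.
  pose r := Num.min d d'; have r0 : 0 < r by rewrite lt_min d_gt0.
  have [rd rd'] : r <= d /\ r <= d' by rewrite /r !ge_min !lexx orbT.
  have nR : 0 < n%:R :> R by rewrite ltr0n.
  (* Two points of the neighbourhood are at [norm1]-distance at most [2 n e = r / 2]. As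
     [e <= r / 4], the cube of radius [r / 2 + r / 4] around [y1] stays within [r] of [y], where
     both the chart and the metric comparison are available. *)
  pose e := r / (4 * n%:R); have e0 : 0 < e by rewrite divr_gt0 // mulr_gt0.
  have ne : n%:R * e = r / 4 by rewrite /e; field; rewrite gt_eqF.
  have er : e <= r / 4.
    by rewrite -ne ler_peMl ?(ltW e0) // ler1n.
  exists [set q' | chart_dom j q' /\ cube y e (crd j q')]; first exact: chart_cube_nbhs.
  move=> q0 q1 [jq0 yq0] [jq1 yq1] [p _ pq0].
  set y1 := crd j q1.
  have near1 (c : R) (v : 'rV[R]_n) : c <= r / 2 + r / 4 -> (forall k, `|v ord0 k - y1 ord0 k| <= c) -> cube y r v.
    move=> cr vc k; have := vc k; have := yq1 k; rewrite -/y1.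
    have := ler_normD (v ord0 k - y1 ord0 k) (y1 ord0 k - y ord0 k).
    by rewrite addrA subrK; lra.
  have [||||||p' p'y] := @base_reach j y1 (r / 2) (r / 2 + r / 4) C p C0.
  - by lra.
  - move=> v [Hv vy]; apply: dcod; split=> //; apply: cube_le rd' _ _.
    by apply: near1 vy; lra.
  - exact: crd_halfspace.
  - move=> v w vcod vy; have [] // := gC v w vcod; apply: cube_le rd _ _.
    by apply: (near1 (r / 2 + r / 4)) => // k; exact/ltW/vy.
  - by rewrite -[(F p).1]/(f p) pq0.
  - rewrite -[(F p).1]/(f p) pq0.
    have -> : r / 2 = n%:R * (e + e) by rewrite mulrDr ne; field.
    apply: norm1_le => k; rewrite !mxE.
    have := yq0 k; have := yq1 k; have := ler_normB (crd j q0 ord0 k - y ord0 k) (y1 ord0 k - y ord0 k).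
    by rewrite opprB addrA subrK; lra.
  by exists p' => //; rewrite /f p'y /y1 crdK.
have op : open (range f).
  rewrite openE => q fq; have [V nV VP] := loc q; have Vq := nbhs_singleton nV.
  by apply: filterS nV => q' Vq'; exact: VP fq.
have cl : closed (range f).
  move=> q clq; have [V nV VP] := loc q; have [q' [fq' Vq']] := clq V nV.
  by apply: VP fq' => //; exact: (nbhs_singleton nV).
have E : range f = [set: M].
  apply: Mconn; first by exists (f p0), p0.
  - by exists (range f) => //; rewrite setTI.
  - by exists (range f) => //; rewrite setTI.
move=> q; have : range f q by rewrite E.
by move=> [p _ <-]; exists p.
Qed.

End Completeness.

Theorem theorem3p2 (R : realType) (n : nat) (n_gt0 : (0 < n)%N)
  (M : manifold R n) (g : metric_on M) (o : chart_index M -> M -> bool)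
  (g_riem : riemannian g) (M_complete : riem_complete g)
  (M_connected : connected [set: M]) (M_oriented : orientation o)
  (h : M -> R) (v : R -> R) (h_smooth : Cinf_fun h) (v_smooth : smooth_line v)
  (psi := fun q : M * R => h q.1 + v q.2)
  (lambda a : R) (lambda_ge0 : 0 <= lambda)
  (v_deriv : forall t, t <= a -> lambda <= derive1 v t)
  (S : manifold R n) (F : S -> M * R) (N : field_along M S)
  (S_neq0 : [set: S] !=set0) (S_connected : connected [set: S])
  (F_imm : immersion F) (N_gauss : gauss_map g F N)
  (S_parabolic : parabolic (induced_metric g F) (psi \o F))
  (S_below : forall p, (F p).2 <= a)
  (H := weighted_mean_curvature g F N psi)
  (H_bound : (forall p, `|H p| <= lambda) \/
     ((forall p, angle g F N p <= 0) /\ (forall p, H p <= lambda))) :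
  ((@boundary _ _ S) !=set0 -> tangent_to_slice F a ->
     range F `<=` [set q | q.2 = a] /\
     forall q : M, slice_mean_curvature g psi a q = lambda)
  /\
  (riem_complete (induced_metric g F) -> free_boundary g F N ->
     exists s : R, range F = [set q | q.2 = s] /\
       forall q : M, slice_mean_curvature g psi s q = lambda).
Proof.
have v_der t : derivable v t 1 := v_smooth 0%N t.
have h1 := h_smooth 1%N.
have const : (forall p : S, boundary p ->
    0 <= conormal_deriv (induced_metric g F) (fun p => (F p).2) p) ->
    exists c, forall p, (F p).2 = c.
  move=> bd; apply: S_parabolic => //.
  - by move=> i; exact: height_Ck.
  - by exists a.
  - move=> p _; exact: (wlaplacian_height_ge0 n_gt0 g_riem F_imm N_gauss h1 v_der
      lambda_ge0 v_deriv S_below H_bound).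
(* The slice has the same curvature at all points of M, the derivative of [v] at [c]; one point of
   Sigma is enough to identify that number with [lambda]. *)
have curv c : (forall p, (F p).2 = c) -> forall q : M, slice_mean_curvature g psi c q = lambda.
  move=> Fc q; have [p _] := S_neq0; rewrite /psi slice_curvature //.
  exact: (height_cst_weight n_gt0 g_riem F_imm N_gauss h1 v_der p v_deriv S_below H_bound Fc).
split=> [[p0 bp0] tg|complete free].
  have [|c Fc] := const; first by move=> p bp; rewrite (conormal_deriv_tangent g_riem F_imm tg bp).
  have [Fa _] := tg p0 bp0; have ca : c = a by rewrite -(Fc p0).
  by rewrite -ca; split; [move=> _ [p _ <-]; exact: Fc | exact: curv].
have [|c Fc] := const.
  by move=> p bp; rewrite (conormal_deriv_free g_riem F_imm N_gauss free bp).
exists c; split; last exact: curv.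
apply/seteqP; split=> [_ [p _ <-]|[q t] /= ->]; first exact: Fc.
have F_boundary p : boundary p -> boundary (F p).1 by case: (free.1 p).
have [p pq] := base_surjective n_gt0 g_riem F_imm Fc F_boundary complete M_connected S_neq0 q.
by exists p => //; rewrite [LHS]surjective_pairing pq Fc.
Qed.
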